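(* Let $W$ be a digraphon. For every integer $\ell\ge 3$, $$t(C_\ell,W)=\sum_{\lambda\in\mathrm{Sp}(W)\setminus\{0\}}m_W(\lambda)\cdot\lambda^\ell,$$ where the sum is absolutely convergent.
   Context: A kernel is a bounded measurable function $W:[0,1]^2\to\mathbb{R}$, and a digraphon is a non-negative kernel $W$ such that $W(x,y)+W(y,x)\le 1$ for all $(x,y)\in[0,1]^2$. $C_\ell$ denotes the cyclically oriented (directed) cycle of length $\ell$. The homomorphism density of a digraph $H$ with vertex set $V(H)$ and set of directed edges $E(H)$ in $W$ is $$t(H,W)=\int_{[0,1]^{V(H)}}\prod_{uv\in E(H)}W(x_u,x_v)\,dx_{V(H)};$$ in particular $t(C_\ell,W)=\int_{[0,1]^\ell}W(x_1,x_2)W(x_2,x_3)\cdots W(x_{\ell-1},x_\ell)W(x_\ell,x_1)\,dx_1\cdots dx_\ell$. A kernel $W$ is identified with the (compact) integral operator on the complex Hilbert space $L_2[0,1]$ (Lebesgue measure) given by $(Wf)(x)=\int_{[0,1]}W(x,y)f(y)\,dy$. Its spectrum $\mathrm{Sp}(W)$ is the set of all $\lambda\in\mathbb{C}$ such that $W-\lambda\,\mathrm{Id}$ does not have a bounded inverse. Every non-zero point of $\mathrm{Sp}(W)$ is an eigenvalue, and its algebraic multiplicity is $m_W(\lambda)=\lim_{k\to\infty}\dim\ker\left((W-\lambda\,\mathrm{Id})^k\right)$, which is finite. *)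

(* Defs.v *)
From HB Require Import structures.
From mathcomp Require Import all_boot all_order all_algebra.
From mathcomp Require Import all_classical all_reals all_analysis.
From mathcomp Require Import complex.

Set Implicit Arguments.
Unset Strict Implicit.
Unset Printing Implicit Defensive.
Import Order.TTheory GRing.Theory Num.Theory.
Import numFieldNormedType.Exports.

Local Open Scope classical_set_scope.
Local Open Scope ring_scope.
Local Open Scope complex_scope.

Section digraphons.
Variable R : realType.

Definition I01 : set R := `[0, 1]%classic.

(* Functions on [0,1]^2 are represented by functions on R * R; their values
   outside [0,1]^2 are never used.  Measurable means Borel measurable. *)
Definition kernel (W : R * R -> R) : Prop :=
  measurable_fun (I01 `*` I01) W /\
  exists M : R, forall z, (I01 `*` I01) z -> `|W z| <= M.

Definition digraphon (W : R * R -> R) : Prop :=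
  [/\ kernel W,
      forall z, (I01 `*` I01) z -> 0 <= W z &
      forall x y, I01 x -> I01 y -> W (x, y) + W (y, x) <= 1].

End digraphons.
Arguments I01 {R}.

Section cube_measure.
Variable R : realType.
Local Notation RR := (measurableTypeR R).

Lemma measurable_I01 : measurable (@I01 R : set RR).
Proof. exact: measurable_itv. Qed.

Definition lebesgue01 : set RR -> \bar R :=
  mrestr (@lebesgue_measure R) measurable_I01.

HB.instance Definition _ := Measure.on lebesgue01.

Let lebesgue01_setT : lebesgue01 [set: RR] = 1%E.
Proof.
rewrite /lebesgue01 /mrestr setTI /I01 lebesgue_measure_itv /= lte_fin ltr01.
by rewrite oppr0 adde0.
Qed.

HB.instance Definition _ :=
  Measure_isProbability.Build _ _ _ lebesgue01 lebesgue01_setT.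

Definition tuple_cons n (z : RR * n.-tuple RR) : n.+1.-tuple RR :=
  [tuple of z.1 :: z.2].

Lemma measurable_tuple_cons n : measurable_fun setT (@tuple_cons n).
Proof. by apply: measurable_cons. Qed.

HB.instance Definition _ n :=
  isMeasurableFun.Build _ _ _ _ (@tuple_cons n) (@measurable_tuple_cons n).

(* The product measure on R^n of n copies of the Lebesgue measure of [0,1],
   obtained by transporting products along R * R^n -> R^(n+1). *)
Fixpoint cube_measure n : probability (n.-tuple RR) R :=
  match n with
  | 0%N => \d_([tuple] : 0.-tuple RR)
  | m.+1 => distribution (lebesgue01 \x cube_measure m)%E (@tuple_cons m)
  end.

Definition cube n : set (n.-tuple RR) := [set x | forall i, I01 (tnth x i)].

(* A digraph on the vertex set {0, .., n-1} is given by its edge relation. *)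
Definition hom_density n (H : rel 'I_n) (W : R * R -> R) : R :=
  \int[cube_measure n]_(x in @cube n)
    \prod_(e : 'I_n * 'I_n | H e.1 e.2) W (tnth x e.1, tnth x e.2).

End cube_measure.

(* ordS is the successor modulo l on 'I_l. *)
Definition dicycle l : rel 'I_l := [rel u v | v == ordS u].

Section L2.
Variable R : realType.
Local Notation C := R[i].
Local Notation mu := (@lebesgue_measure R).
Local Notation normc := Normc.normc.

(* Elements of the complex Hilbert space L_2[0,1] are represented by
   square-integrable functions f : R -> C (restricted to [0,1]), two functions
   being identified when they satisfy ae01 f g. *)
Definition L2 : set (R -> C) := [set f : R -> C |
  [/\ measurable_fun I01 (fun x => complex.Re (f x)),
      measurable_fun I01 (fun x => complex.Im (f x)) &
      (\int[mu]_(x in I01) (normc (f x) ^+ 2)%:E < +oo)%E]].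

Definition ae01 (f g : R -> C) : Prop := f = g %[ae mu in I01].

Definition L2norm (f : R -> C) : R :=
  Num.sqrt (\int[mu]_(x in I01) (normc (f x) ^+ 2)).

Definition bounded_operator (S : (R -> C) -> (R -> C)) : Prop :=
  [/\ forall f, L2 f -> L2 (S f),
      forall (a : C) f g, L2 f -> L2 g ->
        ae01 (S (fun x => a * f x + g x)) (fun x => a * S f x + S g x) &
      exists M : R, forall f, L2 f -> L2norm (S f) <= M * L2norm f].

Definition has_bounded_inverse (T : (R -> C) -> (R -> C)) : Prop :=
  exists S, [/\ bounded_operator S,
    forall f, L2 f -> ae01 (S (T f)) f &
    forall f, L2 f -> ae01 (T (S f)) f].

Definition linearly_independent n (f : 'I_n -> R -> C) : Prop :=
  forall a : 'I_n -> C,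
    ae01 (fun x => \sum_(i < n) a i * f i x) (fun=> 0) -> forall i, a i = 0.

(* The dimension, in the quotient of L2 by ae01, of the subspace consisting of
   the classes of the functions in K; +oo when it is infinite. *)
Definition dimension (K : set (R -> C)) : \bar R :=
  ereal_sup [set n%:R%:E | n in [set n | exists f : 'I_n -> R -> C,
    (forall i, K (f i)) /\ linearly_independent f]].

Definition Cintegral (f : R -> C) : C :=
  (\int[mu]_(x in I01) complex.Re (f x))
  +i* (\int[mu]_(x in I01) complex.Im (f x)).

Variable W : R * R -> R.

Definition integral_operator (f : R -> C) : R -> C :=
  fun x => Cintegral (fun y => (W (x, y))%:C * f y).

Definition shifted_operator (z : C) (f : R -> C) : R -> C :=
  fun x => integral_operator f x - z * f x.

Definition spectrum : set C :=
  [set z | ~ has_bounded_inverse (shifted_operator z)].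

Definition ker_power (z : C) (k : nat) : set (R -> C) :=
  [set f | L2 f /\ ae01 (iter k (shifted_operator z) f) (fun=> 0)].

Definition algebraic_multiplicity (z : C) : \bar R :=
  limn (fun k => dimension (ker_power z k)).

End L2.

Section complex_sums.
Variable R : realType.
Local Notation C := R[i].
Local Notation normc := Normc.normc.

(* Unconditional convergence of the sum of f over D to s, along the finite
   subsets of D ordered by inclusion. *)
Definition has_sum (D : set C) (f : C -> C) (s : C) : Prop :=
  forall e : R, 0 < e -> exists2 A, fsets D A &
    forall B, fsets D B -> A `<=` B -> normc (\sum_(z \in B) f z - s) < e.

End complex_sums.

(* Main.v *)
(* Replace the operator W by the matrices A n of its compressions to the step
   functions on n + 1 equal intervals.  Since W is the limit in L1 of its averages,
   the trace of (A n)^l tends to t(C_l, W).  Passing to the limit along an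
   ultrafilter G, the A n act on the Hilbert space ultraproduct of the C^(n+1);
   compactness of W identifies the generalized eigenspaces of this action for
   z <> 0 with those of W.  In the ultraproduct one can deflate: if A e = z e with
   |e| = 1, then (1 - e e^* ) A has the multiplicities of A except for one less at z,
   the trace of its l-th power is smaller by z^l, and its squared Frobenius norm
   drops by at least |z|^2.  After finitely many deflations no eigenvalue of modulus
   at least eps remains, neither in the ultraproduct nor, for G-almost all n, for
   the deflated matrices; hence the trace of their l-th power is at most
   eps^(l - 2) times the squared Frobenius norm, which tends to 0 with eps as
   l >= 3. *)

Require Import Defs.
From mathcomp Require Import all_boot all_order all_algebra.
From mathcomp Require Import all_classical all_reals all_analysis.
From mathcomp Require Import finmap measurable_realfun complex ring lra.

Set Implicit Arguments.
Unset Strict Implicit.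
Unset Printing Implicit Defensive.
Import Order.TTheory GRing.Theory Num.Theory.
Import numFieldNormedType.Exports.

Local Open Scope classical_set_scope.
Local Open Scope ring_scope.
Local Open Scope complex_scope.
Local Open Scope sesquilinear_scope.

(** * Frobenius norm *)

(** W need not be normal, so its eigenvectors give no orthogonal decomposition. Each deflation is
    one step of a Schur triangularization, which needs one unit eigenvector at a time and no basis.
    The obstacle to doing this at a fixed n is that an eigenvalue of W of multiplicity m is in
    general only the limit of a cluster of m eigenvalues of A n, whose eigenvectors may become
    parallel. Along G a cluster becomes one exact eigenvalue, coefficients become constants, and
    multiplicities can be followed exactly through every deflation. The entries of A n have modulus
    at most 1/(n+1), so its Frobenius norm is at most 1. Since the limit of the squared norm pays
    |z|^2 for each deflation, the sum of m(z) |z|^2 over any finite set of non-zero z is at most 1.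
    This inequality gives the absolute convergence, and bounds by eps^(l - 2) the part of the sum
    over the spectrum that comes from moduli at most eps. Of the spectrum itself, the argument uses
    that it contains the non-zero points of non-zero multiplicity; its other non-zero points
    contribute 0. *)

Lemma normcEC (R : rcfType) (z : R[i]) : (Normc.normc z)%:C = `|z|.
Proof. by []. Qed.

Lemma normc_ge0 (R : rcfType) (z : R[i]) : 0 <= Normc.normc z.
Proof. by case: z => a b; exact: sqrtr_ge0. Qed.

Lemma normc_eq0 (R : rcfType) (z : R[i]) : (Normc.normc z == 0) = (z == 0).
Proof.
apply/eqP/eqP => [/Normc.eq0_normc//|->]; exact: Normc.normc0.
Qed.

Lemma normc_conj (R : rcfType) (z : R[i]) : Normc.normc (Num.conj z) = Normc.normc z.
Proof. by apply: complexI; rewrite !normcEC norm_conjC. Qed.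

Lemma sqr_normcC (R : rcfType) (z : R[i]) :
  (Normc.normc z ^+ 2)%:C = z * Num.conj z.
Proof. by rewrite rmorphXn /= normcEC normCK. Qed.

Lemma sqr_normcE (R : rcfType) (z : R[i]) :
  Normc.normc z ^+ 2 = complex.Re z ^+ 2 + complex.Im z ^+ 2.
Proof. by case: z => a b /=; rewrite sqr_sqrtr// addr_ge0 ?sqr_ge0. Qed.

Lemma ler_normc_sum (R : rcfType) (I : Type) (r : seq I) (P : pred I) (f : I -> R[i]) :
  Normc.normc (\sum_(i <- r | P i) f i) <= \sum_(i <- r | P i) Normc.normc (f i).
Proof.
elim/big_rec2 : _ => [|i x y _ h]; first by rewrite Normc.normc0.
by rewrite (le_trans (le_normcD _ _))// lerD2l.
Qed.

Lemma normc_real (R : rcfType) (x : R) : Normc.normc x%:C = `|x|.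
Proof. by rewrite /= expr0n addr0 sqrtr_sqr. Qed.

Lemma normcX (R : rcfType) (z : R[i]) n : Normc.normc (z ^+ n) = Normc.normc z ^+ n.
Proof.
by elim: n => [|n ih]; rewrite ?expr0 ?Normc.normc1// !exprS Normc.normcM ih.
Qed.

(** Lagrange's identity: the double sum of the squared 2 by 2 minors is twice the difference of the
    two sides. *)
Lemma sum_CauchySchwarz (R : realFieldType) (I : finType) (a b : I -> R) :
  (\sum_i a i * b i) ^+ 2 <= (\sum_i a i ^+ 2) * (\sum_i b i ^+ 2).
Proof.
have : 0 <= \sum_i \sum_j (a i * b j - a j * b i) ^+ 2.
  by apply: sumr_ge0 => i _; apply: sumr_ge0 => j _; exact: sqr_ge0.
have -> : \sum_i \sum_j (a i * b j - a j * b i) ^+ 2 =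
  \sum_i \sum_j (a i ^+ 2 * b j ^+ 2) + \sum_i \sum_j (b i ^+ 2 * a j ^+ 2)
  - \sum_i \sum_j ((a i * b i) * (a j * b j)) *+ 2.
  rewrite -big_split -sumrB; apply: eq_bigr => i _.
  rewrite -big_split -sumrB; apply: eq_bigr => j _ /=; ring.
under [X in _ - X]eq_bigr do rewrite sumrMnl.
rewrite sumrMnl -!big_distrlr /= -expr2; nra.
Qed.

Section frobenius.
Variable R : realType.
Local Notation C := R[i].
Local Notation normc := Normc.normc.

Definition fnorm m n (A : 'M[C]_(m, n)) : R :=
  Num.sqrt (\sum_(p : 'I_m * 'I_n) normc (A p.1 p.2) ^+ 2).

Lemma fnorm_ge0 m n (A : 'M[C]_(m, n)) : 0 <= fnorm A.
Proof. exact: sqrtr_ge0. Qed.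
Hint Resolve fnorm_ge0 : core.

Lemma fnorm2 m n (A : 'M[C]_(m, n)) :
  fnorm A ^+ 2 = \sum_(p : 'I_m * 'I_n) normc (A p.1 p.2) ^+ 2.
Proof. by rewrite sqr_sqrtr// sumr_ge0// => p _; exact: sqr_ge0. Qed.

Lemma fnorm2_sum m n (A : 'M[C]_(m, n)) :
  fnorm A ^+ 2 = \sum_i \sum_j normc (A i j) ^+ 2.
Proof. by rewrite fnorm2 pair_big. Qed.

Lemma fnorm2_tr m n (A : 'M[C]_(m, n)) : (fnorm A ^+ 2)%:C = \tr (A *m A ^t*).
Proof.
rewrite fnorm2_sum rmorph_sum /mxtrace; apply: eq_bigr => i _.
rewrite rmorph_sum mxE; apply: eq_bigr => j _.
by rewrite /= sqr_normcC !mxE.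
Qed.

Lemma fnorm_le_normc m n (A : 'M[C]_(m, n)) i j : normc (A i j) <= fnorm A.
Proof.
rewrite -(@ler_pXn2r _ 2) ?nnegrE ?normc_ge0// fnorm2 (bigD1 (i, j))//=.
by rewrite lerDl sumr_ge0// => p _; exact: sqr_ge0.
Qed.

Lemma fnorm0 m n : fnorm (0 : 'M[C]_(m, n)) = 0.
Proof.
rewrite /fnorm big1 ?sqrtr0// => p _.
by rewrite mxE Normc.normc0 expr0n.
Qed.

Lemma fnormZ m n a (A : 'M[C]_(m, n)) : fnorm (a *: A) = normc a * fnorm A.
Proof.
apply/eqP; rewrite -(@eqrXn2 _ 2) ?mulr_ge0 ?normc_ge0// exprMn !fnorm2 mulr_sumr.
by apply/eqP/eq_bigr => p _; rewrite mxE Normc.normcM exprMn.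
Qed.

Lemma fnormN m n (A : 'M[C]_(m, n)) : fnorm (- A) = fnorm A.
Proof.
by rewrite -scaleN1r fnormZ (@normcN R 1) Normc.normc1 mul1r.
Qed.

Lemma fnormD m n (A B : 'M[C]_(m, n)) : fnorm (A + B) <= fnorm A + fnorm B.
Proof.
rewrite -(@ler_pXn2r _ 2) ?nnegrE ?addr_ge0// sqrrD !fnorm2.
pose x (p : 'I_m * 'I_n) := normc (A p.1 p.2).
pose y (p : 'I_m * 'I_n) := normc (B p.1 p.2).
apply: (@le_trans _ _ (\sum_p (x p + y p) ^+ 2)).
  apply: ler_sum => p _; rewrite ler_pXn2r ?nnegrE ?addr_ge0 ?normc_ge0//.
  by rewrite mxE le_normcD.
rewrite (eq_bigr (fun p => x p ^+ 2 + (x p * y p) *+ 2 + y p ^+ 2)); last first.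
  by move=> p _; rewrite sqrrD.
rewrite !big_split /= lerD2r lerD2l -mulr2n ler_pMn2r//.
rewrite -(@ler_pXn2r _ 2) ?nnegrE ?mulr_ge0//; last first.
  by apply: sumr_ge0 => p _; rewrite mulr_ge0 ?normc_ge0.
by rewrite exprMn !fnorm2; exact: sum_CauchySchwarz.
Qed.

Lemma fnormB m n (A B : 'M[C]_(m, n)) : fnorm (A - B) <= fnorm A + fnorm B.
Proof. by rewrite (le_trans (fnormD _ _))// fnormN. Qed.

Lemma fnormM m n p (A : 'M[C]_(m, n)) (B : 'M[C]_(n, p)) :
  fnorm (A *m B) <= fnorm A * fnorm B.
Proof.
rewrite -(@ler_pXn2r _ 2) ?nnegrE ?mulr_ge0// exprMn fnorm2_sum.
rewrite (fnorm2_sum A) (fnorm2_sum B) [X in _ <= _ * X]exchange_big big_distrlr /=.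
apply: ler_sum => i _; apply: ler_sum => j _.
apply: le_trans (sum_CauchySchwarz _ _).
rewrite ler_pXn2r ?nnegrE ?normc_ge0//; last first.
  by apply: sumr_ge0 => k _; rewrite mulr_ge0 ?normc_ge0.
rewrite mxE (le_trans (ler_normc_sum _ _ _))//.
by apply: ler_sum => k _; rewrite Normc.normcM.
Qed.

Lemma fnorm_adj m n (A : 'M[C]_(m, n)) : fnorm (A ^t*) = fnorm A.
Proof.
apply/eqP; rewrite -(@eqrXn2 _ 2)// !fnorm2_sum exchange_big /=; apply/eqP.
by apply: eq_bigr => i _; apply: eq_bigr => j _; rewrite !mxE normc_conj.
Qed.

Lemma normc_mxtraceM m n (A : 'M[C]_(m, n)) (B : 'M[C]_(n, m)) :
  normc (\tr (A *m B)) <= fnorm A * fnorm B.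
Proof.
rewrite -(@ler_pXn2r _ 2) ?nnegrE ?mulr_ge0 ?normc_ge0// exprMn -(fnorm_adj B) !fnorm2.
apply: le_trans (sum_CauchySchwarz _ _).
rewrite ler_pXn2r ?nnegrE ?normc_ge0//; last first.
  by apply: sumr_ge0 => k _; rewrite mulr_ge0 ?normc_ge0.
rewrite -(pair_big xpredT xpredT (fun i j => normc (A i j) * normc ((B ^t*) i j))) /=.
rewrite (le_trans (ler_normc_sum _ _ _))//; apply: ler_sum => i _.
rewrite mxE (le_trans (ler_normc_sum _ _ _))//; apply: ler_sum => j _.
by rewrite Normc.normcM !mxE normc_conj.
Qed.

Lemma fnorm1 (A : 'M[C]_1) : fnorm A = normc (A 0 0).
Proof.
apply/eqP; rewrite -(@eqrXn2 _ 2) ?normc_ge0// fnorm2_sum.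
by rewrite !big_ord1.
Qed.

Lemma fnorm_eq0 m n (A : 'M[C]_(m, n)) : (fnorm A == 0) = (A == 0).
Proof.
apply/eqP/eqP => [A0|->]; last exact: fnorm0.
apply/matrixP => i j; rewrite mxE; apply/eqP; rewrite -normc_eq0 eq_le normc_ge0.
by rewrite andbT -A0 fnorm_le_normc.
Qed.

Lemma trmxC_mul m n p (A : 'M[C]_(m, n)) (B : 'M[C]_(n, p)) :
  (A *m B) ^t* = B ^t* *m A ^t*.
Proof. by rewrite trmx_mul map_mxM. Qed.

(* In a Schur triangular form the diagonal consists of eigenvalues, and its
   squared length is at most that of the whole matrix. *)
Lemma normc_mxtraceX n (A : 'M[C]_n.+1) (e : R) l :
  (forall z, eigenvalue A z -> normc z < e) -> (2 <= l)%N ->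
  normc (\tr (A ^+ l)) <= e ^+ (l - 2) * fnorm A ^+ 2.
Proof.
move=> Ae l2; have [P Pu /= PA] := Schur A (ltn0Sn n).
have Punit := unitarymx_unit Pu.
set T := conjmx P A in PA.
have TE : T = P *m A *m invmx P by rewrite /T conjumx.
have TX k : T ^+ k = P *m A ^+ k *m invmx P.
  elim: k => [|k ih]; first by rewrite !expr0 mulmx1 mulmxV.
  rewrite !exprS ih TE -!mulmxE !mulmxA; congr (_ *m _ *m _).
  by rewrite -(mulmxA _ (invmx P)) mulVmx// mulmx1.
have trT k : \tr (A ^+ k) = \tr (T ^+ k).
  by rewrite TX mxtrace_mulC mulmxA mulVmx// mul1mx.
have /is_trig_mxP Ttrig := PA.
have eT i : normc (T i i) < e.
  apply: Ae; have : eigenvalue T (T i i).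
    rewrite eigenvalue_root_char char_poly_trig// rootE horner_prod.
    by rewrite (bigD1 i)//= hornerXsubC subrr mul0r.
  move=> /eigenvalueP[u uT u0]; apply/eigenvalueP; exists (u *m P).
    have PAT : P *m A = T *m P by rewrite TE mulmxKV.
    by rewrite -mulmxA PAT mulmxA uT scalemxAl.
  by apply: contra_neq u0 => uP0; rewrite -[u](mulmxK Punit) uP0 mul0mx.
have trigX k : is_trig_mx (T ^+ k) /\ forall i, (T ^+ k) i i = T i i ^+ k.
  elim: k => [|k [/is_trig_mxP ih1 ih2]].
    by split; [exact: scalar_mx_is_trig|move=> i; rewrite expr0 mxE eqxx].
  split.
    apply/is_trig_mxP => i j ij; rewrite exprS mxE big1// => h _.
    have [ih|hi] := ltnP i h; first by rewrite Ttrig ?mul0r.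
    by rewrite ih1 ?mulr0// (leq_ltn_trans hi).
  move=> i; rewrite exprS mxE (bigD1 i)//= ih2 -exprS big1 ?addr0// => h hi.
  have [ih|hi'] := ltnP i h; first by rewrite Ttrig ?mul0r.
  by rewrite ih1 ?mulr0// ltn_neqAle hi hi'.
have fT : fnorm T ^+ 2 = fnorm A ^+ 2.
  apply: complexI; rewrite !fnorm2_tr TE invmx_unitary// !trmxC_mul trmxCK.
  rewrite !mulmxA mxtrace_mulC !mulmxA -invmx_unitary// mulVmx// mul1mx.
  by rewrite -(mulmxA _ (invmx P)) mulVmx// mulmx1.
rewrite trT /mxtrace (le_trans (ler_normc_sum _ _ _))//.
apply: (@le_trans _ _ (\sum_i e ^+ (l - 2) * normc (T i i) ^+ 2)).
  apply: ler_sum => i _; rewrite (trigX l).2 normcX -{1}(subnK l2) exprD.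
  rewrite ler_wpM2r ?sqr_ge0// lerXn2r ?nnegrE ?normc_ge0 ?(ltW (eT i))//.
  exact: le_trans (normc_ge0 _) (ltW (eT i)).
rewrite -mulr_sumr ler_wpM2l//.
  by rewrite exprn_ge0// (le_trans (normc_ge0 (T 0 0)))// ltW.
rewrite -fT fnorm2_sum; apply: ler_sum => i _; rewrite (bigD1 i)//= lerDl.
by apply: sumr_ge0 => j _; exact: sqr_ge0.
Qed.

(** [eigenvalue] speaks of row vectors, whereas deflation uses columns; A and its transpose have the
    same characteristic polynomial. *)
Lemma eigenvector_unit n (A : 'M[C]_n.+1) z : eigenvalue A z ->
  exists v : 'cV[C]_n.+1, fnorm v = 1 /\ A *m v = z *: v.
Proof.
have -> : eigenvalue A z = eigenvalue A^T z.
  rewrite !eigenvalue_root_char /char_poly -[in RHS]det_tr /char_poly_mx.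
  by rewrite linearB /= tr_scalar_mx -map_trmx trmxK.
move=> /eigenvalueP[u uA u0].
have u0' : fnorm u^T != 0 by rewrite fnorm_eq0 trmx_eq0.
exists ((fnorm u^T)^-1%:C *: u^T); split.
  by rewrite fnormZ normc_real ger0_norm ?invr_ge0// mulVf.
by rewrite -scalemxAr -[A in LHS]trmxK -trmx_mul uA linearZ /= !scalerA mulrC.
Qed.

End frobenius.

#[local] Hint Extern 0 (is_true (0 <= fnorm _)) => exact: fnorm_ge0 : core.
#[local] Hint Extern 0 (is_true (0 <= Normc.normc _)) => exact: normc_ge0 : core.

(** * Bounded sequences of vectors modulo null sequences along an ultrafilter *)

Section ultra_limits.
Variables (R : realType) (G : set_system nat).
Hypothesis GU : UltraFilter G.
Local Notation C := R[i].
Local Notation normc := Normc.normc.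

Local Instance GP : ProperFilter G. Proof. exact: ultra_proper. Qed.

Definition small (x : nat -> R) := x n @[n --> G] --> (0 : R).

Lemma smallP (x : nat -> R) :
  small x <-> forall e, 0 < e -> \forall n \near G, `|x n| < e.
Proof.
split; first by move=> /cvgr0Pnorm_lt.
by move=> h; apply/cvgr0Pnorm_lt => e /h.
Qed.

Lemma small_le (x y : nat -> R) :
  (\forall n \near G, `|x n| <= y n) -> small y -> small x.
Proof.
move=> xy /smallP y0; apply/smallP => e /y0 ye; near=> n.
apply: (@le_lt_trans _ _ (y n)); first by near: n.
by rewrite (le_lt_trans (ler_norm _))//; near: n.
Unshelve. all: by end_near. Qed.

Lemma small_leT (x y : nat -> R) : (forall n, `|x n| <= y n) -> small y -> small x.
Proof. by move=> xy; apply: small_le; exact: nearW. Qed.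

Lemma small_ext (x y : nat -> R) : (forall n, x n = y n) -> small x -> small y.
Proof. by move=> /funext ->. Qed.

Lemma smallD x y : small x -> small y -> small (fun n => x n + y n).
Proof. by move=> x0 y0; rewrite /small -[0]addr0; exact: cvgD. Qed.

Lemma small_normr x : small x -> small (fun n => `|x n|).
Proof.
by move=> /smallP h; apply/smallP => e /h; apply: filterS => n; rewrite normr_id.
Qed.

Lemma smallN x : small x -> small (fun n => - x n).
Proof. by move=> x0; rewrite /small -oppr0; exact: cvgN. Qed.

Lemma smallM c x : small x -> small (fun n => c * x n).
Proof. by move=> x0; rewrite /small -(mulr0 c); apply: cvgM => //; exact: cvg_cst. Qed.

Lemma small0 : small (fun=> 0).
Proof. exact: cvg_cst. Qed.

Lemma small_cst c : small (fun=> c) -> c = 0.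
Proof.
move=> /smallP h; apply/eqP; rewrite -normr_eq0; apply/eqP/le_anti.
rewrite normr_ge0 andbT leNgt; apply/negP => c0.
by have [n] := @filter_ex _ _ GP _ (h _ c0); rewrite ltxx.
Qed.

(** The image of G under x is an ultrafilter containing the compact interval [-M, M], hence it
    converges. Limits along G are always expressed by the smallness of a difference. *)
Lemma ultra_limit (x : nat -> R) M : (forall n, `|x n| <= M) ->
  exists l, small (fun n => x n - l).
Proof.
move=> xM; have UF : UltraFilter (x @ G).
  split; first exact: fmap_proper_filter.
  move=> H HP GH; apply/seteqP; split => // B HB.
  have [//|nB] := in_ultra_setVsetC (x @^-1` B) GU.
  have HnB : H (~` B) by apply: GH; rewrite /= preimage_setC.
  by have /filter_ex[? []] : H (B `&` ~` B) by exact: filterI.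
have := @segment_compact R (- M) M; rewrite compact_ultra => /(_ (x @ G) UF).
case.
  by apply: nearW => n /=; rewrite in_itv /= -ler_norml.
move=> l [_ xl]; exists l; rewrite /small -(subrr l).
exact: (cvgB xl (cvg_cst l)).
Qed.

Lemma small_lim_le (x y : nat -> R) (l k : R) :
  (\forall n \near G, x n <= y n) ->
  small (fun n => x n - l) -> small (fun n => y n - k) -> l <= k.
Proof.
move=> xy xl yk; rewrite leNgt; apply/negP => kl.
have e0 : 0 < (l - k) / 2 by rewrite divr_gt0// subr_gt0.
have /smallP/(_ _ e0) h1 := xl; have /smallP/(_ _ e0) h2 := yk.
have [n []] := @filter_ex _ _ GP _ (filterI xy (filterI h1 h2)).
by move=> xyn []; rewrite !ltr_norml => /andP[a b] /andP[c d]; lra.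
Qed.

Lemma small_sqr x : small x -> small (fun n => x n ^+ 2).
Proof.
move=> x0; rewrite /small (_ : (fun n => x n ^+ 2) = (fun n => x n * x n)).
  by rewrite -(mulr0 (0 : R)); exact: cvgM.
by apply/funext => n; rewrite expr2.
Qed.

Lemma small_sqrt x : small (fun n => x n ^+ 2) -> small x.
Proof.
move=> /smallP x0; apply/smallP => e e0; have := x0 _ (exprn_gt0 2 e0).
apply: filterS => n; rewrite normrX ltr_pXn2r// nnegrE//; exact: ltW.
Qed.

Lemma ultra_climit (x : nat -> C) M : (forall n, normc (x n) <= M) ->
  exists l, small (fun n => normc (x n - l)).
Proof.
move=> xM.
have [a xa] : exists a, small (fun n => complex.Re (x n) - a).
  apply: (@ultra_limit _ M) => n; apply: le_trans (xM n).
  by rewrite -lecR; exact: normc_ge_Re.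
have [b xb] : exists b, small (fun n => complex.Im (x n) - b).
  apply: (@ultra_limit _ M) => n; apply: le_trans (xM n).
  case: (x n) => p q /=; rewrite -sqrtr_sqr ler_sqrt ?addr_ge0 ?sqr_ge0//.
  by rewrite lerDr sqr_ge0.
exists (a +i* b).
apply: (@small_leT _ (fun n => `|complex.Re (x n) - a| + `|complex.Im (x n) - b|)).
  move=> n; rewrite ger0_norm; last exact: normc_ge0.
  case: (x n) => p q /=.
  rewrite -(@ler_pXn2r _ 2) ?nnegrE ?addr_ge0//.
  rewrite sqr_sqrtr ?addr_ge0 ?sqr_ge0// [leRHS]sqrrD !real_normK ?num_real//.
  by rewrite lerD2r lerDl mulrn_wge0// mulr_ge0.
by apply: smallD; rewrite /small -(normr0 R); exact: cvg_norm.
Qed.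

Lemma small_normc (x : nat -> C) l : small (fun n => normc (x n - l)) ->
  small (fun n => normc (x n) - normc l).
Proof.
apply: small_leT => n; have := le_normcD (x n - l) l.
have := le_normcD (l - x n) (x n).
by rewrite !subrK -[l - x n]opprB normcN ler_norml => a b; lra.
Qed.

Lemma climit_cst (c : C) : small (fun=> normc c) -> c = 0.
Proof. by move=> /small_cst/eqP; rewrite normc_eq0 => /eqP. Qed.

End ultra_limits.

Section ultraproduct.
Variables (R : realType) (G : set_system nat).
Hypothesis GU : UltraFilter G.
Local Notation C := R[i].
Local Notation normc := Normc.normc.
Local Notation small := (small G).

Local Instance GP' : ProperFilter G. Proof. exact: ultra_proper. Qed.

(* A vector of the Hilbert space ultraproduct of the spaces C^(n+1) along G is
   represented by a bounded sequence v with v n in C^(n+1); two sequences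
   represent the same vector when their difference is tiny. *)
Definition bnd (p q : nat -> nat) (v : forall n, 'M[C]_(p n, q n)) :=
  exists M, forall n, fnorm (v n) <= M.
Definition tiny (p q : nat -> nat) (v : forall n, 'M[C]_(p n, q n)) :=
  small (fun n => fnorm (v n)).

Section shapes.
Variables p q r : nat -> nat.
Implicit Types v w : forall n, 'M[C]_(p n, q n).

Lemma bndD v w : bnd v -> bnd w -> bnd (fun n => v n + w n).
Proof.
move=> [M vM] [N wN]; exists (M + N) => n.
by rewrite (le_trans (fnormD _ _))// lerD.
Qed.

Lemma bndZ a v : bnd v -> bnd (fun n => a *: v n).
Proof.
by move=> [M vM]; exists (normc a * M) => n; rewrite fnormZ ler_wpM2l.
Qed.

Lemma bndB v w : bnd v -> bnd w -> bnd (fun n => v n - w n).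
Proof.
move=> [M vM] [N wN]; exists (M + N) => n.
by rewrite (le_trans (fnormB _ _))// lerD.
Qed.

Lemma bnd_sum (I : Type) (s : seq I) (f : I -> forall n, 'M[C]_(p n, q n)) :
  (forall i, bnd (f i)) -> bnd (fun n => \sum_(i <- s) f i n).
Proof.
move=> bf; elim: s => [|i s ih].
  by exists 0 => n; rewrite big_nil fnorm0.
have [M h] := bndD (bf i) ih; exists M => n; by rewrite big_cons.
Qed.

Lemma bndM v (w : forall n, 'M[C]_(q n, r n)) :
  bnd v -> bnd w -> bnd (fun n => v n *m w n).
Proof.
move=> [M vM] [N wN]; exists (M * N) => n.
by rewrite (le_trans (fnormM _ _))// ler_pM.
Qed.

Lemma tinyD v w : tiny v -> tiny w -> tiny (fun n => v n + w n).
Proof.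
move=> v0 w0; apply: (small_leT GU (y := fun n => fnorm (v n) + fnorm (w n))).
  by move=> n; rewrite ger0_norm// fnormD.
exact: (smallD GU).
Qed.

Lemma tinyB v w : tiny v -> tiny w -> tiny (fun n => v n - w n).
Proof.
move=> v0 w0; apply: (small_leT GU (y := fun n => fnorm (v n) + fnorm (w n))).
  by move=> n; rewrite ger0_norm// fnormB.
exact: (smallD GU).
Qed.

Lemma tinyZ a v : tiny v -> tiny (fun n => a *: v n).
Proof.
move=> v0; apply: (small_leT GU (y := fun n => normc a * fnorm (v n))).
  by move=> n; rewrite ger0_norm// fnormZ.
exact: (smallM GU).
Qed.

Lemma tiny0 : tiny (fun n => 0 : 'M[C]_(p n, q n)).
Proof.
apply: (small_leT GU (y := fun=> 0)); last exact: (small0 GU).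
by move=> n; rewrite fnorm0 normr0.
Qed.

Lemma tinyMr v (w : forall n, 'M[C]_(q n, r n)) :
  bnd v -> tiny w -> tiny (fun n => v n *m w n).
Proof.
move=> [M vM] w0; apply: (small_leT GU (y := fun n => M * fnorm (w n))).
  move=> n; rewrite ger0_norm// (le_trans (fnormM _ _))// ler_wpM2r//.
exact: (smallM GU).
Qed.

Lemma tinyMl v (w : forall n, 'M[C]_(q n, r n)) :
  tiny v -> bnd w -> tiny (fun n => v n *m w n).
Proof.
move=> v0 [M wM]; apply: (small_leT GU (y := fun n => M * fnorm (v n))).
  move=> n; rewrite ger0_norm// (le_trans (fnormM _ _))// mulrC ler_wpM2r//.
exact: (smallM GU).
Qed.

Lemma tiny_ext v w : (forall n, v n = w n) -> tiny v -> tiny w.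
Proof. by move=> vw; apply: (small_leT GU) => n; rewrite vw ger0_norm. Qed.

Lemma bnd_ext v w : (forall n, v n = w n) -> bnd v -> bnd w.
Proof. by move=> vw [M h]; exists M => n; rewrite -vw. Qed.

Lemma tiny_sub v w : tiny (fun n => v n - w n) -> tiny w -> tiny v.
Proof. by move=> /tinyD h /h; apply: tiny_ext => n; rewrite subrK. Qed.

Lemma tiny_subC v w : tiny (fun n => v n - w n) -> tiny (fun n => w n - v n).
Proof. by apply: (small_leT GU) => n; rewrite ger0_norm// -fnormN opprB. Qed.

Lemma bnd_adj v : bnd v -> bnd (fun n => (v n) ^t*).
Proof. by move=> [M h]; exists M => n; rewrite fnorm_adj. Qed.

End shapes.

Local Notation vseq := (forall n, 'cV[C]_n.+1).
Local Notation mseq := (forall n, 'M[C]_n.+1).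
Implicit Types (A : mseq) (v w e : vseq) (z lam : C).

(** * Generalized eigenvectors in the ultraproduct *)

Definition shift_op A z v : vseq := fun n => A n *m v n - z *: v n.

Definition approx_ker A z k v := bnd v /\ tiny (iter k (shift_op A z) v).

Definition indep m (f : 'I_m -> vseq) := forall a : 'I_m -> C,
  tiny (fun n => \sum_(i < m) a i *: f i n) -> forall i, a i = 0.

(** This says that the kernel of (A - z)^k in the ultraproduct has dimension at least m; exhibiting
    m vectors spares forming the quotient and its dimensions. *)
Definition indep_ker A z k m := exists f : 'I_m -> vseq,
  (forall i, approx_ker A z k (f i)) /\ indep f.

Lemma iter_shiftB A z k v w n :
  iter k (shift_op A z) (fun n => v n - w n) n =
  iter k (shift_op A z) v n - iter k (shift_op A z) w n.
Proof.
by elim: k n => //= k ih n; rewrite /shift_op !ih mulmxBr scalerBr !opprD !opprK addrACA.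
Qed.

Lemma iter_shiftZ A z k a v n :
  iter k (shift_op A z) (fun n => a *: v n) n = a *: iter k (shift_op A z) v n.
Proof.
by elim: k n => //= k ih n; rewrite /shift_op !ih -scalemxAr scalerBr !scalerA mulrC.
Qed.

Lemma iter_shift_sum A z k (I : Type) (s : seq I) (f : I -> vseq) n :
  iter k (shift_op A z) (fun n => \sum_(i <- s) f i n) n =
  \sum_(i <- s) iter k (shift_op A z) (f i) n.
Proof.
elim: k n => //= k ih n; rewrite /shift_op sumrB ih mulmx_sumr; congr (_ - _).
by rewrite scaler_sumr.
Qed.

Lemma iter_shift_tiny A z k v : bnd A -> tiny v -> tiny (iter k (shift_op A z) v).
Proof.
move=> bA; elim: k => //= k ih /ih v0.
by apply: tinyB; [exact: tinyMr|exact: tinyZ].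
Qed.

Lemma iter_shift_bnd A z k v : bnd A -> bnd v -> bnd (iter k (shift_op A z) v).
Proof.
move=> bA; elim: k => //= k ih /ih v0.
by apply: bndB; [exact: bndM|exact: bndZ].
Qed.

Lemma iter_shift_sub A z k v w : bnd A -> tiny (fun n => v n - w n) ->
  tiny (fun n => iter k (shift_op A z) v n - iter k (shift_op A z) w n).
Proof.
move=> bA vw; apply: (tiny_ext (iter_shiftB A z k v w)).
exact: iter_shift_tiny.
Qed.

Lemma approx_kerS A z k v : bnd A -> approx_ker A z k v -> approx_ker A z k.+1 v.
Proof. by move=> bA [bv kv]; split => //; exact: (iter_shift_tiny z 1 bA kv). Qed.

Lemma approx_ker_le A z k k' v : bnd A -> (k <= k')%N ->
  approx_ker A z k v -> approx_ker A z k' v.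
Proof.
move=> bA /subnK <-; elim: (k' - k)%N => // d ih kv.
by apply: approx_kerS => //; exact: ih.
Qed.

Lemma indep_ker_le A z k k' m : bnd A -> (k <= k')%N ->
  indep_ker A z k m -> indep_ker A z k' m.
Proof.
move=> bA kk [f [fk fi]]; exists f; split => // i; exact: (approx_ker_le bA kk).
Qed.

Lemma indep_ker0 A z k : indep_ker A z k 0.
Proof. by exists (fun i => fun=> 0); split => [[]//|a _ []]. Qed.

Lemma indep_not_tiny m (f : 'I_m -> vseq) i : indep f -> ~ tiny (f i).
Proof.
move=> fi f0; suff : 1 = 0 :> C by move/eqP; rewrite oner_eq0.
have := fi (fun j => (j == i)%:R) _ i; rewrite eqxx; apply.
apply: tiny_ext f0 => n.
rewrite (bigD1 i)//= eqxx scale1r big1 ?addr0// => j /negPf ->.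
by rewrite scale0r.
Qed.

Definition approx_eigen A z := exists v, ~ tiny v /\ approx_ker A z 1 v.

(** If (A - z)^(k+1) f is tiny and (A - z)^k f is not, the latter is an eigenvector. Without
    eigenvectors, descending on k shows that f itself is tiny, which no member of an independent
    family can be. *)
Lemma indep_ker_no_eigen A z k m : bnd A ->
  ~ approx_eigen A z -> indep_ker A z k m -> m = 0%N.
Proof.
move=> bA nA [f [fk fi]]; case: m f fk fi => // m f fk fi; exfalso.
apply: (@indep_not_tiny _ f ord0 fi); have [bf] := fk ord0.
elim: k {fk} => //= k ih fk; apply: ih; apply: contrapT => nt.
apply: nA; exists (iter k (shift_op A z) (f ord0)); split => //.
by split => //; exact: iter_shift_bnd.
Qed.

Lemma approx_eigen_unit A z : bnd A -> approx_eigen A z ->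
  exists e, (forall n, fnorm (e n) = 1) /\ tiny (fun n => A n *m e n - z *: e n).
Proof.
move=> bA [v [nv [[M vM] /= kv]]].
have [c vc] : exists c, small (fun n => fnorm (v n) - c).
  by apply: (@ultra_limit _ _ GU _ M) => n; rewrite ger0_norm.
have c0 : 0 <= c.
  apply: (small_lim_le GU (x := fun=> 0) (y := fun n => fnorm (v n))) => //.
    by apply: nearW => n.
  by rewrite subr0; exact: (small0 GU).
have {c0} c0 : 0 < c.
  rewrite lt_neqAle c0 andbT; apply/eqP => c0'; apply: nv.
  by apply: (small_leT GU) vc => n; rewrite -c0' subr0 ger0_norm.
pose u n : 'cV[C]_n.+1 := delta_mx 0 0.
have u1 n : fnorm (u n) = 1.
  apply/eqP; rewrite -(@eqrXn2 _ 2)// expr1n fnorm2_sum.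
  rewrite (bigD1 ord0)//= [X in _ + X]big1 => [|i /negPf i0].
    by rewrite big_ord1 addr0 mxE !eqxx Normc.normc1 expr1n.
  by rewrite big_ord1 mxE i0 Normc.normc0 expr0n.
(* The norms tend to c > 0 along G, so [v n] gets normalized, by a factor at most 2 / c, for
   G-almost all n. The other n, where [v n] may vanish, receive an arbitrary unit vector, so that
   the norm is 1 for every n. *)
pose e n := if fnorm (v n) < c / 2 then u n else (fnorm (v n))^-1%:C *: v n.
have e1 n : fnorm (e n) = 1.
  rewrite /e; case: ltP => // vn; rewrite fnormZ normc_real ger0_norm ?invr_ge0//.
  by rewrite mulVf// gt_eqF// (lt_le_trans _ vn)// divr_gt0.
exists e; split => //.
apply: (small_le GU (y := fun n => 2 / c * fnorm (shift_op A z v n))); last exact: (smallM GU).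
have /(smallP _) /(_ (c / 2)) : small (fun n => fnorm (v n) - c) by [].
rewrite divr_gt0// => /(_ isT); apply: filterS => n; rewrite ltr_norml => /andP[h _].
have {}h : c / 2 < fnorm (v n) by lra.
rewrite ger0_norm// /e ltNge (ltW h)/= -scalemxAr scalerA mulrC -scalerA -scalerBr.
rewrite fnormZ normc_real ger0_norm ?invr_ge0// ler_wpM2r//.
by rewrite -[2 / c]invrK invf_div lef_pV2 ?posrE ?divr_gt0// ?(ltW h)// (lt_trans _ h)// divr_gt0.
Qed.

(** * Deflation by a unit eigenvector, and its effect on multiplicities *)

Section deflation.
Variables (A : mseq) (e : vseq) (lam : C).
Hypothesis bA : bnd A.
Hypothesis e1 : forall n, fnorm (e n) = 1.
Hypothesis eA : tiny (fun n => A n *m e n - lam *: e n).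

Definition coef v n : C := ((e n) ^t* *m v n) 0 0.
Definition proj v : vseq := fun n => v n - coef v n *: e n.
Definition deflation : mseq := fun n => A n - e n *m ((e n) ^t* *m A n).
Local Notation A' := deflation.

Lemma dot_unit n : (e n) ^t* *m e n = 1%:M.
Proof.
rewrite [LHS]mx11_scalar -trace_mx11 mxtrace_mulC -fnorm2_tr e1 expr1n.
by congr (_%:M).
Qed.

Lemma coefE v n : (e n) ^t* *m v n = (coef v n)%:M.
Proof. exact: mx11_scalar. Qed.

Lemma deflation_mul v n :
  A' n *m v n = A n *m v n - coef (fun n => A n *m v n) n *: e n.
Proof. by rewrite mulmxBl -!mulmxA (coefE (fun n => A n *m v n)) mul_mx_scalar. Qed.

Lemma normc_coef v n : normc (coef v n) <= fnorm (v n).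
Proof.
rewrite -fnorm1 (le_trans (fnormM _ _))// fnorm_adj e1 mul1r//.
Qed.

Lemma coefB v w n : coef (fun n => v n - w n) n = coef v n - coef w n.
Proof. by rewrite /coef mulmxBr !mxE. Qed.

Lemma coefZ a v n : coef (fun n => a n *: v n) n = a n * coef v n.
Proof. by rewrite /coef -scalemxAr mxE. Qed.

Lemma coef_e n : coef e n = 1.
Proof. by rewrite /coef dot_unit mxE eqxx. Qed.

Lemma coef_proj v n : coef (proj v) n = 0.
Proof. by rewrite coefB (coefZ (coef v) e) coef_e mulr1 subrr. Qed.

Lemma coef_deflation v n : coef (fun n => A' n *m v n) n = 0.
Proof.
by rewrite -[RHS](coef_proj (fun n => A n *m v n) n) /coef deflation_mul.
Qed.

Lemma bnd_e : bnd e.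
Proof. by exists 1 => n; rewrite e1. Qed.

Lemma bnd_coef v : bnd v -> exists M, forall n, normc (coef v n) <= M.
Proof. by move=> [M vM]; exists M => n; exact: le_trans (normc_coef _ _) (vM n). Qed.

Lemma bnd_coefe v : bnd v -> bnd (fun n => coef v n *: e n).
Proof.
by move=> /bnd_coef[M vM]; exists M => n; rewrite fnormZ e1 mulr1.
Qed.

Lemma tiny_coefe v : tiny v -> tiny (fun n => coef v n *: e n).
Proof.
apply: (small_leT GU) => n; rewrite ger0_norm// fnormZ e1 mulr1; exact: normc_coef.
Qed.

Lemma bnd_proj v : bnd v -> bnd (proj v).
Proof. by move=> bv; apply: bndB => //; exact: bnd_coefe. Qed.

Lemma tiny_proj v : tiny v -> tiny (proj v).
Proof. by move=> bv; apply: tinyB => //; exact: tiny_coefe. Qed.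

Lemma bnd_deflation : bnd A'.
Proof.
apply: bndB => //; apply: bndM; first exact: bnd_e.
by apply: bndM => //; apply: bnd_adj; exact: bnd_e.
Qed.

Lemma projB v w n : proj (fun n => v n - w n) n = proj v n - proj w n.
Proof. by rewrite /proj coefB scalerBl !opprD !opprK addrACA. Qed.

Lemma projZ a v n : proj (fun n => a *: v n) n = a *: proj v n.
Proof. by rewrite /proj (coefZ (fun=> a)) scalerBr scalerA. Qed.

Lemma proj_e n : proj e n = 0.
Proof. by rewrite /proj coef_e scale1r subrr. Qed.

Lemma proj_sum (I : Type) (s : seq I) (f : I -> vseq) n :
  proj (fun n => \sum_(i <- s) f i n) n = \sum_(i <- s) proj (f i) n.
Proof.
rewrite /proj sumrB -scaler_suml; congr (_ - _ *: _).
by rewrite /coef mulmx_sumr summxE.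
Qed.

Lemma tiny_deflation_e : tiny (fun n => A' n *m e n).
Proof.
apply: tiny_ext (tiny_proj eA) => n.
by rewrite projB projZ proj_e scaler0 subr0 deflation_mul.
Qed.

(** The projection intertwines A with its deflation: the only discrepancy is the image under [A'] of
    the component of v along e, and [A' e] is tiny because [A e] is nearly a multiple of e. *)
Lemma tiny_shift_proj z v : bnd v ->
  tiny (fun n => shift_op A' z (proj v) n - proj (shift_op A z v) n).
Proof.
move=> bv; have [M vM] := bnd_coef bv.
apply: (small_leT GU (y := fun n => M * fnorm (A' n *m e n))); last first.
  by apply: (smallM GU) => //; exact: tiny_deflation_e.
move=> n; rewrite ger0_norm//; have -> : shift_op A' z (proj v) n - proj (shift_op A z v) n =
    - (coef v n *: (A' n *m e n)).
  rewrite [in X in _ - X]/shift_op projB projZ /shift_op /proj mulmxBr -scalemxAr.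
  rewrite (deflation_mul v); set a := A n *m _ - _; set b := z *: _; set c := coef v n *: _.
  by rewrite opprB addrA subrK addrAC subrr sub0r.
by rewrite fnormN fnormZ ler_wpM2r.
Qed.

Lemma tiny_iter_shift_proj z k v : bnd v ->
  tiny (fun n => iter k (shift_op A' z) (proj v) n - proj (iter k (shift_op A z) v) n).
Proof.
move=> bv; elim: k => [|k ih] /=.
  by apply: tiny_ext (tiny0 _ _) => n; rewrite subrr.
have h1 := iter_shift_sub z 1 bnd_deflation ih.
have h2 := tiny_shift_proj z (iter_shift_bnd z k bA bv).
by apply: tiny_ext (tinyD h1 h2) => n /=; rewrite addrA subrK.
Qed.

Lemma approx_ker_proj z k v : approx_ker A z k v -> approx_ker A' z k (proj v).
Proof.
move=> [bv kv]; split; first exact: bnd_proj.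
by apply: tiny_sub (tiny_iter_shift_proj z k bv) _; exact: tiny_proj.
Qed.

(** The coefficient of v along e depends on n; taking its limit along G makes the component a
    genuine scalar multiple of e in the ultraproduct. *)
Lemma tiny_coef_cst v : bnd v -> exists c, tiny (fun n => coef v n *: e n - c *: e n).
Proof.
move=> /bnd_coef[M vM]; have [c vc] := ultra_climit GU vM; exists c.
by apply: (small_leT GU) vc => n; rewrite ger0_norm// -scalerBl fnormZ e1 mulr1.
Qed.

Lemma tiny_projP v : bnd v -> tiny (proj v) -> exists c, tiny (fun n => v n - c *: e n).
Proof.
move=> bv pv; have [c vc] := tiny_coef_cst bv; exists c.
by apply: tiny_ext (tinyD pv vc) => n; rewrite /proj addrA subrK.
Qed.

Lemma tiny_scale_e c : tiny (fun n => c *: e n) -> c = 0.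
Proof.
move=> h; apply: (climit_cst GU).
by apply: (small_leT GU) h => n; rewrite ger0_norm// fnormZ e1 mulr1.
Qed.

Lemma iter_shift_e z k :
  tiny (fun n => iter k (shift_op A z) e n - (lam - z) ^+ k *: e n).
Proof.
elim: k => [|k ih]; first by apply: tiny_ext (tiny0 _ _) => n; rewrite scale1r subrr.
have h1 := iter_shift_sub z 1 bA ih.
have h2 := tinyZ ((lam - z) ^+ k) eA.
apply: tiny_ext (tinyD h1 h2) => n /=.
rewrite -addrA; congr (_ + _).
rewrite /shift_op -scalemxAr scalerBr !scalerA opprB addrA subrK -scalerBl -[RHS]scaleNr.
by congr (_ *: _); rewrite exprSr; ring.
Qed.

Lemma indep_exchange m (f : 'I_m.+1 -> vseq) : indep f ->
  exists p : 'I_m.+1, forall (a : 'I_m -> C) (c : C),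
    tiny (fun n => \sum_i a i *: f (lift p i) n - c *: e n) -> forall i, a i = 0.
Proof.
move=> fi.
have [[b [p [bp bt]]]|nb] := pselect (exists (b : 'I_m.+1 -> C) (p : 'I_m.+1), b p != 0 /\
    tiny (fun n => \sum_i b i *: f i n - e n)).
  exists p => a c ac.
  pose d i := (if unlift p i is Some j then a j else 0) - c * b i.
  have d0 : forall i, d i = 0.
    apply: fi; apply: tiny_ext (tinyB ac (tinyZ c bt)) => n.
    rewrite scalerBr opprB addrA subrK scaler_sumr.
    under [RHS]eq_bigr do rewrite scalerBl; rewrite sumrB; congr (_ - _).
      rewrite [RHS](bigD1_ord p)//= unlift_none scale0r add0r.
      by apply: eq_bigr => i _; rewrite liftK.
    by apply: eq_bigr => i _; rewrite scalerA.
  have c0 : c = 0.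
    have := d0 p; rewrite /d unlift_none sub0r => /eqP; rewrite oppr_eq0 mulf_eq0.
    by rewrite (negPf bp) orbF => /eqP.
  move=> i; have := d0 (lift p i); rewrite /d liftK c0 mul0r subr0//.
exists ord0 => a c ac.
have h : forall i, (if unlift ord0 i is Some j then a j else 0) = 0 :> C; last first.
  by move=> i; have := h (lift ord0 i); rewrite liftK.
have sumE n : \sum_i (if unlift ord0 i is Some j then a j else 0) *: f i n =
    \sum_i a i *: f (lift ord0 i) n.
  rewrite (bigD1_ord ord0)//= unlift_none scale0r add0r.
  by apply: eq_bigr => i _; rewrite liftK.
have [c0|c0] := eqVneq c 0.
  by apply: fi; apply: tiny_ext ac => n; rewrite c0 scale0r subr0 sumE.
move=> i; apply: contrapT => /eqP ai; apply: nb.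
exists (fun i => c^-1 * if unlift ord0 i is Some j then a j else 0), i.
split; first by rewrite mulf_neq0// invr_eq0.
apply: tiny_ext (tinyZ c^-1 ac) => n.
rewrite scalerBr scalerA mulVf// scale1r -sumE scaler_sumr; congr (_ - _).
by apply: eq_bigr => j _; rewrite scalerA.
Qed.

(** The projection maps the kernel of (A - z)^k into that of (A' - z)^k, and it kills only multiples
    of e. This costs at most one dimension, and none when z differs from lam: then (A - z)^k e is
    (lam - z)^k e up to a tiny error, so no non-zero multiple of e lies in the kernel. *)
Lemma indep_ker_deflation z k m :
  indep_ker A z k (m + (z == lam)) -> indep_ker A' z k m.
Proof.
have projP q (f : 'I_q -> vseq) (a : 'I_q -> C) : (forall i, approx_ker A z k (f i)) ->
    tiny (fun n => \sum_i a i *: proj (f i) n) ->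
    exists c, tiny (fun n => \sum_i a i *: f i n - c *: e n).
  move=> fk h; apply: tiny_projP.
    by apply: bnd_sum => i; apply: bndZ; exact: (fk i).1.
  apply: tiny_ext h => n; rewrite proj_sum; apply: eq_bigr => i _.
  by rewrite projZ.
case: eqVneq => [_|zl] [f [fk fi]].
  rewrite addn1 in f fk fi.
  have [p fp] := indep_exchange fi.
  exists (fun i => proj (f (lift p i))); split => [i|a h]; first exact: approx_ker_proj.
  by have [c /fp] := projP _ _ _ (fun i => fk (lift p i)) h.
rewrite addn0 in f fk fi.
exists (fun i => proj (f i)); split => [i|a h]; first exact: approx_ker_proj.
have [c hc] := projP _ _ _ fk h.
suff c0 : c = 0 by apply: fi; apply: tiny_ext hc => n; rewrite c0 scale0r subr0.
have h1 := iter_shift_sub z k bA hc.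
have h2 : tiny (iter k (shift_op A z) (fun n => \sum_i a i *: f i n)).
  apply: (tiny_ext (fun n => esym (iter_shift_sum A z k _ _ n))).
  elim: (index_enum _) => [|i s ih].
    by apply: tiny_ext (tiny0 _ _) => n; rewrite big_nil.
  apply: tiny_ext (tinyD (tinyZ (a i) (fk i).2) ih) => n.
  by rewrite big_cons -iter_shiftZ.
have h3 := tinyZ c (iter_shift_e z k).
have h4 : tiny (fun n => (c * (lam - z) ^+ k) *: e n).
  apply: tiny_ext (tinyB (tinyB h2 h1) h3) => n.
  by rewrite subKr iter_shiftZ scalerBr scalerA subKr.
have /eqP := tiny_scale_e h4; rewrite mulf_eq0 => /orP[/eqP//|].
by rewrite expf_eq0 subr_eq0 eq_sym (negPf zl) andbF.
Qed.

(** The range of [A'] is orthogonal to e, so along e the operator A' - z acts as -z. *)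
Lemma coef_iter_deflation z k v n :
  coef (iter k (shift_op A' z) v) n = (- z) ^+ k * coef v n.
Proof.
elim: k => [|k ih]; first by rewrite expr0 mul1r.
rewrite [LHS]/= [in LHS]/shift_op coefB coef_deflation (coefZ (fun=> z)) ih.
by rewrite exprS; ring.
Qed.

(** The component along e of the tiny vector (A' - z)^k v is (-z)^k times that of v; as z is not 0,
    v is nearly orthogonal to e. The intertwining then shows that the projection of (A - z)^k v is
    tiny. *)
Lemma approx_ker_deflationP z k v : z != 0 -> approx_ker A' z k v ->
  tiny (fun n => v n - proj v n) /\
  exists c, tiny (fun n => iter k (shift_op A z) v n - c *: e n).
Proof.
move=> z0 [bv kv].
have vp : tiny (fun n => v n - proj v n).
  have := tinyZ ((- z) ^- k) (tiny_coefe kv); apply: tiny_ext => n.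
  rewrite coef_iter_deflation scalerA mulrA mulVf ?mul1r; last first.
    by rewrite expf_eq0 oppr_eq0 (negPf z0) andbF.
  by rewrite /proj opprB addrC subrK.
split => //.
apply: tiny_projP; first exact: iter_shift_bnd.
have h1 := tiny_iter_shift_proj z k bv.
have h2 := iter_shift_sub z k bnd_deflation vp.
apply: tiny_ext (tinyB (tinyB kv h2) h1) => n.
by rewrite subKr opprB addrC subrK.
Qed.

(** For g in the kernel of (A' - z)^k, the vector (A - z)^k g is some c e. If z = lam, one more
    factor A - lam kills c e, and e itself is the additional kernel vector. If z differs from lam,
    subtracting c / (lam - z)^k times e from g corrects the error. *)
Lemma indep_deflation_ker z k m : z != 0 ->
  indep_ker A' z k m -> indep_ker A z k.+1 (m + (z == lam)).
Proof.
move=> z0 [g [gk gi]].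
have gP i := approx_ker_deflationP z0 (gk i).
have projg (a : 'I_m -> C) (c : 'I_m -> C) d :
    tiny (fun n => \sum_i a i *: (g i n - c i *: e n) - d *: e n) -> forall i, a i = 0.
  move=> h; apply: gi.
  have h1 : tiny (fun n => \sum_i a i *: (g i n - proj (g i) n)).
    elim: (index_enum _) => [|i s ih].
      by apply: tiny_ext (tiny0 _ _) => n; rewrite big_nil.
    by apply: tiny_ext (tinyD (tinyZ (a i) (gP i).1) ih) => n; rewrite big_cons.
  apply: tiny_ext (tinyD h1 (tiny_proj h)) => n.
  rewrite projB projZ proj_e scaler0 subr0 proj_sum -big_split/=.
  apply: eq_bigr => i _; rewrite projZ -scalerDr projB projZ proj_e scaler0 subr0.
  by rewrite subrK.
have ebnd c : bnd (fun n => c *: e n) by apply: bndZ; exact: bnd_e.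
case: eqVneq => [zl|zl].
  rewrite addn1.
  exists (fun i => if unlift ord0 i is Some j then g j else e); split.
    move=> i; case: unliftP => [j _|_]; split.
    - exact: (gk j).1.
    - have [c hc] := (gP j).2.
      have h1 := iter_shift_sub z 1 bA hc.
      have h2 := tinyZ c (iter_shift_e z 1).
      apply: tiny_ext (tinyD h1 h2) => n /=.
      have /= := iter_shiftZ A z 1 c e n => ->.
      by rewrite zl subrr expr1 scale0r subr0 subrK.
    - exact: bnd_e.
    - apply: tiny_ext (iter_shift_e z k.+1) => n.
      by rewrite zl subrr expr0n scale0r subr0.
  move=> a h.
  have sumE n : \sum_i a i *: (if unlift ord0 i is Some j then g j else e) n =
      a ord0 *: e n + \sum_i a (lift ord0 i) *: g i n.
    rewrite (bigD1_ord ord0)//= unlift_none; congr (_ + _).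
    by apply: eq_bigr => i _; rewrite liftK.
  have a0 : forall i, a (lift ord0 i) = 0.
    apply: (projg (fun i => a (lift ord0 i)) (fun=> 0) (- a ord0)).
    apply: tiny_ext h => n; rewrite sumE scaleNr opprK addrC; congr (_ + _).
    by apply: eq_bigr => i _; rewrite scale0r subr0.
  move=> i; case: (unliftP ord0 i) => [j ->//|->].
  apply: tiny_scale_e; apply: tiny_ext h => n.
  by rewrite sumE big1 ?addr0// => j _; rewrite a0 scale0r.
rewrite addn0.
have lz : (lam - z) ^+ k != 0.
  by rewrite expf_eq0 subr_eq0 eq_sym (negPf zl) andbF.
have [c cP] := @choice _ _ (fun i c =>
  tiny (fun n => iter k (shift_op A z) (g i) n - c *: e n)) (fun i => (gP i).2).
exists (fun i n => g i n - (c i / (lam - z) ^+ k) *: e n); split.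
  move=> i; apply: approx_kerS => //; split.
    by apply: bndB => //; exact: (gk i).1.
  have h := tinyZ (c i / (lam - z) ^+ k) (iter_shift_e z k).
  apply: tiny_ext (tinyB (cP i) h) => n.
  rewrite iter_shiftB iter_shiftZ scalerBr scalerA divfK// opprB addrA subrK.
  by [].
move=> a h; apply: (projg a (fun i => c i / (lam - z) ^+ k) 0).
by apply: tiny_ext h => n; rewrite scale0r subr0.
Qed.

End deflation.

(** * Effect of a deflation on traces and on the Frobenius norm *)

Section deflation_trace.
Variables (A : mseq) (e : vseq) (lam : C).
Hypothesis bA : bnd A.
Hypothesis e1 : forall n, fnorm (e n) = 1.
Hypothesis eA : tiny (fun n => A n *m e n - lam *: e n).
Local Notation A' := (deflation A e).
Local Notation coef := (coef e).

(** Pythagoras for the inner product given by the trace: A is the orthogonal sum of [A'] and e e^*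
    A, and the norm of e e^* A is that of the row e^* A. *)
Lemma fnorm2_deflation n :
  fnorm (A' n) ^+ 2 = fnorm (A n) ^+ 2 - fnorm ((e n) ^t* *m A n) ^+ 2.
Proof.
apply: complexI; rewrite rmorphB /= !fnorm2_tr /deflation.
set b := (e n) ^t* *m A n.
have -> : (A n - e n *m b) ^t* = (A n) ^t* - b ^t* *m (e n) ^t*.
  by rewrite linearB /= map_mxB trmxC_mul.
have bE : b ^t* = (A n) ^t* *m e n by rewrite trmxC_mul trmxCK.
have t1 : \tr (A n *m (b ^t* *m (e n) ^t*)) = \tr (b *m b ^t*).
  by rewrite mulmxA mxtrace_mulC mulmxA.
have t2 : \tr (e n *m b *m (A n) ^t*) = \tr (b *m b ^t*).
  by rewrite -mulmxA mxtrace_mulC -mulmxA -bE.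
have t3 : \tr (e n *m b *m (b ^t* *m (e n) ^t*)) = \tr (b *m b ^t*).
  rewrite -mulmxA mxtrace_mulC !mulmxA -[_ *m (e n)^t* *m e n]mulmxA.
  by rewrite dot_unit// mulmx1.
rewrite mulmxBl !mulmxBr !linearB /= t1 t2 t3; ring.
Qed.

Lemma normc_coef_limit : small (fun n => normc (coef (fun n => A n *m e n) n - lam)).
Proof.
apply: (small_leT GU (y := fun n => fnorm (A n *m e n - lam *: e n))) eA => n.
rewrite ger0_norm//.
have := normc_coef e1 (fun n => A n *m e n - lam *: e n) n.
by rewrite coefB (coefZ e (fun=> lam) e) coef_e// mulr1.
Qed.

Lemma bndX k : bnd (fun n => A n ^+ k.+1).
Proof.
elim: k => [|k ih]; first by apply: bnd_ext bA => n; rewrite expr1.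
by apply: bnd_ext (bndM bA ih) => n; rewrite [RHS]exprS.
Qed.

(** Because [A' e] is tiny, deflating commutes with taking powers up to this tiny error. The
    exponent starts at 1: at exponent 0 the difference would be e e^*, of norm 1. *)
Let err l n := A' n ^+ l.+1 - (A n ^+ l.+1 - e n *m ((e n) ^t* *m A n ^+ l.+1)).

Let errS l n : err l.+1 n =
  A' n *m err l n - (A' n *m e n) *m ((e n) ^t* *m A n ^+ l.+1).
Proof.
have hA : A' n *m A n ^+ l.+1 = A n ^+ l.+2 - e n *m ((e n) ^t* *m A n ^+ l.+2).
  by rewrite /deflation mulmxBl -!mulmxA [A n ^+ l.+2]exprS.
rewrite /err !mulmxBr hA (mulmxA (A' n) (e n)) [A' n ^+ l.+2]exprS -addrA.
by congr (_ + _); rewrite [in RHS]opprB addrAC subrr sub0r.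
Qed.

Let tiny_err l : tiny (err l).
Proof.
elim: l => [|l ih].
  by apply: tiny_ext (tiny0 _ _) => n; rewrite /err !expr1 subrr.
apply: tiny_ext (fun n => esym (errS l n)) _.
apply: tinyB; first by apply: tinyMr => //; exact: (bnd_deflation bA e1).
apply: tinyMl; first exact: (tiny_deflation_e e1 eA).
by apply: bndM; [apply: bnd_adj; exact: (bnd_e e1)|exact: bndX].
Qed.

Let coef_pow l : small (fun n => normc (coef (fun n => A n ^+ l *m e n) n - lam ^+ l)).
Proof.
have := iter_shift_e bA eA 0 l.
apply: (small_leT GU) => n; rewrite ger0_norm// subr0.
have AE k m : iter k (shift_op A 0) e m = A m ^+ k *m e m.
  elim: k m => [|k ih] m; first by rewrite expr0 mul1mx.
  by rewrite /= /shift_op ih scale0r subr0 exprS mulmxA.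
have := normc_coef e1 (fun n => A n ^+ l *m e n - lam ^+ l *: e n) n.
by rewrite coefB (coefZ e (fun=> lam ^+ l) e) coef_e// mulr1 AE.
Qed.

(** The trace of e e^* A^l is e^* A^l e, which tends to lam^l. A tiny Frobenius norm does not make a
    trace small in growing dimension; so [errS] is used to write the error as two products, each
    with a tiny factor and a bounded one, and Cauchy-Schwarz bounds their traces. Having two factors
    is what l >= 2 provides. *)
Lemma trace_deflation l : (2 <= l)%N ->
  small (fun n => normc (\tr (A' n ^+ l) - (\tr (A n ^+ l) - lam ^+ l))).
Proof.
case: l => [|[|l]] // _.
have [M AM] := bndX l.
have [N A'N] := bnd_deflation bA e1.
pose y n := N * fnorm (err l n) + fnorm (A' n *m e n) * M +
  normc (coef (fun n => A n ^+ l.+2 *m e n) n - lam ^+ l.+2).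
apply: (small_leT GU (y := y)); last first.
  have h1 : small (fun n => N * fnorm (err l n)) by apply: (smallM GU); exact: tiny_err.
  have h2 : small (fun n => fnorm (A' n *m e n) * M).
    rewrite (_ : (fun n => _) = (fun n => M * fnorm (A' n *m e n))).
      by apply: (smallM GU); exact: (tiny_deflation_e e1 eA).
    by apply/funext => n; rewrite mulrC.
  exact: (smallD GU (smallD GU h1 h2) (coef_pow l.+2)).
move=> n; rewrite ger0_norm// /y.
have -> : \tr (A' n ^+ l.+2) - (\tr (A n ^+ l.+2) - lam ^+ l.+2) =
    \tr (A' n *m err l n) - \tr ((A' n *m e n) *m ((e n) ^t* *m A n ^+ l.+1)) -
    (coef (fun n => A n ^+ l.+2 *m e n) n - lam ^+ l.+2).
  have -> : coef (fun n => A n ^+ l.+2 *m e n) n =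
      \tr (e n *m ((e n) ^t* *m A n ^+ l.+2)).
    by rewrite mxtrace_mulC -mulmxA trace_mx11.
  rewrite -linearB /= -errS /err !linearB /=; ring.
have trD (a b : C) : normc (a - b) <= normc a + normc b.
  by rewrite (le_trans (le_normcD _ _))// normcN.
rewrite (le_trans (trD _ _))// lerD2r (le_trans (trD _ _))// lerD//.
  by rewrite (le_trans (normc_mxtraceM _ _))// ler_wpM2r.
rewrite (le_trans (normc_mxtraceM _ _))// ler_wpM2l//.
by rewrite (le_trans (fnormM _ _))// fnorm_adj e1 mul1r.
Qed.

(** The row e^* A removed by the deflation has norm at least |e^* A e|, which tends to |lam|. *)
Lemma fnorm2_deflation_limit L L' :
  small (fun n => fnorm (A n) ^+ 2 - L) -> small (fun n => fnorm (A' n) ^+ 2 - L') ->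
  L' <= L - normc lam ^+ 2.
Proof.
move=> AL A'L.
apply: (small_lim_le GU (x := fun n => fnorm (A' n) ^+ 2)
  (y := fun n => fnorm (A n) ^+ 2 - normc (coef (fun n => A n *m e n) n) ^+ 2)) A'L _.
  apply: nearW => n; rewrite fnorm2_deflation lerB// ler_pXn2r ?nnegrE//.
  have -> : coef (fun n => A n *m e n) n = ((e n) ^t* *m A n *m e n) 0 0.
    by rewrite -mulmxA.
  rewrite -fnorm1 (le_trans (fnormM _ _))// e1 mulr1//.
have h := small_normc GU normc_coef_limit.
have h2 := smallN GU (smallD GU (small_sqr GU h) (smallM GU (2 * normc lam) h)).
by apply: small_ext (smallD GU AL h2) => n; ring.
Qed.

End deflation_trace.

(** * Exhausting the large eigenvalues *)

Lemma small_near_eq (x y : nat -> R) : (\forall n \near G, x n = y n) ->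
  small x -> small y.
Proof.
move=> xy /(smallP _) x0; apply/(smallP _) => e /x0; apply: filterS2 xy => n ->.
by [].
Qed.

(* Otherwise limits along G of unit eigenvectors and eigenvalues of A n would
   provide an approximate eigenvector. *)
Lemma no_eigenvalue A eps : bnd A ->
  (forall z, eps <= normc z -> ~ approx_eigen A z) ->
  \forall n \near G, forall z, eigenvalue (A n) z -> normc z < eps.
Proof.
move=> bA nA.
have [//|nN] := in_ultra_setVsetC [set n | forall z, eigenvalue (A n) z -> normc z < eps] GU.
exfalso.
have H n : exists zv : C * 'cV[C]_n.+1, (exists2 z, eigenvalue (A n) z & eps <= normc z) ->
    [/\ eps <= normc zv.1, fnorm zv.2 = 1 & A n *m zv.2 = zv.1 *: zv.2].
  have [[z zA ez]|no] := pselect (exists2 z, eigenvalue (A n) z & eps <= normc z).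
    by have [v [v1 vz]] := eigenvector_unit zA; exists (z, v).
  by exists (0, 0).
pose zv n := sval (cid (H n)).
have zvP n := svalP (cid (H n)); rewrite -/(zv _) in zvP.
pose N := [set n | exists2 z, eigenvalue (A n) z & eps <= normc z].
have GN : G N.
  apply: filterS nN => n /= h; apply: contrapT => h'; apply: h => z zA.
  by rewrite ltNge; apply/negP => ez; apply: h'; exists z.
(* Outside [N] the chosen pair is meaningless; the value 0 keeps both sequences bounded and the
   relation A v = z v true for every n. *)
pose z n := if n \in N then (zv n).1 else 0.
pose v n := if n \in N then (zv n).2 else 0.
have vle n : fnorm (v n) <= 1.
  rewrite /v; case: ifPn => [/set_mem Nn|_]; last by rewrite fnorm0.
  by have [_ ->] := zvP _ Nn.
have vz n : A n *m v n = z n *: v n.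
  rewrite /v /z; case: ifPn => [/set_mem Nn|_]; last by rewrite mulmx0 scaler0.
  by have [] := zvP _ Nn.
have [M AM] := bA.
have zM n : normc (z n) <= M.
  have M0 : 0 <= M by rewrite (le_trans _ (AM n)).
  rewrite /z; case: ifPn => [/set_mem Nn|_]; last by rewrite Normc.normc0.
  have [_ v1 vA] := zvP _ Nn; apply: le_trans (AM n).
  have : fnorm (A n *m (zv n).2) <= fnorm (A n) by rewrite (le_trans (fnormM _ _))// v1 mulr1.
  by rewrite vA fnormZ v1 mulr1.
have [l zl] := ultra_climit GU zM.
have el : eps <= normc l.
  apply: (small_lim_le GU (x := fun=> eps) (y := fun n => normc (z n))) (small_normc GU zl).
    apply: filterS GN => n Nn; rewrite /z mem_set//; by have [] := zvP _ Nn.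
  by apply: small_ext (small0 GU) => n; rewrite subrr.
apply: (nA l el); exists v; split.
  move=> v0; suff : (1 : R) = 0 by move/eqP; rewrite oner_eq0.
  apply: (small_cst GU).
  apply: small_near_eq v0; apply: filterS GN => n Nn.
  by rewrite /v mem_set//; have [] := zvP _ Nn.
split; first by exists 1.
apply: (small_leT GU) zl => n; rewrite ger0_norm//= /shift_op vz -scalerBl fnormZ.
by rewrite ler_piMr.
Qed.

Lemma limit_ge0 (x : nat -> R) l : (forall n, 0 <= x n) -> small (fun n => x n - l) -> 0 <= l.
Proof.
move=> x0; apply: (small_lim_le GU (x := fun=> 0)); first exact: nearW.
by apply: small_ext (small0 GU) => n; rewrite subrr.
Qed.

Lemma deflation_step A L lam : bnd A -> small (fun n => fnorm (A n) ^+ 2 - L) ->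
  approx_eigen A lam -> exists e L',
  [/\ forall n, fnorm (e n) = 1, tiny (fun n => A n *m e n - lam *: e n),
    small (fun n => fnorm (deflation A e n) ^+ 2 - L') , 0 <= L' & L' <= L - normc lam ^+ 2].
Proof.
move=> bA AL /(approx_eigen_unit bA)[e [e1 eA]].
have [M A'M] := bnd_deflation bA e1.
have [L' A'L'] : exists L', small (fun n => fnorm (deflation A e n) ^+ 2 - L').
  apply: (@ultra_limit _ _ GU _ (M ^+ 2)) => n; rewrite ger0_norm ?sqr_ge0//.
  by rewrite ler_pXn2r ?nnegrE ?A'M// (le_trans _ (A'M n)).
exists e, L'; split => //; last exact: fnorm2_deflation_limit AL A'L'.
by apply: limit_ge0 A'L' => n; exact: sqr_ge0.
Qed.

Lemma trace_limit_no_eigen eps A L l t : 0 < eps -> bnd A ->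
  small (fun n => fnorm (A n) ^+ 2 - L) ->
  (forall z, eps <= normc z -> ~ approx_eigen A z) -> (2 <= l)%N ->
  small (fun n => normc (\tr (A n ^+ l) - t)) ->
  normc t <= eps ^+ (l - 2) * L.
Proof.
move=> eps0 bA AL nA l2 At.
apply: (small_lim_le GU (y := fun n => eps ^+ (l - 2) * fnorm (A n) ^+ 2)) (small_normc GU At) _.
  by apply: filterS (no_eigenvalue bA nA) => n h; exact: normc_mxtraceX.
by apply: small_ext (smallM GU (eps ^+ (l - 2)) AL) => n; rewrite mulrBr.
Qed.

(* A deflation by an eigenvalue of modulus at least eps lowers L by at least
   eps^2, so that K bounds the number of deflations. *)
Theorem approx_spectral_expansion eps (K : nat) A L : 0 < eps -> bnd A ->
  small (fun n => fnorm (A n) ^+ 2 - L) -> L <= K%:R * eps ^+ 2 ->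
  exists s : seq C, [/\ forall z, z \in s -> eps <= normc z,
    \sum_(z <- s) normc z ^+ 2 <= L,
    forall l t, (3 <= l)%N -> small (fun n => normc (\tr (A n ^+ l) - t)) ->
      normc (t - \sum_(z <- s) z ^+ l) <= eps ^+ (l - 2) * L &
    forall z, eps <= normc z ->
      (forall k m, indep_ker A z k m -> (m <= count_mem z s)%N) /\
      indep_ker A z (size s) (count_mem z s)].
Proof.
move=> eps0; elim: K A L => [|K ih] A L bA AL LK.
all: have [[lam el /(deflation_step bA AL)]|nA] :=
  pselect (exists2 z, eps <= normc z & approx_eigen A z); last first.
1,3: have {}nA z : eps <= normc z -> ~ approx_eigen A z by
  move=> ez Az; apply: nA; exists z.
1,2: exists [::]; split => //; [by rewrite big_nil; apply: limit_ge0 AL => n; exact: sqr_ge0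
  | by move=> l t l3 At; rewrite big_nil subr0; exact: (trace_limit_no_eigen eps0 bA AL nA (ltnW l3) At)
  | by move=> z /nA Az; split; [move=> k m /(indep_ker_no_eigen bA Az) ->|exact: indep_ker0]].
all: move=> [e [L' [e1 eA A'L' L'0 LL']]].
all: have el2 : eps ^+ 2 <= normc lam ^+ 2 by rewrite ler_pXn2r ?nnegrE// ltW.
(* No room for a deflation when K = 0: it would give 0 <= L' <= L - |lam|^2 < 0. *)
- rewrite mul0r in LK; have := exprn_gt0 2 eps0; lra.
- have L'K : L' <= K%:R * eps ^+ 2.
    by rewrite -natr1 mulrDl mul1r in LK; lra.
  have [s [s1 s2 s3 s4]] := ih _ _ (bnd_deflation bA e1) A'L' L'K.
  exists (lam :: s); split.
  + by move=> z; rewrite inE => /orP[/eqP->//|/s1].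
  + by rewrite big_cons; lra.
  + move=> l t l3 At.
    have := s3 l (t - lam ^+ l) l3; rewrite big_cons => h.
    have -> : t - (lam ^+ l + \sum_(j <- s) j ^+ l) = t - lam ^+ l - \sum_(j <- s) j ^+ l by ring.
    apply: (@le_trans _ _ (eps ^+ (l - 2) * L')); last first.
      rewrite ler_wpM2l ?exprn_ge0 ?(ltW eps0)//.
      by have := sqr_ge0 (normc lam); lra.
    apply: h; have := smallD GU (trace_deflation bA e1 eA (ltnW l3)) At.
    apply: (small_leT GU) => n; rewrite ger0_norm//.
    have := le_normcD (\tr (deflation A e n ^+ l) - (\tr (A n ^+ l) - lam ^+ l))
      (\tr (A n ^+ l) - t).
    by congr (normc _ <= _); ring.
  + move=> z ez; have [h1 h2] := s4 z ez.
    have z0 : z != 0 by rewrite -normc_eq0 gt_eqF// (lt_le_trans eps0).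
    (* Undoing a deflation raises the exponent of the kernel by one, just as [size s] grows by
       one. *)
    split; last by rewrite /= addnC eq_sym; exact: indep_deflation_ker.
    move=> k [//|m] Akm; rewrite /= eq_sym addnC.
    have [zl|zl] := eqVneq z lam.
      rewrite addn1 ltnS; apply: (h1 k); apply: (indep_ker_deflation bA e1 eA).
      by rewrite zl eqxx addn1 -zl.
    rewrite addn0; apply: (h1 k); apply: (indep_ker_deflation bA e1 eA).
    by rewrite (negPf zl) addn0.
Qed.

End ultraproduct.

(** * Expectations *)

Section real_expectation.
Context d (T : measurableType d) (R : realType).
Variable P : {measure set T -> \bar R}.
Implicit Types f g : T -> R.

Definition intg f := P.-integrable setT (EFin \o f).
Definition sqintg f := measurable_fun setT f /\ intg (fun x => f x ^+ 2).
Local Notation E f := (\int[P]_x (f x)).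

Lemma intg_measurable f : intg f -> measurable_fun setT f.
Proof. by move=> /integrableP[/measurable_EFinP]. Qed.

Lemma intg_le f g : measurable_fun setT f -> (forall x, `|f x| <= g x) -> intg g -> intg f.
Proof.
move=> mf fg; apply: le_integrable => //; first exact/measurable_EFinP.
by move=> x _; rewrite /= lee_fin (le_trans (fg x))// ler_norm.
Qed.

Lemma intgD f g : intg f -> intg g -> intg (fun x => f x + g x).
Proof. by move=> fi gi; exact: (integrableD _ fi gi). Qed.

Lemma intgZ a f : intg f -> intg (fun x => a * f x).
Proof. by move=> fi; exact: (integrableZl _ a fi). Qed.

Lemma intgB f g : intg f -> intg g -> intg (fun x => f x - g x).
Proof. by move=> fi gi; exact: (integrableB _ fi gi). Qed.

Lemma intg_norm f : intg f -> intg (fun x => `|f x|).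
Proof. by move=> fi; exact: (integrable_norm fi). Qed.

Lemma intg_sum (I : Type) (s : seq I) (f : I -> T -> R) :
  (forall i, intg (f i)) -> intg (fun x => \sum_(i <- s) f i x).
Proof.
move=> fi; elim: s => [|i s ih].
  have -> : (fun x => \sum_(i <- [::]) f i x) = (fun=> 0).
    by apply/funext => x; rewrite big_nil.
  exact: integrable0.
have -> : (fun x => \sum_(i <- i :: s) f i x) = (fun x => f i x + \sum_(i <- s) f i x).
  by apply/funext => x; rewrite big_cons.
exact: intgD.
Qed.

Lemma ED f g : intg f -> intg g -> E (fun x => f x + g x) = E f + E g.
Proof. by move=> fi gi; rewrite RintegralD. Qed.

Lemma EB f g : intg f -> intg g -> E (fun x => f x - g x) = E f - E g.
Proof. by move=> fi gi; rewrite RintegralB. Qed.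

Lemma EZ a f : intg f -> E (fun x => a * f x) = a * E f.
Proof. by move=> fi; rewrite RintegralZl. Qed.

Lemma E0 : E (fun=> 0) = 0.
Proof. by rewrite /Rintegral integral0. Qed.

Lemma Esum (I : Type) (s : seq I) (f : I -> T -> R) :
  (forall i, intg (f i)) -> E (fun x => \sum_(i <- s) f i x) = \sum_(i <- s) E (f i).
Proof.
move=> fi; elim: s => [|i s ih].
  by rewrite big_nil -[RHS]E0; apply: eq_Rintegral => x _; rewrite big_nil.
rewrite big_cons -ih -ED//; last exact: intg_sum.
by apply: eq_Rintegral => x _; rewrite big_cons.
Qed.

Lemma Ele f g : intg f -> intg g -> (forall x, f x <= g x) -> E f <= E g.
Proof. by move=> fi gi fg; apply: le_Rintegral. Qed.

Lemma Ege0 f : (forall x, 0 <= f x) -> 0 <= E f.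
Proof. by move=> f0; apply: Rintegral_ge0. Qed.

Lemma Eabs f : intg f -> `|E f| <= E (fun x => `|f x|).
Proof. by move=> fi; exact: le_normr_Rintegral. Qed.

Lemma eq_E f g : (forall x, f x = g x) -> E f = E g.
Proof. by move=> fg; apply: eq_Rintegral => x _. Qed.

Lemma sqintgM f g : sqintg f -> sqintg g -> intg (fun x => f x * g x).
Proof.
move=> [mf fi] [mg gi]; apply: (intg_le (g := fun x => f x ^+ 2 + g x ^+ 2)).
- exact: measurable_funM.
- move=> x; have := sqr_ge0 (f x - g x); have := sqr_ge0 (f x + g x).
  by rewrite ler_norml => a b; apply/andP; split; nra.
- exact: intgD.
Qed.

Lemma sqintgD f g : sqintg f -> sqintg g -> sqintg (fun x => f x + g x).
Proof.
move=> sf sg; split; first by apply: measurable_funD; [exact: sf.1|exact: sg.1].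
have -> : (fun x => (f x + g x) ^+ 2) = (fun x => f x ^+ 2 + 2 * (f x * g x) + g x ^+ 2).
  by apply/funext => x; ring.
apply: intgD; [apply: intgD; [exact: sf.2|apply: intgZ; exact: sqintgM]|exact: sg.2].
Qed.

Lemma sqintgZ a f : sqintg f -> sqintg (fun x => a * f x).
Proof.
move=> sf; split; first by apply: measurable_funM => //; exact: sf.1.
have -> : (fun x => (a * f x) ^+ 2) = (fun x => a ^+ 2 * f x ^+ 2).
  by apply/funext => x; ring.
by apply: intgZ; exact: sf.2.
Qed.

Lemma sqintgB f g : sqintg f -> sqintg g -> sqintg (fun x => f x - g x).
Proof.
move=> sf sg; have := sqintgD sf (sqintgZ (-1) sg).
by congr sqintg; apply/funext => x; rewrite mulN1r.
Qed.

(** The expectation of (g - t f)^2 is a non-negative polynomial in t, evaluated at its minimum t = b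
    / a when a > 0. *)
Lemma E_CauchySchwarz f g : sqintg f -> sqintg g ->
  E (fun x => f x * g x) ^+ 2 <= E (fun x => f x ^+ 2) * E (fun x => g x ^+ 2).
Proof.
move=> sf sg; set a := E (fun x => f x ^+ 2); set b := E (fun x => f x * g x).
set c := E (fun x => g x ^+ 2).
have h t : 0 <= c - 2 * t * b + t ^+ 2 * a.
  have -> : c - 2 * t * b + t ^+ 2 * a = E (fun x => (g x - t * f x) ^+ 2).
    rewrite /a /b /c -!EZ ?sf.2//; last exact: sqintgM.
    rewrite -EB ?sg.2//; last by apply: intgZ; exact: sqintgM.
    rewrite -ED; first by apply: eq_E => x; ring.
      by apply: intgB; [exact: sg.2|apply: intgZ; exact: sqintgM].
    by apply: intgZ; exact: sf.2.
  by apply: Ege0 => x; exact: sqr_ge0.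
have a0 : 0 <= a by apply: Ege0 => x; exact: sqr_ge0.
have [a0'|an0] := eqVneq a 0.
  rewrite a0' mul0r; have [->|b0] := eqVneq b 0; first by rewrite expr0n.
  (* For a = 0 the polynomial is affine in t, and this t would give it the value -1. *)
  have := h ((c + 1) / (2 * b)); rewrite a0' mulr0 addr0.
  have -> : 2 * ((c + 1) / (2 * b)) * b = c + 1 by field.
  by lra.
have {an0}ap : 0 < a by rewrite lt_neqAle eq_sym an0.
have := h (b / a); have -> : c - 2 * (b / a) * b + (b / a) ^+ 2 * a = c - b ^+ 2 / a.
  by field; rewrite gt_eqF.
by rewrite subr_ge0 ler_pdivrMr// mulrC.
Qed.

End real_expectation.

Section probability_expectation.
Context d (T : measurableType d) (R : realType).
Variable P : probability T R.
Implicit Types f g : T -> R.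
Local Notation E f := (\int[P]_x (f x)).

Lemma intg_bounded f M : measurable_fun setT f -> (forall x, `|f x| <= M) -> intg P f.
Proof.
move=> mf fM; apply: measurable_bounded_integrable => //.
  by rewrite (le_lt_trans (probability_le1 P measurableT))// ltry.
exists M; split; first exact: num_real.
by move=> N MN x _; exact: le_trans (fM x) (ltW MN).
Qed.

Lemma E_cst (c : R) : E (fun=> c) = c.
Proof.
rewrite Rintegral_cst// -[RHS]mulr1; congr (_ * _).
exact: (congr1 fine (probability_setT P)).
Qed.

Lemma intg_cst (c : R) : intg P (fun=> c).
Proof. by apply: (intg_bounded (M := `|c|)) => //; exact: measurable_cst. Qed.

Lemma sqintg_bounded f M : measurable_fun setT f -> (forall x, `|f x| <= M) -> sqintg P f.
Proof.
move=> mf fM; split => //; apply: (intg_bounded (M := M ^+ 2)).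
  exact: measurable_funX.
move=> x; rewrite normrX lerXn2r ?nnegrE//; exact: le_trans (normr_ge0 _) (fM x).
Qed.

Lemma sqintg_intg f : sqintg P f -> intg P f.
Proof.
move=> [mf fi]; apply: (intg_le (g := fun x => 1 + f x ^+ 2)) => //.
  move=> x; have := sqr_ge0 (`|f x| - 1); rewrite sqrrB real_normK ?num_real//.
  by have := normr_ge0 (f x); lra.
by apply: intgD => //; exact: intg_cst.
Qed.

Lemma sqr_E_le f : sqintg P f -> E f ^+ 2 <= E (fun x => f x ^+ 2).
Proof.
move=> sf; have s1 : sqintg P (fun=> 1).
  by apply: (sqintg_bounded (M := 1)) => // x; rewrite normr1.
have := E_CauchySchwarz s1 sf; rewrite expr1n E_cst mul1r.
by congr (_ ^+ 2 <= _); apply: eq_E => x; rewrite mul1r.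
Qed.

Lemma E_le_cst f M : intg P f -> (forall x, f x <= M) -> E f <= M.
Proof. by move=> fi fM; rewrite -(E_cst M); apply: Ele => //; exact: intg_cst. Qed.

End probability_expectation.

Section double_expectation.
Context d1 d2 (T1 : measurableType d1) (T2 : measurableType d2) (R : realType).
Variables (P1 : probability T1 R) (P2 : probability T2 R).
Implicit Types h : T1 * T2 -> R.

Lemma measurable_E h : intg (P1 \x P2)%E h ->
  measurable_fun setT (fun x => \int[P2]_y h (x, y)).
Proof.
move=> hi; have := measurable_fubini_F hi; rewrite /fubini_F => m.
exact: (measurableT_comp (fine_measurable measurableT) m).
Qed.

(** A real integral is the [fine] part of an extended one. Integrability of every section, not
    merely of almost every one, keeps the inner integral finite everywhere. *)
Lemma intg_E h : intg (P1 \x P2)%E h -> (forall x, intg P2 (fun y => h (x, y))) ->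
  intg P1 (fun x => \int[P2]_y h (x, y)).
Proof.
move=> hi h2; have := integrable_fubini_F hi; congr integrable.
apply/funext => x; rewrite /fubini_F /= /Rintegral fineK//.
exact: integrable_fin_num (h2 x).
Qed.

Lemma E_iterated h : intg (P1 \x P2)%E h -> (forall x, intg P2 (fun y => h (x, y))) ->
  \int[P1]_x (\int[P2]_y h (x, y)) = \int[(P1 \x P2)%E]_z h z.
Proof.
move=> hi h2; rewrite {1}/Rintegral /Rintegral; congr fine.
rewrite -(integral12_prod_meas1 hi); apply: eq_integral => x _.
rewrite /fubini_F fineK//; exact: integrable_fin_num (h2 x).
Qed.

Lemma E_swap h : intg (P1 \x P2)%E h -> (forall x, intg P2 (fun y => h (x, y))) ->
  (forall y, intg P1 (fun x => h (x, y))) ->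
  \int[P1]_x (\int[P2]_y h (x, y)) = \int[P2]_y (\int[P1]_x h (x, y)).
Proof.
move=> hi h2 h1; rewrite E_iterated// /Rintegral; congr fine.
rewrite -(integral21_prod_meas1 hi); apply: eq_integral => x _.
rewrite /fubini_G fineK//; exact: integrable_fin_num (h1 x).
Qed.

Lemma intg_prod_bounded h M : measurable_fun setT h -> (forall z, `|h z| <= M) ->
  intg (P1 \x P2)%E h.
Proof. exact: (@intg_bounded _ _ _ (P1 \x P2)%E). Qed.

Lemma measurable_sect1 h x : measurable_fun setT h -> measurable_fun setT (fun y => h (x, y)).
Proof. by move=> mh; exact: (measurableT_comp mh (pair1_measurable x)). Qed.

Lemma measurable_sect2 h y : measurable_fun setT h -> measurable_fun setT (fun x => h (x, y)).
Proof. by move=> mh; exact: (measurableT_comp mh (pair2_measurable y)). Qed.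

Lemma intg_snd f : intg P2 f -> intg (P1 \x P2)%E (fun z => f z.2).
Proof.
move=> fi; have mf := intg_measurable fi.
apply/integrable21ltyP.
  by apply/measurable_EFinP; exact: measurableT_comp.
rewrite /=; under eq_integral do rewrite integral_cst//.
move: fi => /integrableP[_]; apply: le_lt_trans.
rewrite le_eqVlt; apply/orP; left; apply/eqP/eq_integral => y _.
rewrite -[RHS]mule1; congr (_ * _)%E; exact: probability_setT.
Qed.

End double_expectation.

(** * Averaging over partitions and integral operators *)

Section averaging.
Context d (T : measurableType d) (R : realType).
Variables (P : probability T R) (kap : forall n, T -> 'I_n.+1).
Implicit Types f g : T -> R.
Local Notation E f := (\int[P]_x (f x)).
Hypothesis kap_measurable : forall n k, measurable (kap n @^-1` [set k]).
Hypothesis kap_measure : forall n k, P (kap n @^-1` [set k]) = (n.+1%:R^-1)%:E.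

Definition chi n k x : R := (kap n x == k)%:R.
Arguments chi : clear implicits.
(** The cells have measure 1/(n+1), so this factor gives the functions [chi n k] norm 1 in L2. With
    it [cell_coord] consists of orthonormal coordinates and [average] is the orthogonal projection
    onto the step functions. *)
Definition scale n : R := Num.sqrt n.+1%:R.
Definition cell_coord n f k := scale n * E (fun x => chi n k x * f x).
Arguments cell_coord : clear implicits.
Definition step n (v : 'I_n.+1 -> R) x : R := scale n * v (kap n x).
Definition average n f := step (cell_coord n f).

Lemma scale_ge0 n : 0 <= scale n. Proof. exact: sqrtr_ge0. Qed.

Lemma scale2 n : scale n ^+ 2 = n.+1%:R.
Proof. by rewrite sqr_sqrtr// ler0n. Qed.

Lemma chiE n k : chi n k = \1_(kap n @^-1` [set k]) :> (T -> R).
Proof.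
apply/funext => x; rewrite /chi indicE.
by case: eqP => xk; [rewrite (mem_set (xk : (kap n @^-1` [set k]) x))|rewrite (memNset (xk : ~ (kap n @^-1` [set k]) x))].
Qed.

Lemma measurable_chi n k : measurable_fun setT (chi n k).
Proof. by rewrite chiE; exact: measurable_indic. Qed.

Lemma chi_ge0 n k x : 0 <= chi n k x. Proof. exact: ler0n. Qed.

Lemma chi_le1 n k x : `|chi n k x| <= 1.
Proof. by rewrite ger0_norm ?chi_ge0// /chi; case: eqP => // _; exact: ler01. Qed.

Lemma chi_idem n k x : chi n k x * chi n k x = chi n k x.
Proof. by rewrite /chi; case: eqP => _; rewrite ?mulr1 ?mulr0. Qed.

Lemma sum_chi n (F : 'I_n.+1 -> R) x : \sum_k F k * chi n k x = F (kap n x).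
Proof.
rewrite (bigD1 (kap n x))//= big1 ?addr0 /chi ?eqxx ?mulr1// => k kx.
by rewrite eq_sym (negPf kx) mulr0.
Qed.

Lemma E_chi n k : E (chi n k) = n.+1%:R^-1.
Proof.
rewrite /Rintegral chiE.
by rewrite integral_indic// setIT; exact: (congr1 fine (kap_measure k)).
Qed.

Lemma sqintg_chi n k : sqintg P (chi n k).
Proof. by apply: (sqintg_bounded P (M := 1)); [exact: measurable_chi|exact: chi_le1]. Qed.

Lemma intg_chi n k : intg P (chi n k).
Proof. exact: sqintg_intg (sqintg_chi k). Qed.

Lemma intg_chiM n k f : intg P f -> intg P (fun x => chi n k x * f x).
Proof.
move=> fi; apply: (intg_le (g := fun x => `|f x|)); last exact: intg_norm.
  by apply: measurable_funM; [exact: measurable_chi|exact: intg_measurable fi].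
by move=> x; rewrite normrM ler_piMl// chi_le1.
Qed.

Lemma sqintg_chiM n k f : sqintg P f -> sqintg P (fun x => chi n k x * f x).
Proof.
move=> [mf fi]; split; first by apply: measurable_funM => //; exact: measurable_chi.
have -> : (fun x => (chi n k x * f x) ^+ 2) = (fun x => chi n k x * f x ^+ 2).
  by apply/funext => x; rewrite exprMn [chi n k x ^+ 2]expr2 chi_idem.
exact: intg_chiM.
Qed.

Lemma stepE n (v : 'I_n.+1 -> R) x : step v x = \sum_k (scale n * v k) * chi n k x.
Proof. by rewrite sum_chi. Qed.

Lemma measurable_step n (v : 'I_n.+1 -> R) : measurable_fun setT (step v).
Proof.
rewrite (_ : step v = fun x => \sum_k (scale n * v k) * chi n k x); last first.
  by apply/funext => x; exact: stepE.
apply: measurable_sum => k; apply: measurable_funM => //; exact: measurable_chi.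
Qed.

Lemma sqintg_step n (v : 'I_n.+1 -> R) : sqintg P (step v).
Proof.
apply: (sqintg_bounded P (M := scale n * \sum_k `|v k|)); first exact: measurable_step.
move=> x; rewrite normrM ger0_norm ?scale_ge0// ler_wpM2l ?scale_ge0//.
by rewrite (bigD1 (kap n x))//= lerDl sumr_ge0.
Qed.

Lemma E_partition n f : intg P f -> E f = \sum_(k < n.+1) E (fun x => chi n k x * f x).
Proof.
move=> fi; rewrite -Esum; last by move=> k; exact: intg_chiM.
apply: eq_E => x; under eq_bigr do rewrite mulrC.
by rewrite (sum_chi (fun=> f x)).
Qed.

Lemma E_step_sqr n (v : 'I_n.+1 -> R) : E (fun x => step v x ^+ 2) = \sum_k v k ^+ 2.
Proof.
have -> : E (fun x => step v x ^+ 2) = E (fun x => \sum_k (n.+1%:R * v k ^+ 2) * chi n k x).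
  by apply: eq_E => x; rewrite (sum_chi (fun k => n.+1%:R * v k ^+ 2)) exprMn scale2.
rewrite Esum; last by move=> k; apply: intgZ; exact: intg_chi.
apply: eq_bigr => k _; rewrite EZ ?E_chi; last exact: intg_chi.
by rewrite mulrAC mulfV ?mul1r// pnatr_eq0.
Qed.

(** Bessel's inequality, from Cauchy-Schwarz on each cell. *)
Lemma cell_coord_sqr_le n f : sqintg P f -> \sum_k cell_coord n f k ^+ 2 <= E (fun x => f x ^+ 2).
Proof.
move=> sf; rewrite (E_partition n sf.2); apply: ler_sum => k _.
rewrite exprMn scale2.
have := E_CauchySchwarz (sqintg_chi k) (sqintg_chiM k sf).
have -> : E (fun x => chi n k x * (chi n k x * f x)) = E (fun x => chi n k x * f x).
  by apply: eq_E => x; rewrite mulrA chi_idem.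
have -> : E (fun x => chi n k x ^+ 2) = n.+1%:R^-1.
  by rewrite -(E_chi k); apply: eq_E => x; rewrite expr2 chi_idem.
have -> : E (fun x => (chi n k x * f x) ^+ 2) = E (fun x => chi n k x * f x ^+ 2).
  by apply: eq_E => x; rewrite exprMn [chi n k x ^+ 2]expr2 chi_idem.
by rewrite mulrC ler_pdivlMr ?ltr0Sn// mulrC.
Qed.

Lemma cell_coordD n f g k : intg P f -> intg P g ->
  cell_coord n (fun x => f x + g x) k = cell_coord n f k + cell_coord n g k.
Proof.
move=> fi gi; rewrite /cell_coord -mulrDr -ED; try exact: intg_chiM.
by congr (_ * _); apply: eq_E => x; rewrite mulrDr.
Qed.

Lemma cell_coordZ n a f k : intg P f -> cell_coord n (fun x => a * f x) k = a * cell_coord n f k.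
Proof.
move=> fi; rewrite /cell_coord mulrCA; congr (_ * _); rewrite -EZ; last exact: intg_chiM.
by apply: eq_E => x; rewrite mulrCA.
Qed.

Lemma cell_coordB n f g k : intg P f -> intg P g ->
  cell_coord n (fun x => f x - g x) k = cell_coord n f k - cell_coord n g k.
Proof.
move=> fi gi; rewrite /cell_coord -mulrBr -EB; try exact: intg_chiM.
by congr (_ * _); apply: eq_E => x; rewrite mulrBr.
Qed.

Lemma cell_coord_sum n (I : Type) (s : seq I) (f : I -> T -> R) k : (forall i, intg P (f i)) ->
  cell_coord n (fun x => \sum_(i <- s) f i x) k = \sum_(i <- s) cell_coord n (f i) k.
Proof.
move=> fi; rewrite /cell_coord -mulr_sumr -Esum; last by move=> i; exact: intg_chiM.
by congr (_ * _); apply: eq_E => x; rewrite mulr_sumr.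
Qed.

Lemma average_bounded n f M : intg P f -> (forall x, `|f x| <= M) ->
  forall x, `|average n f x| <= M.
Proof.
move=> fi fM x; have M0 : 0 <= M := le_trans (normr_ge0 _) (fM x).
rewrite /average /step /cell_coord mulrA -expr2 scale2 normrM normr_nat.
rewrite mulrC -ler_pdivlMr ?ltr0Sn//.
rewrite (le_trans (Eabs (intg_chiM _ fi)))// -(E_chi (kap n x)) -EZ//; last exact: intg_chi.
apply: Ele; [exact/intg_norm/intg_chiM|by apply: intgZ; exact: intg_chi|].
by move=> y; rewrite normrM ger0_norm ?chi_ge0// mulrC ler_wpM2r ?chi_ge0.
Qed.

Hypothesis average_cvg : forall f, intg P f ->
  E (fun x => `|f x - average n f x|) @[n --> \oo] --> 0.

(** * Compressions of an integral operator to step functions *)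

Section kernel_operator.
Variable W : T * T -> R.
Hypothesis mW : measurable_fun setT W.
Hypothesis W1 : forall z, `|W z| <= 1.

(* gram n is the matrix of the compression of op to the step functions, in the
   orthonormal basis of the functions scale n * chi n k. *)
Definition op f x := \int[P]_y (W (x, y) * f y).
Definition gram n k l := cell_coord n (fun x => scale n * op (chi n l) x) k.
Arguments gram : clear implicits.
Definition Wavg n (z : T * T) := average n (fun y => W (z.1, y)) z.2.

Lemma intg_Wprod f : intg P f -> intg (P \x P)%E (fun z => W z * f z.2).
Proof.
move=> fi; apply: (intg_le (g := fun z => `|f z.2|)).
- apply: measurable_funM => //.
  by apply: (measurableT_comp (intg_measurable fi)).
- by move=> z; rewrite normrM ler_piMl.
- exact: (intg_norm (intg_snd P fi)).
Qed.

Lemma intg_W f x : intg P f -> intg P (fun y => W (x, y) * f y).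
Proof.
move=> fi; apply: (intg_le (g := fun y => `|f y|)); last exact: intg_norm.
  by apply: measurable_funM; [exact: measurable_sect1|exact: intg_measurable fi].
by move=> y; rewrite normrM ler_piMl.
Qed.

Lemma intg_Wx x : intg P (fun y => W (x, y)).
Proof. by apply: (intg_bounded P (M := 1)) => //; exact: measurable_sect1. Qed.

Lemma measurable_op f : intg P f -> measurable_fun setT (op f).
Proof. by move=> /intg_Wprod; exact: measurable_E. Qed.

Lemma op_bounded f x : intg P f -> `|op f x| <= E (fun y => `|f y|).
Proof.
move=> fi; rewrite (le_trans (Eabs (intg_W x fi)))//.
apply: Ele; [exact/intg_norm/intg_W|exact: intg_norm|].
by move=> y; rewrite normrM ler_piMl.
Qed.

Lemma sqintg_op f : intg P f -> sqintg P (op f).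
Proof.
move=> fi; apply: (sqintg_bounded P (M := E (fun y => `|f y|)) (measurable_op fi)) => x; exact: op_bounded.
Qed.

Lemma intg_op f : intg P f -> intg P (op f).
Proof. by move=> /sqintg_op/sqintg_intg. Qed.

Lemma opZ a f x : intg P f -> op (fun y => a * f y) x = a * op f x.
Proof.
move=> fi; rewrite /op -EZ; last exact: intg_W.
by apply: eq_E => y; rewrite mulrCA.
Qed.

Lemma op_sum (I : Type) (s : seq I) (f : I -> T -> R) x : (forall i, intg P (f i)) ->
  op (fun y => \sum_(i <- s) f i y) x = \sum_(i <- s) op (f i) x.
Proof.
move=> fi; rewrite /op -Esum; last by move=> i; exact: intg_W.
by apply: eq_E => y; rewrite mulr_sumr.
Qed.

Lemma op_step n (v : 'I_n.+1 -> R) x :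
  op (step v) x = \sum_l v l * (scale n * op (chi n l) x).
Proof.
have -> : op (step v) x = op (fun y => \sum_l (scale n * v l) * chi n l y) x.
  by apply: eq_E => y; rewrite stepE.
rewrite op_sum; last by move=> l; apply: intgZ; exact: intg_chi.
apply: eq_bigr => l _; rewrite opZ; last exact: intg_chi.
by rewrite mulrCA mulrA.
Qed.

Lemma gram_step n (v : 'I_n.+1 -> R) k :
  \sum_l gram n k l * v l = cell_coord n (op (step v)) k.
Proof.
have ic l : intg P (op (chi n l)) by apply: intg_op; exact: intg_chi.
have -> : cell_coord n (op (step v)) k =
    cell_coord n (fun x => \sum_l v l * (scale n * op (chi n l) x)) k.
  by congr (_ * _); apply: eq_E => x; rewrite op_step.
rewrite cell_coord_sum; last by move=> l; apply: intgZ; exact: intgZ.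
by apply: eq_bigr => l _; rewrite cell_coordZ 1?mulrC//; exact: intgZ.
Qed.

(** An entry is n + 1 times the integral of W over a product of two cells, each of measure
    1/(n+1). *)
Lemma gram_le n k l : `|gram n k l| <= n.+1%:R^-1.
Proof.
have ic : intg P (op (chi n l)) by apply: intg_op; exact: intg_chi.
rewrite /gram cell_coordZ// /cell_coord mulrA -expr2 scale2 normrM normr_nat.
have N0 : 0 < n.+1%:R :> R by rewrite ltr0Sn.
rewrite -ler_pdivlMl// (le_trans (Eabs (intg_chiM _ ic)))//.
rewrite -[X in X * _](E_chi k) mulrC -EZ; last exact: intg_chi.
apply: Ele; [exact/intg_norm/intg_chiM|by apply: intgZ; exact: intg_chi|].
move=> x; rewrite normrM ger0_norm ?chi_ge0// mulrC ler_wpM2r ?chi_ge0//.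
rewrite (le_trans (op_bounded _ (intg_chi _)))// -(E_chi l).
by rewrite le_eqVlt; apply/orP; left; apply/eqP/eq_E => y; rewrite ger0_norm ?chi_ge0.
Qed.

Lemma WavgE n x y : Wavg n (x, y) = \sum_l (n.+1%:R * op (chi n l) x) * chi n l y.
Proof.
rewrite (sum_chi (fun l => n.+1%:R * op (chi n l) x)) /Wavg /average /step /cell_coord /=.
rewrite mulrA -expr2 scale2; congr (_ * _); apply: eq_E => u; exact: mulrC.
Qed.

Lemma Wavg_le1 n z : `|Wavg n z| <= 1.
Proof.
case: z => x y; rewrite /Wavg /=.
apply: (@average_bounded n (fun y => W (x, y)) 1) => //; exact: intg_Wx.
Qed.

Lemma measurable_Wavg n : measurable_fun setT (Wavg n).
Proof.
rewrite (_ : Wavg n = fun z => \sum_l (n.+1%:R * op (chi n l) z.1) * chi n l z.2); last first.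
  by apply/funext => -[x y]; exact: WavgE.
apply: measurable_sum => l; apply: measurable_funM; last first.
  by apply: (measurableT_comp (measurable_chi l)).
apply: measurable_funM => //.
by apply: (measurableT_comp (measurable_op (intg_chi l))).
Qed.

(** Averaging is self-adjoint, so it can be moved from the function to the second variable of the
    kernel. *)
Lemma op_average n f x : intg P f ->
  op (average n f) x = \int[P]_y (Wavg n (x, y) * f y).
Proof.
move=> fi; rewrite op_step.
have -> : \int[P]_y (Wavg n (x, y) * f y) =
    \int[P]_y (\sum_l (n.+1%:R * op (chi n l) x) * (chi n l y * f y)).
  by apply: eq_E => y; rewrite WavgE mulr_suml; apply: eq_bigr => l _; rewrite mulrA.
rewrite Esum; last by move=> l; apply: intgZ; exact: intg_chiM.
apply: eq_bigr => l _; rewrite EZ; last exact: intg_chiM.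
by rewrite /cell_coord -scale2; ring.
Qed.

(** The expectation of [defect n] is the squared Hilbert-Schmidt norm of the difference of W and
    [Wavg n]; all errors of the approximation are measured by it. *)
Definition defect n x := \int[P]_y ((W (x, y) - Wavg n (x, y)) ^+ 2).

Lemma W_Wavg_le2 n z : `|W z - Wavg n z| <= 2.
Proof. by rewrite (le_trans (ler_normB _ _))// -[2]/(1 + 1) lerD// Wavg_le1. Qed.

Lemma measurable_W_Wavg n : measurable_fun setT (fun z => W z - Wavg n z).
Proof. by apply: measurable_funB => //; exact: measurable_Wavg. Qed.

Lemma sqintg_W_Wavg n x : sqintg P (fun y => W (x, y) - Wavg n (x, y)).
Proof.
apply: (sqintg_bounded P (M := 2)).
  exact: (measurable_sect1 x (measurable_W_Wavg n)).
by move=> y; exact: W_Wavg_le2.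
Qed.

Lemma intg_defect_prod n : intg (P \x P)%E (fun z => (W z - Wavg n z) ^+ 2).
Proof.
apply: (intg_prod_bounded P P (M := 4)).
  by apply: measurable_funX; exact: measurable_W_Wavg.
move=> z; rewrite normrX; have := W_Wavg_le2 n z; have := normr_ge0 (W z - Wavg n z).
nra.
Qed.

Lemma intg_defect n : intg P (defect n).
Proof. by apply: (intg_E (intg_defect_prod n)) => x; exact: (sqintg_W_Wavg n x).2. Qed.

Lemma defect_ge0 n x : 0 <= defect n x.
Proof. by apply: Ege0 => y; exact: sqr_ge0. Qed.

(** Both kernels are bounded by 1, so the L1 convergence of averages gives convergence in L2. *)
Lemma defect_le n x : defect n x <= 2 * \int[P]_y `|W (x, y) - Wavg n (x, y)|.
Proof.
have h := sqintg_W_Wavg n x; have hi := intg_norm (sqintg_intg h).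
rewrite -EZ//; apply: Ele; [exact: h.2|exact: intgZ|move=> y].
rewrite -real_normK ?num_real// expr2 ler_wpM2r//; exact: W_Wavg_le2.
Qed.

Lemma defect_cvg x : defect n x @[n --> \oo] --> 0.
Proof.
apply: (@squeeze_cvgr _ _ _ _ (fun=> 0)
  (fun n => 2 * \int[P]_y `|W (x, y) - Wavg n (x, y)|)).
- by apply: nearW => n; rewrite defect_ge0 defect_le.
- exact: cvg_cst.
- rewrite -(mulr0 2); apply: cvgM; first exact: cvg_cst.
  exact: (average_cvg (intg_Wx x)).
Qed.

Lemma E_defect_cvg : E (defect n) @[n --> \oo] --> 0.
Proof.
have md n : measurable_fun setT (EFin \o defect n).
  by apply/measurable_EFinP; exact: intg_measurable (intg_defect n).
have d4 n x : `|defect n x| <= 4.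
  rewrite ger0_norm ?defect_ge0//; apply: E_le_cst; first exact: (sqintg_W_Wavg n x).2.
  move=> y; have := W_Wavg_le2 n (x, y); have := normr_ge0 (W (x, y) - Wavg n (x, y)).
  by rewrite -[_ ^+ 2]real_normK ?num_real//; nra.
have [_ _ h] : [/\ P.-integrable setT (cst 0%E),
    (\int[P]_x `|(defect n x)%:E - 0|)%E @[n --> \oo] --> 0%E &
    (\int[P]_x (defect n x)%:E)%E @[n --> \oo] --> (\int[P]_x cst 0 x)%E].
  apply: (dominated_convergence measurableT md (measurable_cst _) _ (intg_cst P 4)).
  - apply: aeW => x _; apply: cvg_EFin; last exact: defect_cvg.
    exact: nearW.
  - by apply: aeW => x n _; rewrite lee_fin.
move: h; rewrite integral0 => /fine_cvg; exact.
Qed.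

Lemma op_average_sqr_le_pointwise n f x : sqintg P f ->
  (op f x - op (average n f) x) ^+ 2 <= defect n x * E (fun x => f x ^+ 2).
Proof.
move=> sf; have fi := sqintg_intg sf.
rewrite op_average// -EB; last 2 first.
- exact: intg_W.
- have -> : (fun y => Wavg n (x, y) * f y) = (fun y => W (x, y) * f y -
      (W (x, y) - Wavg n (x, y)) * f y).
    by apply/funext => y; ring.
  by apply: intgB; [exact: intg_W|apply: sqintgM => //; exact: sqintg_W_Wavg].
have := E_CauchySchwarz (sqintg_W_Wavg n x) sf.
by congr (_ ^+ 2 <= _); apply: eq_E => y; rewrite mulrBl.
Qed.

Lemma op_average_sqr_le n f : sqintg P f ->
  E (fun x => (op f x - op (average n f) x) ^+ 2) <= E (defect n) * E (fun x => f x ^+ 2).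
Proof.
move=> sf; have fi := sqintg_intg sf.
rewrite mulrC -EZ; last exact: intg_defect.
apply: Ele.
- by have [] := sqintgB (sqintg_op fi) (sqintg_op (sqintg_intg (sqintg_step (cell_coord n f)))).
- by apply: intgZ; exact: intg_defect.
by move=> x; rewrite mulrC; exact: op_average_sqr_le_pointwise.
Qed.

(** By [gram_step], the matrix sends the coordinates of f to those of [op (average n f)]; Bessel's
    inequality then leaves the norm of the difference of [op (average n f)] and [op f]. *)
Lemma gram_cell_coord_le n f : sqintg P f ->
  \sum_k (\sum_l gram n k l * cell_coord n f l - cell_coord n (op f) k) ^+ 2 <=
  E (defect n) * E (fun x => f x ^+ 2).
Proof.
move=> sf; have fi := sqintg_intg sf.
have si := sqintg_op (sqintg_intg (sqintg_step (cell_coord n f))).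
apply: le_trans (op_average_sqr_le n sf).
have -> : E (fun x => (op f x - op (average n f) x) ^+ 2) =
    E (fun x => (op (average n f) x - op f x) ^+ 2).
  by apply: eq_E => x; rewrite -sqrrN opprB.
apply: le_trans (cell_coord_sqr_le n (sqintgB si (sqintg_op fi))).
apply: ler_sum => k _; rewrite gram_step cell_coordB//.
  exact: sqintg_intg si.
exact: intg_op.
Qed.

End kernel_operator.

Section along_ultrafilter.
Variable G : set_system nat.
Hypothesis GU : UltraFilter G.
Hypothesis Goo : \oo `<=` G.

Local Instance GP2 : ProperFilter G. Proof. exact: ultra_proper. Qed.

Lemma small_cvg (x : nat -> R) : x n @[n --> \oo] --> 0 -> small G x.
Proof. by move=> h B /h /Goo. Qed.

Lemma E_norm_step n (v : 'I_n.+1 -> R) :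
  E (fun x => `|step v x|) ^+ 2 <= \sum_k v k ^+ 2.
Proof.
have [ms si] := sqintg_step v.
rewrite -E_step_sqr; have := @sqr_E_le _ _ _ P (fun x => `|step v x|).
have -> : E (fun x => `|step v x| ^+ 2) = E (fun x => step v x ^+ 2).
  by apply: eq_E => x; rewrite real_normK ?num_real.
apply; split; first exact: measurableT_comp.
have -> // : (fun x => `|step v x| ^+ 2) = (fun x => step v x ^+ 2).
by apply/funext => x; rewrite real_normK ?num_real.
Qed.

(** The function f is close in L1 to its averages, whose L1 norms are at most the Euclidean norms of
    the coordinates. *)
Lemma cell_coord_small_eq0 f : intg P f -> small G (fun n => \sum_k cell_coord n f k ^+ 2) ->
  E (fun x => `|f x|) = 0.
Proof.
move=> fi f0.
have h1 := small_cvg (average_cvg fi).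
have h2 : small G (fun n => E (fun x => `|average n f x|)).
  apply: (small_sqrt GU); apply: (small_leT GU) f0 => n.
  by rewrite ger0_norm ?sqr_ge0// E_norm_step.
apply: (small_cst GU).
apply: (small_leT GU) (smallD GU h1 h2) => n.
have ai : intg P (average n f) by apply: sqintg_intg; exact: sqintg_step.
have di := intgB fi ai.
rewrite ger0_norm; last by apply: Ege0 => x.
rewrite -ED; try exact: intg_norm.
apply: Ele; [exact: intg_norm|by apply: intgD; exact: intg_norm|].
by move=> x; rewrite -[X in `|X| <= _](subrK (average n f x)) ler_normD.
Qed.

(** * Compactness: images of bounded sequences converge along G *)

Section compactness.
Variable W : T * T -> R.
Hypothesis mW : measurable_fun setT W.
Hypothesis W1 : forall z, `|W z| <= 1.
Variables (v : forall n, 'I_n.+1 -> R) (M : R).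
Hypothesis vM : forall n, \sum_(k < n.+1) v k ^+ 2 <= M.

Let u n := step (@v n).
Let su n : sqintg P (u n). Proof. exact: sqintg_step. Qed.
Let iu n : intg P (u n). Proof. exact: sqintg_intg. Qed.
Let uM n : E (fun x => u n x ^+ 2) <= M. Proof. by rewrite E_step_sqr. Qed.
Let M0 : 0 <= M.
Proof. by apply: le_trans (uM 0); apply: Ege0 => x; exact: sqr_ge0. Qed.

Let le_add1 (a : R) : a ^+ 2 <= M -> `|a| <= 1 + M.
Proof.
move=> aM; have := sqr_ge0 (`|a| - 1); rewrite sqrrB real_normK ?num_real//.
by have := normr_ge0 a; lra.
Qed.

(* The limit g along G of measurable functions need not be measurable; but g is
   also the limit of the sequence h below, in which averaging makes the limit
   along G a finite combination of measurable functions. *)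
Let g_ex x : exists l, small G (fun n => op W (u n) x - l).
Proof.
apply: (@ultra_limit _ _ GU _ (1 + M)) => n.
apply: le_trans (op_bounded mW W1 x (iu n)) _.
rewrite -[leLHS]ger0_norm; last by apply: Ege0.
by apply: le_add1; apply: le_trans (E_norm_step (@v n)) _.
Qed.
Let g x := sval (cid (g_ex x)).
Let gP x : small G (fun n => op W (u n) x - g x).
Proof. exact: svalP (cid (g_ex x)). Qed.

Let c_ex q (l : 'I_q.+1) : exists c, small G (fun n => cell_coord q (u n) l - c).
Proof.
apply: (@ultra_limit _ _ GU _ (1 + M)) => n; apply: le_add1.
apply: le_trans (uM n); apply: le_trans (cell_coord_sqr_le q (su n)).
by rewrite (bigD1 l)//= lerDl sumr_ge0// => i _; exact: sqr_ge0.
Qed.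
Let c q (l : 'I_q.+1) := sval (cid (c_ex l)).
Let cP q (l : 'I_q.+1) : small G (fun n => cell_coord q (u n) l - c l).
Proof. exact: svalP (cid (c_ex l)). Qed.

Let h q x := \sum_(l < q.+1) c l * (scale q * op W (chi q l) x).
(** A bound, uniform in x, for the squared distance of [op W (average q (u n)) x] from its limit
    [h q x]. Uniformity allows integrating the estimate over x; dominated convergence is a statement
    about sequences and does not cover limits along G. *)
Let delta q n := (\sum_(l < q.+1) `|cell_coord q (u n) l - c l| * scale q) ^+ 2.

Let delta_small q : small G (delta q).
Proof.
apply: (small_sqr GU).
elim: (index_enum _) => [|l s ih].
  by apply: small_ext (small0 GU) => n; rewrite big_nil.
have := smallD GU (smallM GU (scale q) (small_normr GU (cP l))) ih.
by apply: small_ext => n; rewrite big_cons mulrC.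
Qed.

Let h_le q n x : (op W (average q (u n)) x - h q x) ^+ 2 <= delta q n.
Proof.
rewrite op_step// /h -sumrB -[leLHS]real_normK ?num_real// lerXn2r ?nnegrE//.
  by apply: sumr_ge0 => l _; rewrite mulr_ge0 ?scale_ge0.
rewrite (le_trans (ler_norm_sum _ _ _))//; apply: ler_sum => l _.
rewrite -mulrBl normrM ler_wpM2l// normrM ger0_norm ?scale_ge0//.
rewrite ler_piMr ?scale_ge0// (le_trans (op_bounded mW W1 x (intg_chi l)))//.
apply: E_le_cst; first exact: (intg_norm (intg_chi l)).
by move=> y; rewrite chi_le1.
Qed.

Let sqr3 (a b e : R) : (a + b + e) ^+ 2 <= 3 * (a ^+ 2 + b ^+ 2 + e ^+ 2).
Proof.
have := sqr_ge0 (a - b); have := sqr_ge0 (a - e); have := sqr_ge0 (b - e); nra.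
Qed.

(** This is [op_average_sqr_le_pointwise] for [u n], passed to the limit along G at a fixed x. *)
Let h_g q x : (h q x - g x) ^+ 2 <= defect W q x * M.
Proof.
have l1 : small G (fun n => op W (average q (u n)) x - h q x).
  apply: (small_sqrt GU); apply: (small_leT GU) (delta_small q) => n.
  by rewrite ger0_norm ?sqr_ge0.
have l2 : small G (fun n => (op W (u n) x - op W (average q (u n)) x) - (g x - h q x)).
  by apply: small_ext (smallD GU (gP x) (smallN GU l1)) => n; ring.
have l3 : small G (fun n => (op W (u n) x - op W (average q (u n)) x) ^+ 2
    - (h q x - g x) ^+ 2).
  apply: small_ext (smallD GU (small_sqr GU l2) (smallM GU (2 * (g x - h q x)) l2)) => n.
  by ring.
apply: (small_lim_le GU (y := fun=> defect W q x * M)) l3 _.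
  apply: nearW => n; apply: le_trans (op_average_sqr_le_pointwise mW W1 q x (su n)) _.
  by rewrite ler_wpM2l ?defect_ge0.
by apply: small_ext (small0 GU) => n; rewrite subrr.
Qed.

Let sh q : sqintg P (h q).
Proof.
rewrite /h; elim: (index_enum _) => [|l s ih].
  rewrite (_ : (fun x => _) = fun=> 0).
    by apply: (sqintg_bounded P (M := 0)) => // x; rewrite normr0.
  by apply/funext => x; rewrite big_nil.
rewrite (_ : (fun x => _) = fun x => c l * (scale q * op W (chi q l) x) +
    \sum_(l <- s) c l * (scale q * op W (chi q l) x)).
  apply: sqintgD => //; do 2 apply: sqintgZ.
  by apply: sqintg_op => //; exact: intg_chi.
by apply/funext => x; rewrite big_cons.
Qed.

Let mg : measurable_fun setT g.
Proof.
apply: (measurable_fun_cvg (h := h)) => [q|x _]; first exact: (sh q).1.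
apply/subr_cvg0; apply/cvgr0Pnorm_lt => e e0.
have M1 : 0 < M + 1 by rewrite ltr_wpDl.
have e2 : 0 < e ^+ 2 / (M + 1) by rewrite divr_gt0// exprn_gt0.
have := defect_cvg mW W1 x => /cvgr0Pnorm_lt /(_ _ e2).
apply: filterS => q; rewrite ger0_norm ?defect_ge0// ltr_pdivlMr// => dq.
rewrite -(@ltr_pXn2r _ 2) ?nnegrE ?(ltW e0)// real_normK ?num_real//.
apply: le_lt_trans (h_g q x) _; apply: le_lt_trans dq.
by rewrite ler_wpM2l ?defect_ge0// lerDl.
Qed.

(** The estimate [h_g] at level 0 bounds the square of h 0 - g by the integrable function M times
    [defect W 0], and h 0 is square integrable. *)
Let sg : sqintg P g.
Proof.
have sgh : sqintg P (fun x => h 0%N x - g x).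
  split; first by apply: measurable_funB => //; exact: (sh 0).1.
  apply: (intg_le (g := fun x => M * defect W 0 x)).
  - by apply: measurable_funX; apply: measurable_funB => //; exact: (sh 0).1.
  - by move=> x; rewrite ger0_norm ?sqr_ge0// mulrC h_g.
  - by apply: intgZ; exact: intg_defect.
have := sqintgB (sh 0) sgh; congr sqintg.
by apply/funext => x; rewrite subKr.
Qed.

Lemma gram_compact : exists2 g, sqintg P g &
  small G (fun n => \sum_(k < n.+1) (\sum_l gram W k l * v l - cell_coord n g k) ^+ 2).
Proof.
exists g => //.
(* The way from [op W (u n)] to g passes through [op W (average q (u n))] and h q. The outer two
   errors are small for large q, uniformly in n; the middle one is small along G once q is fixed. *)
have step_le n q : \sum_(k < n.+1) (\sum_l gram W k l * v l - cell_coord n g k) ^+ 2 <=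
    3 * (E (defect W q) * M + delta q n + E (defect W q) * M).
  have so := sqintg_op mW W1 (iu n).
  have sa : sqintg P (op W (average q (u n))).
    by apply: sqintg_op => //; apply: sqintg_intg; exact: sqintg_step.
  apply: (@le_trans _ _ (\sum_k cell_coord n (fun x => op W (u n) x - g x) k ^+ 2)).
    apply: ler_sum => k _; rewrite gram_step// cell_coordB//; exact: sqintg_intg.
  apply: le_trans (cell_coord_sqr_le n (sqintgB so sg)) _.
  have s1 := sqintgB so sa; have s2 := sqintgB sa (sh q); have s3 := sqintgB (sh q) sg.
  have := intgD (intgD s1.2 s2.2) s3.2 => s123.
  apply: (@le_trans _ _ (E (fun x => 3 * ((op W (u n) x - op W (average q (u n)) x) ^+ 2 +
      (op W (average q (u n)) x - h q x) ^+ 2 + (h q x - g x) ^+ 2)))).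
    apply: Ele; [exact: (sqintgB so sg).2|exact: intgZ|move=> x].
    by apply: le_trans (sqr3 _ _ _); rewrite le_eqVlt; apply/orP; left; apply/eqP; ring.
  rewrite EZ// ED//; [|exact: (intgD s1.2 s2.2)|exact: s3.2].
  rewrite ED; [|exact: s1.2|exact: s2.2].
  rewrite ler_wpM2l// lerD// ?lerD//.
  - apply: le_trans (op_average_sqr_le mW W1 q (su n)) _.
    by rewrite ler_wpM2l//; apply: Ege0 => x; exact: defect_ge0.
  - by apply: E_le_cst; [exact: s2.2|exact: h_le].
  - rewrite mulrC -EZ; last exact: intg_defect.
    apply: Ele; [exact: s3.2|by apply: intgZ; exact: intg_defect|move=> x].
    by rewrite mulrC h_g.
apply/(smallP _) => e e0.
(* The outer errors will be at most e / 12 each and [delta] less than e / 6, so that three times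
   their sum is below e. The term + 1 covers M = 0. *)
have M1 : 0 < 12 * (M + 1) by rewrite mulr_gt0// ltr_wpDl.
have e2 : 0 < e / (12 * (M + 1)) by rewrite divr_gt0.
have [q dq] : exists q, E (defect W q) < e / (12 * (M + 1)).
  have := E_defect_cvg mW W1 => /cvgr0Pnorm_lt /(_ _ e2) [N _ /(_ N)/= h'].
  by exists N; rewrite (le_lt_trans (ler_norm _))// h'.
have e6 : 0 < e / 6 by rewrite divr_gt0.
have /(smallP _) /(_ _ e6) := delta_small q; apply: filterS => n.
rewrite ger0_norm ?sqr_ge0// => dn.
rewrite ger0_norm; last by apply: sumr_ge0 => k _; exact: sqr_ge0.
apply: le_lt_trans (step_le n q) _.
have : E (defect W q) * M <= e / 12.
  rewrite (@le_trans _ _ (e / (12 * (M + 1)) * M))//; first by rewrite ler_wpM2r// ltW.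
  rewrite invfM mulrA -mulrA ler_piMr ?divr_ge0 ?(ltW e0)//.
  by rewrite mulrC ler_pdivrMr ?mul1r ?lerDl// ltr_wpDl.
by lra.
Qed.

End compactness.
End along_ultrafilter.
End averaging.

(** * Traces *)

Section kernel_powers.
Context d (T : measurableType d) (R : realType).
Variable P : probability T R.
Implicit Types V W : T * T -> R.
Local Notation E f := (\int[P]_x (f x)).

(* kpow W k is the kernel of the power of exponent k + 1. *)
Fixpoint kpow W k : T * T -> R :=
  if k is k'.+1 then fun z => \int[P]_u (W (z.1, u) * kpow W k' (u, z.2)) else W.

Section bounded_kernel.
Variable W : T * T -> R.
Hypothesis mW : measurable_fun setT W.
Hypothesis W1 : forall z, `|W z| <= 1.

Lemma kpow_spec k : measurable_fun setT (kpow W k) /\ forall z, `|kpow W k z| <= 1.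
Proof.
elim: k => [//|k [mk k1]].
pose f (w : (T * T) * T) := W (w.1.1, w.2) * kpow W k (w.2, w.1.2).
have mf : measurable_fun setT f.
  apply: measurable_funM.
    apply: (measurableT_comp mW).
    apply: measurable_fun_pair; last exact: measurable_snd.
    by apply: (measurableT_comp measurable_fst); exact: measurable_fst.
  apply: (measurableT_comp mk).
  apply: measurable_fun_pair; first exact: measurable_snd.
  by apply: (measurableT_comp measurable_snd); exact: measurable_fst.
have f1 w : `|f w| <= 1 by rewrite normrM mulr_ile1.
split.
  exact: (measurable_E (intg_prod_bounded (P \x P)%E P mf f1)).
move=> z.
have fi : intg P (fun u => f (z, u)).
  by apply: (intg_bounded P (M := 1)) => //; exact: measurable_sect1.
rewrite (le_trans (Eabs fi))//; apply: E_le_cst => //; exact: intg_norm.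
Qed.

End bounded_kernel.

Definition trace_kpow W k := \int[P]_x (kpow W k (x, x)).

(** * Continuity of traces of powers in the L1 distance of kernels *)

Section counting.
Variables V W : T * T -> R.
Hypothesis mV : measurable_fun setT V.
Hypothesis V1 : forall z, `|V z| <= 1.
Hypothesis mW : measurable_fun setT W.
Hypothesis W1 : forall z, `|W z| <= 1.

Let dist (p q : T * T -> R) := \int[P]_x (\int[P]_y `|p (x, y) - q (x, y)|).

Let bd (p : T * T -> R) := measurable_fun setT p /\ forall z, `|p z| <= 1.

Let bdB p q : bd p -> bd q -> measurable_fun setT (fun z => `|p z - q z|) /\
  forall z, `| `|p z - q z| | <= 2.
Proof.
move=> [mp p1] [mq q1]; split.
  by apply: measurableT_comp => //; exact: measurable_funB.
by move=> z; rewrite normr_id (le_trans (ler_normB _ _))// -[2]/(1 + 1) lerD.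
Qed.

Let intg_dist p q : bd p -> bd q -> intg (P \x P)%E (fun z => `|p z - q z|).
Proof. by move=> bp /(bdB bp)[m b]; exact: intg_prod_bounded m b. Qed.

Let intg_dist1 p q x : bd p -> bd q -> intg P (fun y => `|p (x, y) - q (x, y)|).
Proof.
move=> bp /(bdB bp)[m b]; apply: (intg_bounded P (M := 2)) => //.
exact: (measurable_sect1 x m).
Qed.

Let intg_dist2 p q y : bd p -> bd q -> intg P (fun x => `|p (x, y) - q (x, y)|).
Proof.
move=> bp /(bdB bp)[m b]; apply: (intg_bounded P (M := 2)) => //.
exact: (measurable_sect2 y m).
Qed.

Let dist_swap p q : bd p -> bd q ->
  \int[P]_y (\int[P]_x `|p (x, y) - q (x, y)|) = dist p q.
Proof.
move=> bp bq; rewrite /dist (E_swap (intg_dist bp bq)) // => x.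
  exact: intg_dist1.
exact: intg_dist2.
Qed.

(** Telescoping V p - W q = (V - W) p + W (p - q), with all kernels bounded by 1. *)
Let prod_le p q x y : bd p -> bd q ->
  `|\int[P]_u (V (x, u) * p (u, y)) - \int[P]_u (W (x, u) * q (u, y))| <=
  \int[P]_u `|V (x, u) - W (x, u)| + \int[P]_u `|p (u, y) - q (u, y)|.
Proof.
move=> bp bq.
have bV : bd V by []. have bW : bd W by [].
have iM (a b : T * T -> R) : bd a -> bd b -> intg P (fun u => a (x, u) * b (u, y)).
  move=> [ma a1] [mb b1]; apply: (intg_bounded P (M := 1)).
    by apply: measurable_funM; [exact: measurable_sect1|exact: measurable_sect2].
  by move=> u; rewrite normrM mulr_ile1.
rewrite -EB; try exact: iM.
have i1 := intgB (iM _ _ bV bp) (iM _ _ bW bq).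
rewrite (le_trans (Eabs i1))// -ED; [|exact: intg_dist1|exact: intg_dist2].
apply: Ele; [exact: intg_norm|by apply: intgD; [exact: intg_dist1|exact: intg_dist2]|].
move=> u.
have -> : V (x, u) * p (u, y) - W (x, u) * q (u, y) =
  (V (x, u) - W (x, u)) * p (u, y) + W (x, u) * (p (u, y) - q (u, y)) by ring.
rewrite (le_trans (ler_normD _ _))// !normrM lerD//.
  by rewrite ler_piMr// bp.2.
by rewrite ler_piMl.
Qed.

Let bdk (U : T * T -> R) (mU : measurable_fun setT U) (U1 : forall z, `|U z| <= 1) k : bd (kpow U k).
Proof. exact: kpow_spec. Qed.

Lemma dist_kpow k : dist (kpow V k) (kpow W k) <= k.+1%:R * dist V W.
Proof.
have bV : bd V by []. have bW : bd W by [].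
elim: k => [|k ih]; first by rewrite mul1r.
have bp := bdk mV V1 k; have bq := bdk mW W1 k.
have bp' := bdk mV V1 k.+1; have bq' := bdk mW W1 k.+1.
have i1 : intg P (fun x => \int[P]_u `|V (x, u) - W (x, u)|).
  by apply: (intg_E (intg_dist bV bW)) => x; exact: intg_dist1.
have i2 : intg P (fun y => \int[P]_u `|kpow V k (u, y) - kpow W k (u, y)|).
  have := intg_E (P1 := P) (P2 := P) (h := fun z => `|kpow V k (z.2, z.1) - kpow W k (z.2, z.1)|).
  apply; last by move=> y; exact: intg_dist2.
  have [m b] := bdB bp bq.
  apply: (intg_prod_bounded P P (M := 2)) => [|z]; last exact: (b (z.2, z.1)).
  by apply: (measurableT_comp m); exact: measurable_swap.
rewrite -natr1 mulrDl mul1r.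
apply: (@le_trans _ _ (\int[P]_x (\int[P]_u `|V (x, u) - W (x, u)| +
    dist (kpow V k) (kpow W k)))).
  apply: Ele.
  - by apply: (intg_E (intg_dist bp' bq')) => x; exact: intg_dist1.
  - by apply: intgD => //; exact: intg_cst.
  move=> x; rewrite -(dist_swap bp bq) -(E_cst P (\int[P]_u `|V (x, u) - W (x, u)|)).
  rewrite -ED => //; last exact: intg_cst.
  apply: Ele; [exact: intg_dist1|by apply: intgD => //; exact: intg_cst|].
  by move=> y; exact: prod_le.
rewrite ED//; last exact: intg_cst.
by rewrite E_cst addrC lerD2r.
Qed.

(** The diagonal is a null set, so the L1 distance says nothing about the trace of a single kernel.
    The kernel of a product of at least two factors is an integral even on the diagonal, which
    explains the exponent [k.+1], that is, at least two factors. *)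
Lemma trace_kpow_dist k :
  `|trace_kpow V k.+1 - trace_kpow W k.+1| <= k.+2%:R * dist V W.
Proof.
have bV : bd V by []. have bW : bd W by [].
have bp := bdk mV V1 k; have bq := bdk mW W1 k.
have idiag (U : T * T -> R) : bd U -> intg P (fun x => U (x, x)).
  move=> [mU U1]; apply: (intg_bounded P (M := 1)) => //.
  by apply: (measurableT_comp mU); exact: measurable_fun_pair.
have i1 := idiag _ (bdk mV V1 k.+1); have i2 := idiag _ (bdk mW W1 k.+1).
rewrite /trace_kpow -EB// (le_trans (Eabs (intgB i1 i2)))//.
have i3 : intg P (fun x => \int[P]_u `|V (x, u) - W (x, u)|).
  by apply: (intg_E (intg_dist bV bW)) => x; exact: intg_dist1.
have i4 : intg P (fun y => \int[P]_u `|kpow V k (u, y) - kpow W k (u, y)|).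
  have := intg_E (P1 := P) (P2 := P) (h := fun z => `|kpow V k (z.2, z.1) - kpow W k (z.2, z.1)|).
  apply; last by move=> y; exact: intg_dist2.
  have [m b] := bdB bp bq.
  apply: (intg_prod_bounded P P (M := 2)) => [|z]; last exact: (b (z.2, z.1)).
  by apply: (measurableT_comp m); exact: measurable_swap.
apply: (@le_trans _ _ (\int[P]_x (\int[P]_u `|V (x, u) - W (x, u)| +
    \int[P]_u `|kpow V k (u, x) - kpow W k (u, x)|))).
  apply: Ele; [by apply: intg_norm; exact: intgB|exact: intgD|].
  by move=> x; exact: prod_le.
rewrite ED// (dist_swap bp bq) -natr1 mulrDl mul1r addrC lerD2r.
exact: dist_kpow.
Qed.

(** Two uses of [sqr_E_le]. For the pair W, [Wavg n] the right-hand side is the expectation of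
    [defect n]. *)
Lemma dist_sqr_le : dist V W ^+ 2 <= \int[P]_x (\int[P]_y ((V (x, y) - W (x, y)) ^+ 2)).
Proof.
have bV : bd V by []. have bW : bd W by [].
have [m b] := bdB bV bW.
have s1 x : sqintg P (fun y => `|V (x, y) - W (x, y)|).
  by apply: (sqintg_bounded P (M := 2)) => //; exact: (measurable_sect1 x m).
have s2 : sqintg P (fun x => \int[P]_y `|V (x, y) - W (x, y)|).
  apply: (sqintg_bounded P (M := 2)).
    exact: (measurable_E (intg_dist bV bW)).
  move=> x; rewrite (le_trans (Eabs (intg_dist1 x bV bW)))//.
  by apply: E_le_cst => //; apply: intg_norm; exact: intg_dist1.
apply: le_trans (sqr_E_le s2) _; apply: Ele; first exact: s2.2.
  apply: (@intg_E _ _ _ _ _ P P (fun z => (V z - W z) ^+ 2)).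
    apply: (intg_prod_bounded P P (M := 4)).
      by apply: measurable_funX; exact: measurable_funB.
    move=> z; have := b z; rewrite normr_id normrX => bz.
    have := normr_ge0 (V z - W z); nra.
  move=> x; have := (s1 x).2; congr intg.
  by apply/funext => y; rewrite real_normK ?num_real.
move=> x; apply: le_trans (sqr_E_le (s1 x)) _.
rewrite le_eqVlt; apply/orP; left; apply/eqP/eq_E => y.
by rewrite real_normK ?num_real.
Qed.

End counting.

(** * Traces of powers of the compressed matrices *)

Section trace_gram.
Variable kap : forall n, T -> 'I_n.+1.
Hypothesis kap_measurable : forall n k, measurable (kap n @^-1` [set k]).
Hypothesis kap_measure : forall n k, P (kap n @^-1` [set k]) = (n.+1%:R^-1)%:E.
Hypothesis average_cvg : forall f, intg P f ->
  E (fun x => `|f x - average P kap n f x|) @[n --> \oo] --> 0.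
Variable W : T * T -> R.
Hypothesis mW : measurable_fun setT W.
Hypothesis W1 : forall z, `|W z| <= 1.

Definition gram_mx n : 'M[R]_n.+1 := \matrix_(k, l) gram P kap W k l.

Local Notation chi n l := (@chi _ _ R kap n l).
Local Notation opc n l := (op P W (chi n l)).

Let intg_opc n l : intg P (opc n l).
Proof. by apply: intg_op => //; exact: intg_chi. Qed.

Let gram_mxE n (k l : 'I_n.+1) :
  gram_mx n k l = n.+1%:R * \int[P]_x (chi n k x * opc n l x).
Proof.
rewrite mxE /gram cell_coordZ//.
by rewrite /cell_coord mulrA -expr2 scale2.
Qed.

(* Averaging W in its second variable only is enough to make the powers of W
   expressible through the powers of the matrix. *)
Lemma kpow_Wavg n k x y : kpow (Wavg P kap W n) k (x, y) =
  \sum_j (n.+1%:R * opc n j x) * (gram_mx n ^+ k) j (kap n y).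
Proof.
elim: k x => [|k ih] x.
  rewrite /= WavgE// (sum_chi kap (fun l => n.+1%:R * opc n l x)).
  rewrite (bigD1 (kap n y))//= big1 ?addr0 => [|j /negPf jy].
    by rewrite mxE eqxx mulr1.
  by rewrite mxE jy mulr0.
rewrite [LHS]/=.
transitivity (\int[P]_u (\sum_i (n.+1%:R * opc n i x) *
    (\sum_j (n.+1%:R * (gram_mx n ^+ k) j (kap n y)) * (chi n i u * opc n j u)))).
  apply: eq_E => u; rewrite ih WavgE// mulr_suml; apply: eq_bigr => i _.
  rewrite -(mulrA (n.+1%:R * opc n i x)); congr (_ * _).
  by rewrite mulr_sumr; apply: eq_bigr => j _; ring.
have ij i j : intg P (fun u => n.+1%:R * (gram_mx n ^+ k) j (kap n y) * (chi n i u * opc n j u)).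
  by apply: intgZ; apply: intg_chiM.
rewrite Esum; last by move=> i; apply: intgZ; exact: intg_sum.
apply: eq_bigr => i _; rewrite EZ; last exact: intg_sum.
congr (_ * _); rewrite Esum// exprS mxE; apply: eq_bigr => j _.
rewrite EZ; last exact: intg_chiM.
by rewrite gram_mxE; ring.
Qed.

Lemma trace_gram n k : \tr (gram_mx n ^+ k.+1) = trace_kpow (Wavg P kap W n) k.
Proof.
have ij i j : intg P (fun u => n.+1%:R * (gram_mx n ^+ k) j i * (chi n i u * opc n j u)).
  by apply: intgZ; apply: intg_chiM.
rewrite /trace_kpow; transitivity (\int[P]_x (\sum_i \sum_j
    n.+1%:R * (gram_mx n ^+ k) j i * (chi n i x * opc n j x))).
  rewrite Esum; last by move=> i; exact: intg_sum.
  rewrite /mxtrace; apply: eq_bigr => i _; rewrite Esum// exprS mxE.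
  apply: eq_bigr => j _; rewrite EZ; last exact: intg_chiM.
  by rewrite gram_mxE; ring.
apply: eq_E => x; rewrite kpow_Wavg exchange_big /=; apply: eq_bigr => j _.
rewrite (eq_bigr (fun i => (n.+1%:R * (gram_mx n ^+ k) j i * opc n j x) * chi n i x)); last first.
  by move=> i _; ring.
by rewrite (sum_chi kap (fun i => n.+1%:R * (gram_mx n ^+ k) j i * opc n j x)); ring.
Qed.

Lemma trace_gram_cvg k :
  \tr (gram_mx n ^+ k.+2) - trace_kpow W k.+1 @[n --> \oo] --> 0.
Proof.
have md := fun n => measurable_Wavg P kap_measurable mW W1 n.
have w1 n z := Wavg_le1 kap_measurable kap_measure mW W1 n z.
apply/cvgr0Pnorm_lt => e e0.
have e2 : 0 < (e / k.+2%:R) ^+ 2 by rewrite exprn_gt0// divr_gt0.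
have := E_defect_cvg kap_measurable kap_measure average_cvg mW W1.
move=> /cvgr0Pnorm_lt /(_ _ e2); apply: filterS => n h.
rewrite trace_gram distrC; apply: le_lt_trans (trace_kpow_dist mW W1 (md n) (w1 n) k) _.
rewrite -ltr_pdivlMl// mulrC -(@ltr_pXn2r _ 2) ?nnegrE//; last first.
- by rewrite divr_ge0// ltW.
- by apply: Ege0 => x; apply: Ege0 => y; exact: normr_ge0.
apply: le_lt_trans (dist_sqr_le mW W1 (md n) (w1 n)) _.
exact: le_lt_trans (ler_norm _) h.
Qed.

End trace_gram.
End kernel_powers.

(** * The unit interval *)

Section average_contraction.
Context d (T : measurableType d) (R : realType).
Variables (P : probability T R) (kap : forall n, T -> 'I_n.+1).
Hypothesis kap_measurable : forall n k, measurable (kap n @^-1` [set k]).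
Hypothesis kap_measure : forall n k, P (kap n @^-1` [set k]) = (n.+1%:R^-1)%:E.
Implicit Types f g : T -> R.

Lemma intg_average n f : intg P (average P kap n f).
Proof. by apply: sqintg_intg; exact: sqintg_step. Qed.

Lemma averageE n f x :
  average P kap n f x = n.+1%:R * \int[P]_y (chi R kap (kap n x) y * f y).
Proof. by rewrite /average /step /cell_coord mulrA -expr2 scale2. Qed.

(** Averaging contracts the L1 norm, which is what lets convergence of averages pass from continuous
    functions to their L1 limits. *)
Lemma E_average_norm_le n f : intg P f ->
  \int[P]_x `|average P kap n f x| <= \int[P]_x `|f x|.
Proof.
move=> fi; have ai := intg_norm fi.
have ci k : intg P (chi R kap (n := n) k) by exact: intg_chi.
have cfi k : intg P (fun y => chi R kap (n := n) k y * `|f y|) by exact: intg_chiM.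
rewrite (E_partition kap_measurable n ai).
apply: (@le_trans _ _ (\int[P]_x (\sum_k (n.+1%:R *
    \int[P]_y (chi R kap (n := n) k y * `|f y|)) * chi R kap (n := n) k x))).
  apply: Ele.
  - exact: (intg_norm (intg_average _ _)).
  - by apply: intg_sum => k; exact: intgZ.
  move=> x; rewrite (sum_chi kap (fun k => n.+1%:R * \int[P]_y (chi R kap (n := n) k y * `|f y|))).
  rewrite averageE normrM normr_nat ler_wpM2l//.
  have h := intg_chiM kap_measurable (kap n x) fi.
  rewrite (le_trans (Eabs h))//.
  apply: Ele => //; first exact: intg_norm.
  by move=> y; rewrite normrM ger0_norm ?chi_ge0.
rewrite Esum; last by move=> k; exact: intgZ.
apply: ler_sum => k _; rewrite EZ// E_chi//.
by rewrite mulrAC mulfV ?mul1r// pnatr_eq0.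
Qed.

End average_contraction.

Section unit_interval.
Variable R : realType.
Local Notation RR := (measurableTypeR R).
Local Notation P := (@lebesgue01 R).
Local Notation mu := (@lebesgue_measure R).
Implicit Types f g : R -> R.

Lemma integral01 (f : R -> \bar R) :
  (\int[mu]_(x in I01) f x = \int[P]_x (f \_ I01) x)%E.
Proof.
rewrite -[RHS]integral_mkcond; apply: eq_measure_integral => A mA AI.
by rewrite /= /lebesgue01 /mrestr setIidl.
Qed.

Lemma Rintegral01 f : \int[mu]_(x in I01) f x = \int[P]_x (f \_ I01) x.
Proof.
rewrite /Rintegral integral01; congr fine; apply: eq_integral => x _.
by rewrite restrict_EFin.
Qed.

Lemma lebesgue01_out : P (~` (I01 : set RR)) = 0%E.
Proof. by rewrite /lebesgue01 /= /mrestr setICl measure0. Qed.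

Lemma eq_E01 f g : measurable_fun setT f -> measurable_fun setT g ->
  (forall x, I01 x -> f x = g x) -> \int[P]_x f x = \int[P]_x g x.
Proof.
move=> mf mg fg; congr fine; apply: ae_eq_integral => //.
- exact/measurable_EFinP.
- exact/measurable_EFinP.
exists (~` (I01 : set RR)); split.
- by apply: measurableC; exact: measurable_I01.
- exact: lebesgue01_out.
- by move=> x /= h Ix; apply: h => _; rewrite fg.
Qed.

Lemma measurable_patch01 f : measurable_fun I01 f ->
  measurable_fun setT (f \_ (I01 : set RR)).
Proof. by move=> mf; apply/(measurable_restrictT f (@measurable_I01 R)). Qed.

Lemma ae_I01 : {ae P, forall x, I01 x}.
Proof.
exists (~` (I01 : set RR)); split => //; last exact: lebesgue01_out.
by apply: measurableC; exact: measurable_I01.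
Qed.

Lemma patch01E f x : I01 x -> (f \_ (I01 : set RR)) x = f x.
Proof. by move=> Ix; rewrite patchE mem_set. Qed.

(** The measure P does not charge the complement of [0,1]; replacing f by the minimum of f and g
    makes the inequality hold everywhere. *)
Lemma Ele01 f g : intg P f -> intg P g ->
  (forall x, I01 x -> f x <= g x) -> \int[P]_x f x <= \int[P]_x g x.
Proof.
move=> fi gi fg; have mf := intg_measurable fi; have mg := intg_measurable gi.
have mmin : measurable_fun setT (fun x => Num.min (f x) (g x)).
  exact: measurable_minr.
have mi : intg P (fun x => Num.min (f x) (g x)).
  apply: (@intg_le _ RR _ P _ (fun x => `|f x| + `|g x|)) => //.
    by move=> x; rewrite minEle; case: ifP => _; rewrite ?lerDl ?lerDr.
  by apply: intgD; exact: intg_norm.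
rewrite (@eq_E01 f (fun x => Num.min (f x) (g x)))//.
  by apply: Ele => // x; rewrite ge_min lexx orbT.
by move=> x Ix; rewrite min_l// fg.
Qed.

(** The set where [kap n] is at least k. Cells are differences of consecutive levels, and a level is
    a half-line or trivial, so measurability and measures come from intervals. *)
Definition level n k : set R :=
  if k == 0%N then setT else if (k <= n)%N then `[k%:R / n.+1%:R, +oo[%classic else set0.

(* The minimum puts the point 1 into the last cell; values outside of [0,1] do
   not matter. *)
Definition kap n (x : R) : 'I_n.+1 := inord (minn n (Num.truncn (n.+1%:R * x))).

Lemma kap_level n k x : (k <= kap n x)%N <-> level n k x.
Proof.
rewrite /level /kap inordK ?ltnS ?geq_minl// leq_min.
case: eqVneq => [->//|k0]; case: leqP => //= kn.
rewrite in_itv /= andbT; case: k k0 kn => // k _ kn.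
by rewrite truncn_gt_nat ler_pdivrMr ?ltr0Sn// mulrC.
Qed.

Lemma measurable_level n k : measurable (level n k : set RR).
Proof. by rewrite /level; case: ifP => // _; case: ifP => // _; exact: measurable_itv. Qed.

Lemma lebesgue01_level n k : (k <= n.+1)%N -> P (level n k) = (1 - k%:R / n.+1%:R)%:E.
Proof.
move=> kn; rewrite /level.
have [->|k0] := eqVneq k 0%N.
  by rewrite mul0r subr0; exact: probability_setT.
case: leqP => kn'; last first.
  have -> : k = n.+1 by apply/eqP; rewrite eqn_leq kn.
  by rewrite divff ?pnatr_eq0// subrr; exact: measure0.
rewrite /= /lebesgue01 /mrestr.
have kN0 : 0 <= k%:R / n.+1%:R :> R by rewrite divr_ge0.
have kN1 : k%:R / n.+1%:R <= 1 :> R by rewrite ler_pdivrMr ?ltr0Sn// mul1r ler_nat.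
have -> : `[k%:R / n.+1%:R, +oo[%classic `&` (I01 : set RR) = `[k%:R / n.+1%:R, 1]%classic :> set R.
  apply/seteqP; split => x /=; rewrite /I01 /= !in_itv /= ?andbT.
    by move=> [-> /andP[_ ->]].
  by move=> /andP[a b]; split => //; rewrite (le_trans kN0 a).
rewrite lebesgue_measure_itv /= lte_fin; case: ltP => [_//|h].
by have -> : k%:R / n.+1%:R = 1 :> R; [apply/eqP; rewrite eq_le kN1|rewrite subrr].
Qed.

Lemma kap_preimage n (k : 'I_n.+1) : kap n @^-1` [set k] = level n k `\` level n k.+1.
Proof.
apply/seteqP; split => x /=.
  move=> <-; split; first exact/kap_level.
  by move=> /kap_level; rewrite ltnn.
move=> [/kap_level a b]; apply/val_inj/eqP; rewrite eqn_leq a andbT leqNgt.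
by apply/negP => /kap_level.
Qed.

Lemma kap_measurable n (k : 'I_n.+1) : measurable (kap n @^-1` [set k] : set RR).
Proof. by rewrite kap_preimage; apply: measurableD; exact: measurable_level. Qed.

Lemma kap_measure n (k : 'I_n.+1) : P (kap n @^-1` [set k]) = (n.+1%:R^-1)%:E.
Proof.
rewrite kap_preimage.
have sub : level n k.+1 `<=` level n k by move=> x /kap_level h; apply/kap_level; exact: ltnW.
rewrite (measureD (measurable_level n k) (measurable_level n k.+1)); last first.
  by rewrite (le_lt_trans (probability_le1 P (measurable_level n k)))// ltry.
rewrite (setIidr sub).
apply: (etrans (congr2 (fun a b => a - b)%E (lebesgue01_level (ltnW (ltn_ord k)))
  (lebesgue01_level (ltn_ord k)))).
rewrite -EFinB; congr (_%:E).
rewrite -[in X in _ - (_ - X)]natr1.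
have N0 : n.+1%:R != 0 :> R by rewrite pnatr_eq0.
by field.
Qed.

Lemma kap_dist n x y : I01 x -> I01 y -> kap n x = kap n y -> `|x - y| <= n.+1%:R^-1.
Proof.
rewrite /I01 /= !in_itv /= => /andP[x0 x1] /andP[y0 y1] xy.
wlog xley : x y x0 x1 y0 y1 xy / x <= y.
  move=> h; case: (leP x y) => [|/ltW] ?; first exact: h.
  by rewrite distrC; exact: h.
rewrite distrC ger0_norm ?subr_ge0//.
have kx : (kap n x)%:R / n.+1%:R <= x.
  have [k0|k0] := eqVneq (kap n x : nat) 0%N; first by rewrite k0 mul0r.
  have /kap_level := leqnn (kap n x).
  by rewrite /level (negPf k0) -ltnS ltn_ord /= in_itv /= andbT.
have ky : y <= ((kap n x).+1)%:R / n.+1%:R.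
  rewrite xy; have [kn|kn] := ltnP (kap n y) n; last first.
    (* The last cell is bounded by no further level; its right end is 1 = (n+1)/(n+1), and y <=
       1. *)
    have -> : kap n y = n :> nat by apply/eqP; rewrite eqn_leq kn -ltnS ltn_ord.
    by rewrite divff ?pnatr_eq0.
  rewrite leNgt; apply/negP => h.
  have /kap_level : level n (kap n y).+1 y.
    by rewrite /level /= kn /= in_itv /= andbT ltW.
  by rewrite ltnn.
apply: (@le_trans _ _ ((kap n x).+1%:R / n.+1%:R - (kap n x)%:R / n.+1%:R)); first exact: lerB.
by rewrite -mulrBl -natr1 addrAC subrr add0r mul1r.
Qed.

Local Notation avg := (average P (@kap)).

(** Cells shrink, so the averages converge at every point of [0,1], and dominated convergence
    applies. Cutting f off outside [0,1] makes it bounded and takes care of the two unbounded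
    cells. *)
Lemma average_cvg_continuous f : continuous f ->
  \int[P]_x `|(f \_ (I01 : set R)) x - avg n (f \_ (I01 : set R)) x| @[n --> \oo] --> 0.
Proof.
move=> cf; set g := f \_ _.
have mg : measurable_fun setT g.
  by apply: measurable_patch01; apply: measurable_funTS; exact: continuous_measurable_fun.
have [M gM] : exists M, forall x, `|g x| <= M.
  have : bounded_set (f @` I01).
    apply: compact_bounded; apply: continuous_compact; last exact: segment_compact.
    exact: continuous_subspaceT.
  move=> [M [Mreal Mb]]; exists (`|M + 1|) => x; rewrite /g patchE.
  case: ifPn => [/set_mem Ix|_]; last by rewrite normr0.
  apply: (Mb `|M + 1|); last by exists x.
  by rewrite (lt_le_trans _ (ler_norm _))// ltrDl.
have ig : intg P g by apply: (intg_bounded P mg gM).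
have ia n : intg P (avg n g) by apply: intg_average; exact: kap_measurable.
have aM n x : `|avg n g x| <= M.
  exact: (average_bounded (@kap_measurable) (@kap_measure) n ig gM).
have ptw x : I01 x -> `|g x - avg n g x| @[n --> \oo] --> 0.
  move=> Ix; apply/cvgr0Pnorm_lt => e e0.
  have e2 : 0 < e / 2 by rewrite divr_gt0.
  have /cvgrPdist_le /(_ _ e2) [r /= r0 rP] := cf x.
  have : (n.+1%:R : R)^-1 @[n --> \oo] --> 0 := @cvg_harmonic R.
  move=> /cvgr0Pnorm_lt /(_ _ r0); apply: filterS => n.
  rewrite ger0_norm// => nr; rewrite normr_id.
  have -> : g x = n.+1%:R * \int[P]_y (chi R (@kap) (n := n) (kap n x) y * g x).
    under eq_Rintegral do rewrite mulrC.
    rewrite EZ; last exact: (intg_chi _ (@kap_measurable)).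
    rewrite E_chi; [|exact: kap_measurable|exact: kap_measure].
    by rewrite mulrCA mulfV ?mulr1// pnatr_eq0.
  have i1 : intg P (fun y => chi R (@kap) (n := n) (kap n x) y * g x).
    by apply: intg_chiM; [exact: kap_measurable|exact: intg_cst].
  have i2 : intg P (fun y => chi R (@kap) (n := n) (kap n x) y * g y).
    by apply: intg_chiM => //; exact: kap_measurable.
  rewrite averageE -mulrBr -EB// normrM normr_nat.
  apply: le_lt_trans (_ : e / 2 < e); last by rewrite ltr_pdivrMr// ltr_pMr// ltr1n.
  rewrite -ler_pdivlMl ?ltr0Sn//.
  rewrite (le_trans (Eabs (intgB i1 i2)))//.
  rewrite -[X in _ <= X * _](E_chi (@kap_measurable) (@kap_measure) (kap n x)).
  rewrite mulrC -EZ; last exact: (intg_chi _ (@kap_measurable)).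
  apply: Ele01.
  - by apply: intg_norm; exact: intgB.
  - by apply: intgZ; exact: (intg_chi _ (@kap_measurable)).
  move=> y Iy; rewrite -mulrBr normrM ger0_norm ?chi_ge0// mulrC.
  have [kxy|kxy] := eqVneq (kap n y) (kap n x); last first.
    by rewrite /chi (negPf kxy) !mulr0.
  rewrite ler_wpM2r ?chi_ge0// /g !patch01E//; apply: rP.
  by rewrite /ball_ /=; exact: le_lt_trans (kap_dist Ix Iy (esym kxy)) nr.
have dM n x : `|g x - avg n g x| <= M + M by rewrite (le_trans (ler_normB _ _))// lerD.
have [_ _ h] : [/\ P.-integrable setT (cst 0%E),
    (\int[P]_x `|(`|g x - avg n g x|)%:E - 0|)%E @[n --> \oo] --> 0%E &
    (\int[P]_x (`|g x - avg n g x|)%:E)%E @[n --> \oo] --> (\int[P]_x cst 0 x)%E].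
  apply: (@dominated_convergence _ RR R P setT measurableT _ _ (cst (M + M)%:E)).
  - move=> n; apply/measurable_EFinP.
    by apply: measurableT_comp => //; apply: measurable_funB => //; exact: intg_measurable (ia n).
  - exact: measurable_cst.
  - have [N [mN N0 sN]] := ae_I01; exists N; split => // x /= h; apply: sN => /= Ix.
    apply: h => _; apply: cvg_EFin; [exact: nearW|exact: ptw].
  - exact: intg_cst.
  - by apply: aeW => x n _; rewrite lee_fin normr_id.
by move: h; rewrite integral0 => /fine_cvg.
Qed.

Lemma intg01 f : mu.-integrable (I01 : set RR) (EFin \o f) <-> intg P (f \_ (I01 : set RR)).
Proof.
have absE : (\int[mu]_(x in I01) `|(f x)%:E| =
    \int[P]_x `|((f \_ (I01 : set RR)) x)%:E|)%E.
  rewrite integral01; apply: eq_integral => x _; rewrite !patchE.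
  by case: ifP => // _; rewrite abse0.
split=> /integrableP[/measurable_EFinP mf fi]; apply/integrableP; split.
- by apply/measurable_EFinP; exact: measurable_patch01.
- by move: fi; rewrite /= absE.
- by apply/measurable_EFinP; apply/(measurable_restrictT f (@measurable_I01 R)).
- by rewrite /= absE.
Qed.

Lemma intg_patch01 f : intg P f -> intg P (f \_ (I01 : set RR)).
Proof.
move=> fi; have mf := intg_measurable fi.
apply: (@intg_le _ RR _ P _ (fun x => `|f x|)); last exact: intg_norm.
  by apply: measurable_patch01; exact: measurable_funTS.
by move=> x; rewrite patchE; case: ifP => // _; rewrite normr0.
Qed.

(** Continuous functions are dense in L1 of [0,1]; the errors are f - h, h minus its average, and
    the average of f - h, each below e / 3. *)
Lemma average_cvg f : intg P f ->
  \int[P]_x `|f x - avg n f x| @[n --> \oo] --> 0.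
Proof.
move=> fi; have f01 := (intg01 f).2 (intg_patch01 fi).
have I01lty : (mu (I01 : set RR) < +oo)%E.
  by rewrite /I01 lebesgue_measure_itv /= lte_fin ltr01 oppr0 adde0 ltry.
have [g_ [cg ig gf]] := approximation_continuous_integrable (@measurable_I01 R) I01lty f01.
apply/cvgr0Pnorm_lt => e e0; have e3 : 0 < e / 3 by rewrite divr_gt0.
have [g [cg' ig' gfe]] : exists g, [/\ continuous g, intg P (g \_ (I01 : set RR)) &
    \int[P]_x `|f x - (g \_ (I01 : set RR)) x| < e / 3].
  move: gf => /fine_cvg /cvgr0Pnorm_lt /(_ _ e3) [N _ /(_ N (leqnn N)) /= gN].
  exists (g_ N); split => //; first exact/intg01.
  apply: le_lt_trans gN; apply: le_trans (ler_norm _).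
  rewrite -/(Rintegral _ _ _) Rintegral01.
  have i1 := intgB fi ((intg01 (g_ N)).1 (ig N)).
  rewrite le_eqVlt; apply/orP; left; apply/eqP; apply: eq_E01.
  - exact: intg_measurable (intg_norm i1).
  - apply: measurable_patch01; apply: measurableT_comp => //; apply: measurable_funTS.
    by apply: measurable_funB; [exact: intg_measurable fi|exact: continuous_measurable_fun].
  by move=> x Ix; rewrite !patch01E.
have ig0 := ig'; set h := g \_ _ in ig0 gfe.
have := average_cvg_continuous cg' => /cvgr0Pnorm_lt /(_ _ e3); apply: filterS => n.
rewrite -/h ger0_norm => [hn|]; last by apply: Ege0.
rewrite ger0_norm; last by apply: Ege0.
have ia : forall k, intg P k -> intg P (avg n k) by move=> k ik; apply: intg_average; exact: kap_measurable.
have i1 := intgB fi ig0.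
have h3 := E_average_norm_le (@kap_measurable) (@kap_measure) n i1.
have -> : e = e / 3 + e / 3 + e / 3 by field.
apply: (@le_lt_trans _ _ (\int[P]_x `|f x - h x| + \int[P]_x `|h x - avg n h x| +
   \int[P]_x `|avg n (fun x => f x - h x) x|)); last by lra.
have i2 := intg_norm i1; have i3 := intg_norm (intgB ig0 (ia _ ig0)).
have i4 := intg_norm (ia _ i1).
rewrite -ED// -ED//; last exact: intgD.
apply: Ele; [exact: (intg_norm (intgB fi (ia _ fi)))|by apply: intgD => //; exact: intgD|].
move=> x; have -> : f x - avg n f x = (f x - h x) + (h x - avg n h x) - avg n (fun x => f x - h x) x.
  by rewrite /average /step cell_coordB//; [ring|exact: kap_measurable].
by rewrite (le_trans (ler_normB _ _))// lerD2r ler_normD.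
Qed.

End unit_interval.

(** * Cycle densities as traces *)

Section cycle_density.
Variable R : realType.
Local Notation RR := (measurableTypeR R).
Local Notation P := (@lebesgue01 R).
Variable W : R * R -> R.
Hypothesis mW : measurable_fun setT (W : RR * RR -> R).
Hypothesis W1 : forall z, `|W z| <= 1.

(* The default value y of nth provides the last vertex of the path. *)
Definition path_weight (s : seq R) (y : R) : R :=
  \prod_(i < size s) W (nth 0 s i, nth y s i.+1).

Lemma path_weight1 x y : path_weight [:: x] y = W (x, y).
Proof. by rewrite /path_weight big_ord1. Qed.

Lemma path_weight_cons x u s y :
  path_weight [:: x, u & s] y = W (x, u) * path_weight (u :: s) y.
Proof. by rewrite /path_weight [LHS]big_ord_recl. Qed.

Lemma path_weight_le1 s y : `|path_weight s y| <= 1.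
Proof.
by rewrite /path_weight normr_prod prodr_ile1// => i _; rewrite normr_ge0 W1.
Qed.

Lemma measurable_path_weight d (T : measurableType d) n (t : T -> n.-tuple RR) (y : T -> R) :
  measurable_fun setT t -> measurable_fun setT (y : T -> RR) ->
  measurable_fun setT (fun z => path_weight (t z) (y z)).
Proof.
move=> mt my.
have nthm (a : T -> RR) i : measurable_fun setT a -> measurable_fun setT (fun z => nth (a z) (t z) i : RR).
  move=> ma; have [ni|ni] := ltnP i n; last first.
    apply: eq_measurable_fun ma => z _; by rewrite nth_default// size_tuple.
  have := measurableT_comp (measurable_tnth (Ordinal ni)) mt.
  by apply: eq_measurable_fun => z _ /=; rewrite (tnth_nth (a z)).
rewrite (_ : (fun z => _) = fun z => \prod_(i < n) W (nth 0 (t z) i, nth (y z) (t z) i.+1)); last first.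
  by apply/funext => z; rewrite /path_weight size_tuple.
apply: measurable_prod => i _.
apply: (measurableT_comp mW); apply: measurable_fun_pair; last exact: nthm.
by apply: (nthm (fun=> 0)); exact: measurable_cst.
Qed.

Lemma Rintegral_cube_measureS n (f : n.+1.-tuple RR -> R) M :
  measurable_fun setT f -> (forall t, `|f t| <= M) ->
  \int[cube_measure R n.+1]_t f t =
  \int[P]_x (\int[cube_measure R n]_t f (tuple_cons (x, t))).
Proof.
move=> mf fM.
have mf' : measurable_fun setT (f \o @tuple_cons R n).
  by apply: measurableT_comp => //; exact: measurable_tuple_cons.
have fi' : intg (P \x cube_measure R n)%E (f \o @tuple_cons R n).
  by apply: (intg_prod_bounded P (cube_measure R n) (M := M)) => // z; exact: fM.
rewrite -[RHS]/(\int[P]_x (\int[cube_measure R n]_t (f \o @tuple_cons R n) (x, t))).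
rewrite (E_iterated fi') => [|x]; last first.
  apply: (intg_bounded (cube_measure R n) (M := M)) => [|t]; last exact: fM.
  exact: (measurable_sect1 x mf').
congr fine.
have h := @integral_pushforward _ _ _ _ R (@tuple_cons R n) (@measurable_tuple_cons R n)
  (P \x cube_measure R n)%E setT (EFin \o f).
by apply: h => //; exact/measurable_EFinP.
Qed.

Lemma path_weight_kpow n x y :
  \int[cube_measure R n]_t path_weight (x :: t) y = kpow P W n (x, y).
Proof.
have mp m (z : R) : measurable_fun setT (fun t : m.-tuple RR => path_weight (z :: t) y).
  have h := @measurable_path_weight _ (m.-tuple RR) m.+1
    (fun t => [the m.+1.-tuple RR of z :: t]) (fun=> y).
  by apply: h => //; exact: measurable_cons.
elim: n x => [|n ih] x.
  rewrite /Rintegral /= integral_dirac//; last by apply/measurable_EFinP; exact: (mp 0%N x).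
  by rewrite diracT mul1e path_weight1.
rewrite (Rintegral_cube_measureS (mp _ _) (fun t => path_weight_le1 _ _)).
apply: eq_E => u.
transitivity (W (x, u) * \int[cube_measure R n]_t path_weight (u :: t) y); last by rewrite ih.
rewrite -EZ.
  by apply: eq_E => t; rewrite path_weight_cons.
by apply: (intg_bounded (cube_measure R n) (M := 1)) => [|t]; [exact: mp|exact: path_weight_le1].
Qed.

Lemma trace_kpow_path_weight n :
  \int[cube_measure R n.+1]_t path_weight t (nth 0 t 0) = trace_kpow P W n.
Proof.
rewrite (@Rintegral_cube_measureS _ (fun t => path_weight t (nth 0 t 0)) 1).
- by apply: eq_E => x /=; exact: path_weight_kpow.
- apply: (@measurable_path_weight _ _ n.+1 id (fun t => nth 0 t 0)) => //.
  rewrite (_ : (fun t => _) = (fun t : n.+1.-tuple RR => tnth t ord0)).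
    exact: measurable_tnth.
  by apply/funext => t; rewrite (tnth_nth 0).
- by move=> t; exact: path_weight_le1.
Qed.

End cycle_density.

Section hom_density_cycle.
Variable R : realType.
Local Notation RR := (measurableTypeR R).
Local Notation P := (@lebesgue01 R).
Variable W : R * R -> R.
Hypothesis W_kernel : measurable_fun (I01 `*` I01) (W : RR * RR -> R).

(** Extension by 0 makes the kernel measurable and bounded everywhere, so that all integrals can be
    taken over the whole space with respect to [lebesgue01]. *)
Definition patch2 : R * R -> R := W \_ (I01 `*` I01).

Lemma measurable_patch2 : measurable_fun setT (patch2 : RR * RR -> R).
Proof.
apply/(measurable_restrictT (W : RR * RR -> R)) => //.
by apply: measurableX; exact: measurable_I01.
Qed.

Lemma patch2E x y : I01 x -> I01 y -> patch2 (x, y) = W (x, y).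
Proof. by move=> Ix Iy; rewrite /patch2 patchE mem_set. Qed.

Lemma patch2_out x y : ~ I01 x -> patch2 (x, y) = 0.
Proof. by move=> Ix; rewrite /patch2 patchE memNset// => -[]. Qed.

Hypothesis W1 : forall z, (I01 `*` I01) z -> `|W z| <= 1.

Lemma patch2_le1 z : `|patch2 z| <= 1.
Proof.
by rewrite /patch2 patchE; case: ifPn => [/set_mem/W1//|_]; rewrite normr0.
Qed.

Lemma hom_density_dicycle n :
  hom_density (@dicycle n.+1) W = trace_kpow P patch2 n.
Proof.
rewrite -trace_kpow_path_weight; [|exact: measurable_patch2|exact: patch2_le1].
rewrite /hom_density Rintegral_mkcond; apply: eq_E => t.
rewrite patchE /path_weight size_tuple.
have -> : \prod_(e : 'I_n.+1 * 'I_n.+1 | dicycle e.1 e.2) W (tnth t e.1, tnth t e.2) =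
    \prod_(i < n.+1) W (tnth t i, tnth t (ordS i)).
  rewrite -(pair_big_dep xpredT (fun i j => @dicycle n.+1 i j)
    (fun i j => W (tnth t i, tnth t j))) /=.
  by apply: eq_bigr => i _; rewrite big_pred1_eq.
(* For the last i the index is out of range: [nth] returns its default, the first vertex, which is
   also where [ordS] wraps around. *)
have sE (i : 'I_n.+1) : nth (nth 0 t 0) t i.+1 = tnth t (ordS i).
  rewrite (tnth_nth (nth 0 t 0)) /=.
  have := ltn_ord i; rewrite leq_eqVlt => /orP[/eqP in1|in1].
    rewrite in1 modnn nth_default ?size_tuple//.
    by apply: set_nth_default; rewrite size_tuple.
  by rewrite modn_small.
case: ifPn => [/set_mem ct|/negP nct].
  apply: eq_bigr => i _; rewrite sE -(tnth_nth 0) patch2E//; exact: ct.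
have [i ni] : exists i, ~ I01 (tnth t i).
  apply: contrapT => h; apply: nct; apply/mem_set => i; apply: contrapT => ni.
  by apply: h; exists i.
(* A vertex outside [0,1] is the tail of one edge of the cycle, whose factor vanishes. *)
by rewrite (bigD1 i)//= -(tnth_nth 0) patch2_out ?mul0r.
Qed.

End hom_density_cycle.

(** * From L2 to sequences of vectors *)

Section complex_bridge.
Variable R : realType.
Local Notation RR := (measurableTypeR R).
Local Notation P := (@lebesgue01 R).
Local Notation mu := (@lebesgue_measure R).
Local Notation C := R[i].
Local Notation normc := Normc.normc.
Local Notation Re := complex.Re.
Local Notation Im := complex.Im.
Local Notation kap := (@kap R).
Implicit Types (f g : R -> C) (z : C).

Definition re_part f : R -> R := (fun x => Re (f x)) \_ (I01 : set RR).
Definition im_part f : R -> R := (fun x => Im (f x)) \_ (I01 : set RR).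

Lemma cReD (x y : C) : Re (x + y) = Re x + Re y. Proof. by case: x y => ? ? []. Qed.
Lemma cImD (x y : C) : Im (x + y) = Im x + Im y. Proof. by case: x y => ? ? []. Qed.
Lemma cReM (x y : C) : Re (x * y) = Re x * Re y - Im x * Im y.
Proof. by case: x y => ? ? []. Qed.
Lemma cImM (x y : C) : Im (x * y) = Re x * Im y + Im x * Re y.
Proof. by case: x y => ? ? []. Qed.

Lemma L2P f : L2 f <-> sqintg P (re_part f) /\ sqintg P (im_part f).
Proof.
have normE : (\int[mu]_(x in I01) (normc (f x) ^+ 2)%:E =
    \int[P]_x (re_part f x ^+ 2 + im_part f x ^+ 2)%:E)%E.
  rewrite integral01; apply: eq_integral => x _; rewrite /re_part /im_part !patchE.
  by case: ifP => _; rewrite ?sqr_normcE// expr0n addr0.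
split=> [[mr mi fi]|[[mr ir] [mi ii]]].
  have mr' := measurable_patch01 mr; have mi' := measurable_patch01 mi.
  have h : intg P (fun x => re_part f x ^+ 2 + im_part f x ^+ 2).
    apply/integrableP; split.
      by apply/measurable_EFinP; apply: measurable_funD; exact: measurable_funX.
    move: fi; rewrite normE; apply: le_lt_trans; rewrite le_eqVlt; apply/orP; left.
    by apply/eqP/eq_integral => x _; rewrite /= ger0_norm// addr_ge0 ?sqr_ge0.
  split; split => //; apply: (@intg_le _ RR _ P _ (fun x => re_part f x ^+ 2 + im_part f x ^+ 2)) => //.
  - exact: measurable_funX.
  - by move=> x; rewrite ger0_norm ?sqr_ge0// lerDl sqr_ge0.
  - exact: measurable_funX.
  - by move=> x; rewrite ger0_norm ?sqr_ge0// lerDr sqr_ge0.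
split.
- by apply/(measurable_restrictT _ (@measurable_I01 R)).
- by apply/(measurable_restrictT _ (@measurable_I01 R)).
rewrite normE; have /integrableP[_] := intgD ir ii.
apply: le_lt_trans; rewrite le_eqVlt; apply/orP; left.
by apply/eqP/eq_integral => x _; rewrite /= ger0_norm// addr_ge0 ?sqr_ge0.
Qed.

Lemma L2_affine (a : C) f g : L2 f -> L2 g -> L2 (fun x => a * f x + g x).
Proof.
move=> /L2P[fr fi] /L2P[gr gi]; apply/L2P; split.
  have -> : re_part (fun x => a * f x + g x) = fun x =>
      (Re a * re_part f x - Im a * im_part f x) + re_part g x.
    apply/funext => x; rewrite /re_part /im_part !patchE; case: ifP => _; last by rewrite !mulr0 ?subr0 !addr0.
    by rewrite cReD cReM.
  by apply: sqintgD => //; apply: sqintgB; exact: sqintgZ.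
have -> : im_part (fun x => a * f x + g x) = fun x =>
    (Re a * im_part f x + Im a * re_part f x) + im_part g x.
  apply/funext => x; rewrite /re_part /im_part !patchE; case: ifP => _; last by rewrite !mulr0 ?subr0 !addr0.
  by rewrite cImD cImM.
by apply: sqintgD => //; apply: sqintgD; exact: sqintgZ.
Qed.

Lemma L2_0 : L2 (fun=> 0 : C).
Proof.
apply/L2P; rewrite /re_part /im_part /=.
have -> : (fun=> 0) \_ (I01 : set RR) = fun=> 0 :> R.
  by apply/funext => x; rewrite patchE; case: ifP.
by split; apply: (sqintg_bounded P (M := 0)) => // x; rewrite normr0.
Qed.

Lemma L2_real (g h : R -> R) : sqintg P g -> sqintg P h -> L2 (fun x => g x +i* h x).
Proof.
have sq (k : R -> R) : sqintg P k -> sqintg P (k \_ (I01 : set RR)).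
  move=> [mk ik]; split; first by apply: measurable_patch01; exact: measurable_funTS.
  have := intg_patch01 ik; congr integrable; apply/funext => x /=.
  by rewrite !patchE; case: ifP => // _; rewrite expr0n.
by move=> sg sh; apply/L2P; split; exact: sq.
Qed.

Lemma L2_ext f g : (forall x, I01 x -> f x = g x) -> L2 f -> L2 g.
Proof.
move=> fg; have -> // : L2 f = L2 g; apply/propext; rewrite !L2P.
have -> : re_part f = re_part g.
  by apply/funext => x; rewrite /re_part !patchE; case: ifPn => // /set_mem /fg ->.
have -> // : im_part f = im_part g.
by apply/funext => x; rewrite /im_part !patchE; case: ifPn => // /set_mem /fg ->.
Qed.

(** The vector of the ultraproduct that represents f: its orthonormal coordinates at all levels.
    [ae01_embed] and [embed_tiny] make this well defined and injective on classes. *)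
Definition embed f : forall n, 'cV[C]_n.+1 :=
  fun n => \col_k (cell_coord P kap (re_part f) k +i* cell_coord P kap (im_part f) k).

Lemma embed_affine (a : C) f g n : L2 f -> L2 g ->
  embed (fun x => a * f x + g x) n = a *: embed f n + embed g n.
Proof.
move=> /L2P[/sqintg_intg fr /sqintg_intg fi] /L2P[/sqintg_intg gr /sqintg_intg gi].
apply/matrixP => k j; rewrite !mxE.
have -> : re_part (fun x => a * f x + g x) = fun x =>
    (Re a * re_part f x - Im a * im_part f x) + re_part g x.
  apply/funext => x; rewrite /re_part /im_part !patchE; case: ifP => _; last by rewrite !mulr0 ?subr0 !addr0.
  by rewrite cReD cReM.
have -> : im_part (fun x => a * f x + g x) = fun x =>
    (Re a * im_part f x + Im a * re_part f x) + im_part g x.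
  apply/funext => x; rewrite /re_part /im_part !patchE; case: ifP => _; last by rewrite !mulr0 ?subr0 !addr0.
  by rewrite cImD cImM.
have km := @kap_measurable R.
rewrite cell_coordD ?cell_coordB ?cell_coordD ?cell_coordD ?cell_coordZ//; try exact: intgZ; try (by apply: intgB; exact: intgZ).
  by case: a => ar ai; apply/eqP; rewrite eq_complex /=; apply/andP; split; apply/eqP; ring.
by apply: intgD; exact: intgZ.
Qed.

Lemma fnorm2_embed f n :
  fnorm (embed f n) ^+ 2 = \sum_k cell_coord P kap (n := n) (re_part f) k ^+ 2 +
    \sum_k cell_coord P kap (n := n) (im_part f) k ^+ 2.
Proof.
rewrite fnorm2_sum -big_split /=; apply: eq_bigr => k _.
by rewrite big_ord1 mxE sqr_normcE.
Qed.

Lemma embed_bnd f : L2 f -> bnd (embed f).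
Proof.
move=> /L2P[fr fi].
exists (\int[P]_x (re_part f x ^+ 2) + \int[P]_x (im_part f x ^+ 2) + 1) => n.
have km := @kap_measurable R; have kP := @kap_measure R.
have := cell_coord_sqr_le km kP n fr; have := cell_coord_sqr_le km kP n fi.
have := fnorm2_embed f n; have := fnorm_ge0 (embed f n).
have := sqr_ge0 (fnorm (embed f n) - 1); nra.
Qed.

Lemma ae01P f : ae01 f (fun=> 0) <-> {ae P, forall x, re_part f x = 0 /\ im_part f x = 0}.
Proof.
split=> -[N [mN N0 sN]].
  exists N; split => //.
    apply/eqP; rewrite eq_le measure_ge0 andbT; apply: (@le_trans _ _ (mu N)).
      rewrite /= /lebesgue01 /mrestr le_measure//; apply: mem_set => //.
      by apply: measurableI => //; exact: measurable_I01.
    by rewrite N0.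
  move=> x /= h; apply: sN => /= fx; apply: h; rewrite /re_part /im_part !patchE.
  by case: ifPn => // /set_mem /fx ->.
exists (N `&` I01); split.
- by apply: measurableI => //; exact: measurable_I01.
- exact: N0.
move=> x /= /not_implyP[Ix fx]; split => //; apply: sN => /= -[].
rewrite /re_part /im_part !patchE mem_set// => h1 h2; apply: fx.
by apply/eqP; rewrite eq_complex h1 h2 !eqxx.
Qed.

Lemma ae01_embed f n : L2 f -> ae01 f (fun=> 0) -> embed f n = 0.
Proof.
move=> /L2P[fr fi] /ae01P h; apply/matrixP => k j; rewrite !mxE.
have c0 (g : R -> R) : intg P g -> {ae P, forall x, g x = 0} -> cell_coord P kap g k = 0.
  move=> ig [N [mN N0 sN]]; rewrite /cell_coord.
  have -> : \int[P]_x (chi R kap k x * g x) = \int[P]_x (0 : R).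
    congr fine; apply: ae_eq_integral => //.
      by apply/measurable_EFinP; exact: intg_measurable (intg_chiM (@kap_measurable R) k ig).
    exists N; split => // x /= h'; apply: sN => /= gx; apply: h' => _.
    by rewrite gx mulr0.
  by rewrite E0 mulr0.
have [N [mN N0 sN]] := h.
rewrite !c0//; try exact: sqintg_intg; exists N; split => // x /= h'; apply: sN => /= -[a b];
  exact: h'.
Qed.

Section limits.
Variable G : set_system nat.
Hypothesis GU : UltraFilter G.
Hypothesis Goo : \oo `<=` G.

Lemma embed_tiny f : L2 f -> tiny G (embed f) -> ae01 f (fun=> 0).
Proof.
move=> /L2P[fr fi] f0; have f2 := small_sqr GU f0.
have km := @kap_measurable R; have kP := @kap_measure R.
have E0' (g : R -> R) : sqintg P g ->
    small G (fun n => \sum_(k < n.+1) cell_coord P kap g k ^+ 2) -> {ae P, forall x, g x = 0}.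
  move=> sg g0; have ig := sqintg_intg sg.
  have := cell_coord_small_eq0 km kP (@average_cvg R) GU Goo ig g0.
  rewrite /Rintegral => h.
  have /ae_eq_integral_abs : (\int[P]_x `|(EFin \o g) x| = 0)%E.
    have fn : (\int[P]_x (`|g x|)%:E)%E \is a fin_num.
      exact: integrable_fin_num (intg_norm ig).
    by rewrite -(fineK fn) h.
  move=> /(_ measurableT) []; first by apply/measurable_EFinP; exact: sg.1.
  move=> N [mN N0 sN]; exists N; split => // x /= h'; apply: sN => /= h2; apply: h'.
  by have [] := h2 I.
apply/ae01P.
have s0 (u : nat -> R) : (forall n, 0 <= u n <= fnorm (embed f n) ^+ 2) -> small G u.
  by move=> uu; apply: (small_leT GU) f2 => n; have /andP[a b] := uu n; rewrite ger0_norm.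
have h1 := E0' _ fr; have h2 := E0' _ fi.
have n1 : P.-negligible (~` [set x | re_part f x = 0]).
  apply: h1; apply: s0 => n.
  by rewrite fnorm2_embed lerDl !sumr_ge0// => k _; exact: sqr_ge0.
have n2 : P.-negligible (~` [set x | im_part f x = 0]).
  apply: h2; apply: s0 => n.
  by rewrite fnorm2_embed lerDr !sumr_ge0// => k _; exact: sqr_ge0.
apply: negligibleS (negligibleU n1 n2) => x /= h; apply: contrapT => /not_orP[m1 m2].
by apply: h; split; apply: contrapT.
Qed.

End limits.
End complex_bridge.

Section operator_bridge.
Variable R : realType.
Local Notation RR := (measurableTypeR R).
Local Notation P := (@lebesgue01 R).
Local Notation mu := (@lebesgue_measure R).
Local Notation C := R[i].
Local Notation normc := Normc.normc.
Local Notation Re := complex.Re.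
Local Notation Im := complex.Im.
Local Notation kap := (@kap R).
Implicit Types (f g : R -> C) (z : C).

Lemma embed_ext f g n : (forall x, I01 x -> f x = g x) -> embed f n = embed g n.
Proof.
move=> fg; rewrite /embed; have -> : re_part f = re_part g.
  by apply/funext => x; rewrite /re_part !patchE; case: ifPn => // /set_mem /fg ->.
have -> // : im_part f = im_part g.
by apply/funext => x; rewrite /im_part !patchE; case: ifPn => // /set_mem /fg ->.
Qed.

Lemma embed_real (g h : R -> R) n : sqintg P g -> sqintg P h ->
  embed (fun x => g x +i* h x) n =
  \col_k (cell_coord P kap g k +i* cell_coord P kap h k).
Proof.
have pc (u : R -> R) (k : 'I_n.+1) : sqintg P u ->
    cell_coord P kap (u \_ (I01 : set RR)) k = cell_coord P kap u k.
  move=> [mu' _]; congr (_ * _); have mp := measurable_patch01 (measurable_funTS mu').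
  have mc := @measurable_chi _ RR R kap (@kap_measurable R) n k.
  apply: eq_E01; [exact: measurable_funM|exact: measurable_funM|].
  by move=> x Ix; rewrite patch01E.
by move=> sg sh; apply/matrixP => k j; rewrite !mxE -(pc g)// -(pc h).
Qed.

Variable W : R * R -> R.
Hypothesis W_measurable : measurable_fun (I01 `*` I01) (W : RR * RR -> R).
Hypothesis W_le1 : forall p, (I01 `*` I01) p -> `|W p| <= 1.
Local Notation V := (patch2 W).
Let mV := measurable_patch2 W_measurable.
Let V1 := patch2_le1 W_le1.

Definition matrix_approx n : 'M[C]_n.+1 := map_mx (real_complex R) (gram_mx P kap V n).
Local Notation A := matrix_approx.

Lemma integral_operatorE f x : I01 x ->
  integral_operator W f x = op P V (re_part f) x +i* op P V (im_part f) x.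
Proof.
move=> Ix; rewrite /integral_operator /Cintegral !Rintegral01.
congr (_ +i* _); apply: eq_E => y; rewrite /re_part /im_part !patchE;
  case: ifPn => [/set_mem Iy|_]; rewrite ?mulr0// patch2E//.
  by rewrite cReM /= mul0r subr0.
by rewrite cImM /= mul0r addr0.
Qed.

Lemma sqintg_op_part f : L2 f ->
  sqintg P (op P V (re_part f)) /\ sqintg P (op P V (im_part f)).
Proof. by move=> /L2P[/sqintg_intg fr /sqintg_intg fi]; split; exact: sqintg_op. Qed.

Lemma L2_integral_operator f : L2 f -> L2 (integral_operator W f).
Proof.
move=> /sqintg_op_part[sr si]; apply: L2_ext (L2_real sr si) => x Ix.
by rewrite integral_operatorE.
Qed.

Lemma L2_shifted z f : L2 f -> L2 (shifted_operator W z f).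
Proof.
move=> Lf; apply: L2_ext (L2_affine (- z) Lf (L2_integral_operator Lf)) => x Ix.
by rewrite /shifted_operator mulNr addrC.
Qed.

Lemma L2_iter_shifted z k f : L2 f -> L2 (iter k (shifted_operator W z) f).
Proof. by move=> Lf; elim: k => //= k; exact: L2_shifted. Qed.

Lemma embed_shifted z f n : L2 f ->
  embed (shifted_operator W z f) n = embed (integral_operator W f) n - z *: embed f n.
Proof.
move=> Lf; rewrite addrC -scaleNr -(embed_affine (- z) n Lf (L2_integral_operator Lf)).
by apply: embed_ext => x Ix; rewrite /shifted_operator mulNr addrC.
Qed.

Lemma embed_integral_operator f n : L2 f -> embed (integral_operator W f) n =
  \col_k (cell_coord P kap (op P V (re_part f)) k +i* cell_coord P kap (op P V (im_part f)) k).
Proof.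
move=> /sqintg_op_part[sr si]; rewrite -(embed_real n sr si).
by apply: embed_ext => x Ix; rewrite integral_operatorE.
Qed.

Lemma matrix_approxM n (u v : 'I_n.+1 -> R) :
  A n *m \col_k (u k +i* v k) =
  \col_k ((\sum_l gram P kap V k l * u l) +i* (\sum_l gram P kap V k l * v l)).
Proof.
apply/matrixP => k j; rewrite !mxE.
have sumC (s : seq 'I_n.+1) (a b : 'I_n.+1 -> R) :
    \sum_(l <- s) (a l +i* b l) = (\sum_(l <- s) a l) +i* (\sum_(l <- s) b l) :> C.
  elim: s => [|l s ih]; first by rewrite !big_nil.
  by rewrite !big_cons ih.
rewrite -sumC; apply: eq_bigr => l _; rewrite !mxE.
by apply/eqP; rewrite eq_complex /= !mul0r subr0 addr0 !eqxx.
Qed.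

Lemma fnorm2_col n (u v : 'I_n.+1 -> R) :
  fnorm (\col_k (u k +i* v k) : 'cV[C]_n.+1) ^+ 2 = \sum_k u k ^+ 2 + \sum_k v k ^+ 2.
Proof.
rewrite fnorm2_sum -big_split /=; apply: eq_bigr => k _.
by rewrite big_ord1 mxE sqr_normcE.
Qed.

Lemma colB n (u v u' v' : 'I_n.+1 -> R) :
  \col_k (u k +i* v k) - \col_k (u' k +i* v' k) =
  \col_k ((u k - u' k) +i* (v k - v' k)) :> 'cV[C]_n.+1.
Proof. by apply/matrixP => k j; rewrite !mxE. Qed.

(** There are (n+1)^2 entries of modulus at most 1/(n+1). This 1 becomes the bound on the sum of
    m(z) |z|^2. *)
Lemma fnorm2_matrix_approx_le1 n : fnorm (A n) ^+ 2 <= 1.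
Proof.
rewrite fnorm2_sum.
apply: (@le_trans _ _ (\sum_(i < n.+1) \sum_(j < n.+1) (n.+1%:R^-1 : R) ^+ 2)).
  apply: ler_sum => i _; apply: ler_sum => j _; rewrite mxE normc_real lerXn2r ?nnegrE//.
  by rewrite mxE; apply: gram_le => //; [exact: kap_measurable|exact: kap_measure].
rewrite !sumr_const card_ord -mulrnA -[_ *+ _]mulr_natr natrM.
by rewrite -expr2 -exprMn mulVf ?expr1n// pnatr_eq0.
Qed.

Lemma bnd_matrix_approx : bnd A.
Proof.
by exists 1 => n; rewrite -(@ler_pXn2r _ 2) ?nnegrE// expr1n fnorm2_matrix_approx_le1.
Qed.

Lemma trace_matrix_approx_cvg l : (2 <= l)%N ->
  normc (\tr (A n ^+ l) - (hom_density (@dicycle l) W)%:C) @[n --> \oo] --> 0.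
Proof.
case: l => [|[|l]]// _; rewrite hom_density_dicycle//.
have := trace_gram_cvg (@kap_measurable R) (@kap_measure R) (@average_cvg R) mV V1 l.
move=> /cvgr0Pnorm_lt h; apply/cvgr0Pnorm_lt => e /h; apply: filterS => n hn.
rewrite ger0_norm//.
have -> : A n ^+ l.+2 = map_mx (real_complex R) (gram_mx P kap V n ^+ l.+2).
  by rewrite /matrix_approx rmorphXn.
by rewrite trace_map_mx -rmorphB normc_real.
Qed.

Section along_ultrafilter.
Variable G : set_system nat.
Hypothesis GU : UltraFilter G.
Hypothesis Goo : \oo `<=` G.

Lemma tiny_integral_operator f : L2 f ->
  tiny G (fun n => A n *m embed f n - embed (integral_operator W f) n).
Proof.
move=> Lf; have [sr si] := (L2P f).1 Lf.
apply: (small_sqrt GU).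
pose K := \int[P]_x (re_part f x ^+ 2) + \int[P]_x (im_part f x ^+ 2).
have dc := small_cvg Goo (E_defect_cvg (@kap_measurable R) (@kap_measure R) (@average_cvg R) mV V1).
apply: (small_leT GU) (smallM GU K dc) => n.
rewrite ger0_norm ?sqr_ge0// embed_integral_operator// matrix_approxM colB fnorm2_col.
rewrite /K mulrC mulrDr.
have km := @kap_measurable R; have kP := @kap_measure R.
by apply: lerD; exact: gram_cell_coord_le.
Qed.

(** On the ultraproduct, A takes all its values in the image of [embed]; this is the form in which
    compactness of W is used. Real and imaginary parts are treated separately since W is real. *)
Lemma tiny_compact (v : forall n, 'cV[C]_n.+1) : bnd v ->
  exists2 g, L2 g & tiny G (fun n => A n *m v n - embed g n).
Proof.
move=> [M vM].
pose vr n (k : 'I_n.+1) := Re (v n k 0); pose vi n (k : 'I_n.+1) := Im (v n k 0).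
have vE n : v n = \col_k (vr n k +i* vi n k).
  by apply/matrixP => k j; rewrite !mxE ord1 /vr /vi; case: (v n k 0).
have vM2 n : fnorm (v n) ^+ 2 <= M ^+ 2.
  by rewrite ler_pXn2r ?nnegrE// (le_trans _ (vM n)).
have [gr sgr hr] : exists2 g, sqintg P g &
    small G (fun n => \sum_(k < n.+1) (\sum_l gram P kap V k l * vr n l - cell_coord P kap g k) ^+ 2).
  apply: (gram_compact (@kap_measurable R) (@kap_measure R) (@average_cvg R) GU mV V1 (M := M ^+ 2)) => n.
  apply: le_trans (vM2 n); rewrite [in leRHS]vE fnorm2_col lerDl.
  by apply: sumr_ge0 => k _; exact: sqr_ge0.
have [gi sgi hi] : exists2 g, sqintg P g &
    small G (fun n => \sum_(k < n.+1) (\sum_l gram P kap V k l * vi n l - cell_coord P kap g k) ^+ 2).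
  apply: (gram_compact (@kap_measurable R) (@kap_measure R) (@average_cvg R) GU mV V1 (M := M ^+ 2)) => n.
  apply: le_trans (vM2 n); rewrite [in leRHS]vE fnorm2_col lerDr.
  by apply: sumr_ge0 => k _; exact: sqr_ge0.
exists (fun x => gr x +i* gi x); first exact: L2_real.
apply: (small_sqrt GU); apply: small_ext (smallD GU hr hi) => n.
by rewrite embed_real// vE matrix_approxM colB fnorm2_col.
Qed.

End along_ultrafilter.
End operator_bridge.

(** * The spectral expansion *)

Section L2_norm.
Variable R : realType.
Local Notation RR := (measurableTypeR R).
Local Notation P := (@lebesgue01 R).
Local Notation C := R[i].
Local Notation normc := Normc.normc.
Implicit Types (f g : R -> C) (z : C).

Lemma L2norm_eq0 f : L2 f -> L2norm f = 0 <-> ae01 f (fun=> 0).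
Proof.
move=> /L2P[[mr ir] [mi ii]].
pose h x := re_part f x ^+ 2 + im_part f x ^+ 2.
have h0 x : 0 <= h x by rewrite addr_ge0 ?sqr_ge0.
have ih : intg P h by exact: intgD.
have -> : L2norm f = Num.sqrt (\int[P]_x h x).
  rewrite /L2norm Rintegral01; congr Num.sqrt; apply: eq_E => x.
  rewrite /h /re_part /im_part !patchE.
  by case: ifP => _; rewrite ?sqr_normcE// expr0n addr0.
have hE x : h x = 0 <-> re_part f x = 0 /\ im_part f x = 0.
  split=> [/eqP|[h1 h2]]; last by rewrite /h h1 h2 expr0n addr0.
  by rewrite paddr_eq0 ?sqr_ge0// !sqrf_eq0 => /andP[/eqP -> /eqP ->].
have mh : measurable_fun setT (EFin \o h) by apply/measurable_EFinP; exact: intg_measurable ih.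
have := ae_eq_integral_abs P measurableT mh => -[h1 h2].
split=> [/eqP|f0].
  rewrite sqrtr_eq0 => hle; apply/ae01P.
  have /h1[N [mN N0 sN]] : (\int[P]_x `|(EFin \o h) x| = 0)%E.
    under eq_integral do rewrite /= ger0_norm//.
    have fn : (\int[P]_x (h x)%:E)%E \is a fin_num by exact: integrable_fin_num ih.
    by rewrite -(fineK fn); congr EFin; apply/le_anti; rewrite -[fine _]/(\int[P]_x h x) hle Ege0.
  exists N; split => // x /= h'; apply: sN => /= hx; apply: h'; apply/hE.
  by have [] := hx I.
have [N [mN N0 sN]] := (ae01P f).1 f0.
rewrite /Rintegral.
have e0 : (\int[P]_x `|(EFin \o h) x| = 0)%E.
  apply: h2; exists N; split => // x /= h'; apply: sN => /= /hE hx; apply: h' => _.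
  by rewrite hx.
have -> : (\int[P]_x (h x)%:E = 0)%E.
  by rewrite -e0; apply: eq_integral => x _; rewrite /= ger0_norm.
by rewrite sqrtr0.
Qed.

End L2_norm.

(** * Multiplicities of W and of the matrices along G *)

Section multiplicities.
Variable R : realType.
Local Notation RR := (measurableTypeR R).
Local Notation P := (@lebesgue01 R).
Local Notation C := R[i].
Local Notation normc := Normc.normc.
Implicit Types (f g : R -> C) (z : C).
Variable W : R * R -> R.
Hypothesis W_measurable : measurable_fun (I01 `*` I01) (W : RR * RR -> R).
Hypothesis W_le1 : forall p, (I01 `*` I01) p -> `|W p| <= 1.
Variable G : set_system nat.
Hypothesis GU : UltraFilter G.
Hypothesis Goo : \oo `<=` G.
Local Notation A := (matrix_approx W).
Let bA : bnd A := bnd_matrix_approx W_measurable W_le1.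

Lemma tiny_iter_shifted z k f : L2 f ->
  tiny G (fun n => iter k (shift_op A z) (embed f) n - embed (iter k (shifted_operator W z) f) n).
Proof.
move=> Lf; elim: k => [|k ih] /=.
  by apply: (tiny_ext GU) (tiny0 GU _ _) => n; rewrite subrr.
have Lh := L2_iter_shifted W_measurable W_le1 z k Lf.
have h1 := iter_shift_sub GU z 1 bA ih.
have h2 := tiny_integral_operator W_measurable W_le1 GU Goo Lh.
apply: (tiny_ext GU) (tinyD GU h1 h2) => n /=.
rewrite (embed_shifted W_measurable W_le1 z n Lh) [in X in _ - X + _]/shift_op.
by rewrite !opprB -addrA; congr (_ + _); rewrite addrA subrK.
Qed.

Lemma ker_power_embed z k f : L2 f ->
  ker_power W z k f <-> approx_ker G A z k (embed f).
Proof.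
move=> Lf; have Lh := L2_iter_shifted W_measurable W_le1 z k Lf.
have h := tiny_iter_shifted z k Lf; split=> [[_ f0]|[_ f0]].
  split; first exact: embed_bnd.
  by apply: (tiny_ext GU) h => n; rewrite (ae01_embed n Lh f0) subr0.
split => //; apply: (embed_tiny GU Goo Lh).
by apply: (tiny_sub GU) (tiny_subC GU h) f0.
Qed.

(* Since v = z^-1 (A v - (A - z) v), induction on k reduces this to the
   compactness of A. *)
Lemma approx_ker_embed z k (v : forall n, 'cV[C]_n.+1) : z != 0 -> approx_ker G A z k v ->
  exists2 g, L2 g & tiny G (fun n => v n - embed g n).
Proof.
move=> z0 [bv]; elim: k v bv => [|k ih] v bv kv.
  exists (fun=> 0); first exact: L2_0.
  apply: (tiny_ext GU) kv => n; rewrite (ae01_embed n (@L2_0 R)) ?subr0//.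
  by apply: aeW => x _.
have bs : bnd (shift_op A z v) by exact: (iter_shift_bnd z 1 bA bv).
have [|g Lg hg] := ih (shift_op A z v) bs; first by rewrite -iterSr.
have [g' Lg' hg'] := tiny_compact W_measurable W_le1 GU bv.
have L1 := L2_affine (- 1) Lg Lg'.
have L2' := L2_affine z^-1 L1 (@L2_0 R).
exists (fun x => z^-1 * (- 1 * g x + g' x) + 0); first exact: L2'.
apply: (tiny_ext GU) (tinyZ GU z^-1 (tinyB GU hg' hg)) => n.
rewrite (embed_affine z^-1 n L1 (@L2_0 R)) (embed_affine (- 1) n Lg Lg').
rewrite (ae01_embed n (@L2_0 R)); last by apply: aeW => x _.
rewrite addr0 scaleN1r /shift_op; apply: (scalerI z0).
rewrite scalerA mulfV// scale1r [RHS]scalerBr scalerA mulfV// scale1r !opprD !opprK.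
by rewrite addrA addrACA subrr add0r [- _ + _]addrC addrAC -addrA.
Qed.

Lemma L2_sum (I : Type) (s : seq I) (a : I -> C) (f : I -> R -> C) :
  (forall i, L2 (f i)) -> L2 (fun x => \sum_(i <- s) a i * f i x).
Proof.
move=> Lf; elim: s => [|i s ih].
  by apply: L2_ext (@L2_0 R) => x _; rewrite big_nil.
by apply: L2_ext (L2_affine (a i) (Lf i) ih) => x _; rewrite big_cons.
Qed.

Lemma embed_sum (I : Type) (s : seq I) (a : I -> C) (f : I -> R -> C) n :
  (forall i, L2 (f i)) ->
  embed (fun x => \sum_(i <- s) a i * f i x) n = \sum_(i <- s) a i *: embed (f i) n.
Proof.
move=> Lf; elim: s => [|i s ih].
  rewrite big_nil -(ae01_embed n (@L2_0 R)); last by apply: aeW => x _.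
  by apply: embed_ext => x _; rewrite big_nil.
rewrite big_cons -ih -(embed_affine (a i) n (Lf i) (L2_sum s a Lf)).
by apply: embed_ext => x _; rewrite big_cons.
Qed.

Lemma linearly_independent_embed m (f : 'I_m -> R -> C) : (forall i, L2 (f i)) ->
  linearly_independent f <-> indep G (fun i => embed (f i)).
Proof.
move=> Lf; split=> h a.
  move=> fa; apply: h; apply: (embed_tiny GU Goo (L2_sum _ a Lf)).
  by apply: (tiny_ext GU) fa => n; rewrite embed_sum.
move=> fa; apply: h; apply: (tiny_ext GU) (tiny0 GU _ _) => n.
by rewrite -embed_sum// (ae01_embed n (L2_sum _ a Lf) fa).
Qed.

Lemma indep_ker_iff z k m : z != 0 ->
  (exists f : 'I_m -> R -> C, (forall i, ker_power W z k (f i)) /\ linearly_independent f) <->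
  indep_ker G A z k m.
Proof.
move=> z0; split=> [[f [fk fi]]|[v [vk vi]]].
  have Lf i : L2 (f i) := (fk i).1.
  exists (fun i => embed (f i)); split=> [i|]; first exact/(ker_power_embed z k (Lf i)).
  exact/linearly_independent_embed.
have [f fP] := @choice _ _ (fun i g => L2 g /\ tiny G (fun n => v i n - embed g n))
  (fun i => let: ex_intro2 g Lg hg := approx_ker_embed z0 (vk i) in
    ex_intro _ g (conj Lg hg)).
have Lf i : L2 (f i) := (fP i).1.
exists f; split=> [i|].
  apply/(ker_power_embed z k (Lf i)); split; first exact: embed_bnd.
  have h := iter_shift_sub GU z k bA (tiny_subC GU (fP i).2).
  by apply: (tiny_sub GU h); exact: (vk i).2.
apply/linearly_independent_embed => // a ha; apply: vi.
have h : tiny G (fun n => \sum_(i < m) a i *: (v i n - embed (f i) n)).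
  elim: (index_enum _) => [|i s ih].
    by apply: (tiny_ext GU) (tiny0 GU _ _) => n; rewrite big_nil.
  by apply: (tiny_ext GU) (tinyD GU (tinyZ GU (a i) (fP i).2) ih) => n; rewrite big_cons.
apply: (tiny_ext GU) (tinyD GU h ha) => n; rewrite -big_split /=.
by apply: eq_bigr => i _; rewrite -scalerDr subrK.
Qed.

Lemma algebraic_multiplicityE z m K : z != 0 ->
  (forall k q, indep_ker G A z k q -> (q <= m)%N) -> indep_ker G A z K m ->
  algebraic_multiplicity W z = m%:R%:E.
Proof.
move=> z0 ub im.
have dimE k : (K <= k)%N -> dimension (ker_power W z k) = m%:R%:E.
  move=> Kk; apply/eqP; rewrite eq_le; apply/andP; split.
    apply: ub_ereal_sup => _ [q /= qf <-]; rewrite lee_fin ler_nat.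
    exact: (ub k q ((indep_ker_iff k q z0).1 qf)).
  apply: ereal_sup_ubound; exists m => //=; apply/(indep_ker_iff k m z0).
  exact: (indep_ker_le GU bA Kk im).
apply: cvg_lim => //; by apply: cvg_near_cst; exists K.
Qed.

(** A bounded inverse could be applied k times to the null class of the k-th iterate, and would show
    that f is null. *)
Lemma spectrum_ker z k f : ker_power W z k f -> ~ ae01 f (fun=> 0) -> spectrum W z.
Proof.
move=> [Lf fk] nf [S [[SL _ [M SM]] ST _]]; apply: nf.
elim: k fk => //= k ih fk; apply: ih.
set h := iter k _ f in fk *.
have Lh : L2 h := L2_iter_shifted W_measurable W_le1 z k Lf.
have LTh := L2_shifted W_measurable W_le1 z Lh.
have LST := SL _ LTh.
(* The inverse S acts on functions rather than on classes; its boundedness makes it send null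
   functions to null functions. *)
have S0 : ae01 (S (shifted_operator W z h)) (fun=> 0).
  apply/(L2norm_eq0 LST)/le_anti; rewrite sqrtr_ge0 andbT.
  by rewrite (le_trans (SM _ LTh))// ((L2norm_eq0 LTh).2 fk) mulr0.
have [N1 [mN1 N10 sN1]] := ST h Lh; have [N2 [mN2 N20 sN2]] := S0.
have := negligibleU (ex_intro _ N1 (And3 mN1 N10 sN1)) (ex_intro _ N2 (And3 mN2 N20 sN2)).
apply: negligibleS => x /= hx; apply: contrapT => /not_orP[h1 h2]; apply: hx => Ix.
have e1 : I01 x -> S (shifted_operator W z h) x = h x by apply: contrapT.
have e2 : I01 x -> S (shifted_operator W z h) x = 0 by apply: contrapT.
by rewrite -(e1 Ix) e2.
Qed.

Lemma spectrum_indep_ker z k m : z != 0 -> (0 < m)%N -> indep_ker G A z k m -> spectrum W z.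
Proof.
case: m => // m z0 _ /(indep_ker_iff k m.+1 z0)[f [fk fi]].
apply: (spectrum_ker (fk ord0)) => f0.
have Lf i : L2 (f i) := (fk i).1.
have := indep_not_tiny GU (i := ord0) ((linearly_independent_embed Lf).1 fi).
apply; apply: (tiny_ext GU) (tiny0 GU _ _) => n.
by rewrite (ae01_embed n (Lf ord0) f0).
Qed.

End multiplicities.

Section expansion.
Variable R : realType.
Local Notation RR := (measurableTypeR R).
Local Notation C := R[i].
Local Notation normc := Normc.normc.
Variable W : R * R -> R.
Hypothesis W_measurable : measurable_fun (I01 `*` I01) (W : RR * RR -> R).
Hypothesis W_le1 : forall p, (I01 `*` I01) p -> `|W p| <= 1.

(** The ultrafilter disappears from the conclusion: the traces converge in the ordinary sense, and
    for |z| >= eps the multiplicities along G are those of W. *)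
Lemma finite_spectral_expansion (eps : R) : 0 < eps -> exists s : seq C,
  [/\ forall z, z \in s -> eps <= normc z /\ spectrum W z,
    \sum_(z <- s) normc z ^+ 2 <= 1,
    forall l, (3 <= l)%N ->
      normc ((hom_density (@dicycle l) W)%:C - \sum_(z <- s) z ^+ l) <= eps ^+ (l - 2) &
    forall z, eps <= normc z -> algebraic_multiplicity W z = (count_mem z s)%:R%:E].
Proof.
move=> eps0.
have [G [GU Goo]] := ultraFilterLemma (@eventually_filter).
have bA := bnd_matrix_approx W_measurable W_le1.
have A1 := fnorm2_matrix_approx_le1 W_measurable W_le1.
have [L AL] : exists L, small G (fun n => fnorm (matrix_approx W n) ^+ 2 - L).
  by apply: (@ultra_limit _ _ GU _ 1) => n; rewrite ger0_norm ?sqr_ge0.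
have L1 : L <= 1.
  apply: (small_lim_le GU (y := fun=> 1)) AL _; first exact: nearW.
  by apply: small_ext (small0 GU) => n; rewrite subrr.
have [K LK] : exists K : nat, L <= K%:R * eps ^+ 2.
  exists (Num.truncn (L / eps ^+ 2)).+1.
  rewrite -ler_pdivrMr ?exprn_gt0//; exact: ltW (truncnS_gt _).
have [s [s1 s2 s3 s4]] := approx_spectral_expansion GU eps0 bA AL LK.
have nz z : eps <= normc z -> z != 0.
  by move=> ez; rewrite -normc_eq0 gt_eqF// (lt_le_trans eps0).
exists s; split.
- move=> z zs; have ez := s1 z zs; split => //.
  have [_ h] := s4 z ez.
  apply: (spectrum_indep_ker W_measurable W_le1 GU Goo (nz z ez) _ h).
  by rewrite -has_count has_pred1.
- exact: le_trans s2 L1.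
- move=> l l3; have At := small_cvg Goo (trace_matrix_approx_cvg W_measurable W_le1 (ltnW l3)).
  apply: le_trans (s3 l _ l3 At) _.
  by rewrite ler_piMr// exprn_ge0// ltW.
- move=> z ez; have [h1 h2] := s4 z ez.
  exact: (algebraic_multiplicityE W_measurable W_le1 GU Goo (nz z ez) h1 h2).
Qed.

End expansion.

Section count_sums.
Variables (T : choiceType) (V : nmodType).

Lemma big_undup_count (s : seq T) (F : T -> V) :
  \sum_(z <- s) F z = \sum_(z <- undup s) F z *+ count_mem z s.
Proof. by rewrite -big_undup_iterop_count. Qed.

Lemma big_count_subset (b s : seq T) (F : T -> V) : uniq b -> {subset s <= b} ->
  \sum_(z <- b) F z *+ count_mem z s = \sum_(z <- s) F z.
Proof.
move=> ub sb; rewrite big_undup_count (bigID (fun z => z \in s)) /= [X in _ + X]big1.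
  rewrite addr0 -big_filter; apply: perm_big; apply: uniq_perm.
  - exact: filter_uniq.
  - exact: undup_uniq.
  - move=> z; rewrite mem_filter mem_undup; apply/andP/idP => [[]//|zs].
    by split => //; exact: sb.
by move=> z /count_memPn ->.
Qed.

End count_sums.

Lemma digraphon_le1 (R : realType) (W : R * R -> R) p : digraphon W ->
  (I01 `*` I01) p -> `|W p| <= 1.
Proof.
case: p => x y [_ W0 W1] [/= Ix Iy]; rewrite ger0_norm; last exact: W0.
by rewrite (le_trans _ (W1 x y Ix Iy))// lerDl; exact: W0.
Qed.

(** * Convergence of the sum over the spectrum *)

Section multiplicity_sums.
Variables (R : realType) (W : R * R -> R).
Hypothesis W_digraphon : digraphon W.
Local Notation C := R[i].
Local Notation normc := Normc.normc.
Implicit Type z : C.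

Let mult z := fine (algebraic_multiplicity W z).

Let expansion (eps : R) (eps0 : 0 < eps) :=
  finite_spectral_expansion (let: And3 (conj m _) _ _ := W_digraphon in m)
    (fun p => @digraphon_le1 R W p W_digraphon) eps0.

Lemma algebraic_multiplicity_nat z : z != 0 ->
  exists n : nat, algebraic_multiplicity W z = n%:R%:E.
Proof.
rewrite -normc_eq0 => z0; have z0' : 0 < normc z by rewrite lt_neqAle normc_ge0 eq_sym z0.
have [s [_ _ _ sE]] := expansion z0'.
by exists (count_mem z s); rewrite sE.
Qed.

Lemma sum_mult_le1 (b : seq C) : uniq b -> (forall z, z \in b -> z != 0) ->
  \sum_(z <- b) mult z * normc z ^+ 2 <= 1.
Proof.
move=> ub b0.
have [e e0 eb] : exists2 e : R, 0 < e & forall z, z \in b -> e <= normc z.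
  elim: b b0 {ub} => [|z b ih] b0; first by exists 1.
  have [|e e0 eb] := ih; first by move=> y yb; apply: b0; rewrite inE yb orbT.
  have z0 : 0 < normc z.
    rewrite lt_neqAle normc_ge0 andbT eq_sym normc_eq0.
    by apply: b0; exact: mem_head.
  exists (Num.min e (normc z)); first by rewrite lt_min e0.
  by move=> y; rewrite inE => /orP[/eqP ->|/eb h]; rewrite ge_min ?lexx ?orbT// h.
have [s [_ s1 _ sE]] := expansion e0.
apply: le_trans s1.
(* Neither of b and s need contain the other; over their union the sum on s counts every point with
   its multiplicity, and the points outside b only add non-negative terms. *)
rewrite -(@big_count_subset _ _ (b ++ [seq z <- undup s | z \notin b]) s); last 2 first.
- rewrite cat_uniq ub filter_uniq ?undup_uniq// andbT.
  by apply/hasPn => z; rewrite mem_filter => /andP[].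
- by move=> z zs; rewrite mem_cat mem_filter mem_undup zs andbT orbN.
rewrite big_cat /= -[leLHS]addr0 lerD//.
  rewrite le_eqVlt; apply/orP; left; apply/eqP; rewrite big_seq [RHS]big_seq.
  by apply: eq_bigr => z /eb /sE; rewrite /mult => -> /=; rewrite mulr_natl.
by apply: sumr_ge0 => z _; rewrite mulrn_wge0// sqr_ge0.
Qed.

Lemma mult_ge0 z : z != 0 -> 0 <= mult z.
Proof. by move=> /algebraic_multiplicity_nat[n]; rewrite /mult => -> /=. Qed.

(** A point of positive multiplicity has modulus at most 1, by [sum_mult_le1] for that single point,
    so higher powers are smaller. *)
Lemma mult_normcX_le1 z l : z != 0 -> (2 <= l)%N ->
  mult z * normc (z ^+ l) <= mult z * normc z ^+ 2.
Proof.
move=> z0 l2; have [n nE] := algebraic_multiplicity_nat z0.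
have : mult z * normc z ^+ 2 <= 1.
  have := @sum_mult_le1 [:: z] isT; rewrite big_seq1; apply.
  by move=> y; rewrite inE => /eqP ->.
rewrite /mult nE /=; case: n {nE} => [|n] z1; first by rewrite !mul0r.
have {}z1 : normc z <= 1.
  rewrite -(@ler_pXn2r _ 2) ?nnegrE// expr1n; apply: le_trans z1.
  by rewrite ler_peMl ?exprn_ge0// ler1n.
by rewrite ler_wpM2l// normcX ler_wiXn2l.
Qed.

(** The tail estimate, independent of the number of points: |z|^l <= e^(l-2) |z|^2, and the weighted
    squares sum to at most 1. *)
Lemma sum_multX_le (e : R) (b : seq C) l : 0 <= e -> uniq b -> (2 <= l)%N ->
  (forall z, z \in b -> z != 0 /\ normc z <= e) ->
  \sum_(z <- b) mult z * normc (z ^+ l) <= e ^+ (l - 2).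
Proof.
move=> e0 ub l2 be.
apply: (@le_trans _ _ (\sum_(z <- b) e ^+ (l - 2) * (mult z * normc z ^+ 2))).
  rewrite big_seq [leRHS]big_seq; apply: ler_sum => z /be[z0 ze].
  rewrite mulrCA ler_wpM2l ?mult_ge0// normcX -{1}(subnK l2) exprD.
  by rewrite ler_wpM2r ?exprn_ge0// lerXn2r ?nnegrE.
rewrite -mulr_sumr ler_piMr ?exprn_ge0//.
by apply: sum_mult_le1 => // z /be[].
Qed.

Lemma summable_multiplicity l : (2 <= l)%N ->
  summable (spectrum W `\ 0)
    (fun z => algebraic_multiplicity W z * (normc (z ^+ l))%:E)%E.
Proof.
move=> l2; apply: (@le_lt_trans _ _ 1%E); last exact: ltry.
apply: ub_ereal_sup => _ [B [Bfin BD] <-].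
have B0 z : z \in fset_set B -> z != 0.
  by rewrite in_fset_set// => /set_mem /BD[_ /eqP].
rewrite fsbig_finite//= big_seq (eq_bigr (fun z => (mult z * normc (z ^+ l))%:E)); last first.
  move=> z /B0 z0; have [n nE] := algebraic_multiplicity_nat z0.
  by rewrite /mult nE /= ger0_norm// mulr_ge0.
rewrite -big_seq sumEFin lee_fin.
apply: le_trans (sum_mult_le1 (fset_uniq (fset_set B)) B0).
rewrite big_seq [leRHS]big_seq; apply: ler_sum => z /B0 z0.
exact: mult_normcX_le1.
Qed.

Lemma has_sum_multiplicity l : (3 <= l)%N ->
  has_sum (spectrum W `\ 0) (fun z => (mult z)%:C * z ^+ l) (hom_density (@dicycle l) W)%:C.
Proof.
move=> l3 d d0.
(* As e <= 1 and l - 2 >= 1, the power e^(l-2) is at most e. Two errors of at most d / 3 arise: the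
   expansion and the points of modulus below e. *)
pose e := Num.min 1 (d / 3).
have e0 : 0 < e by rewrite lt_min ltr01 divr_gt0.
have eX : e ^+ (l - 2) <= d / 3.
  apply: (@le_trans _ _ e); last by rewrite ge_min lexx orbT.
  have l21 : (0 < l - 2)%N by rewrite subn_gt0.
  by rewrite -(prednK l21) exprS ler_piMr ?(ltW e0)// exprn_ile1 ?(ltW e0)// ge_min lexx.
have [s [s1 _ s3 sE]] := expansion e0.
have nz z : e <= normc z -> z != 0.
  by move=> ez; rewrite -normc_eq0 gt_eqF// (lt_le_trans e0).
exists [set` undup s].
  split; first exact: finite_seq.
  move=> z /=; rewrite mem_undup => /s1[ez zS]; split => //.
  exact/eqP/nz.
move=> B [Bfin BD] sB.
have B0 z : z \in fset_set B -> z != 0.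
  by rewrite in_fset_set// => /set_mem /BD[_ /eqP].
rewrite fsbig_finite//= (bigID (fun z => e <= normc z)) /=.
set t := (hom_density _ _)%:C; set b := fset_set B.
(* Points of B of modulus at least e that are absent from s have multiplicity 0, so enlarging s to B
   changes nothing here. *)
have -> : \sum_(z <- b | e <= normc z) (mult z)%:C * z ^+ l = \sum_(z <- s) z ^+ l.
  rewrite -big_filter -(@big_count_subset _ _ [seq z <- b | e <= normc z] s).
  - rewrite big_seq [RHS]big_seq; apply: eq_bigr => z; rewrite mem_filter => /andP[ez _].
    by rewrite /mult sE//= rmorph_nat mulr_natl.
  - exact/filter_uniq/fset_uniq.
  - move=> z zs; rewrite mem_filter; have [ez _] := s1 z zs; rewrite ez /=.
    by rewrite in_fset_set//; apply/mem_set/sB => /=; rewrite mem_undup.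
have h1 : normc (\sum_(z <- s) z ^+ l - t) <= d / 3.
  by rewrite -opprB normcN; apply: le_trans (s3 l l3) eX.
have h2 : normc (\sum_(z <- b | ~~ (e <= normc z)) (mult z)%:C * z ^+ l) <= d / 3.
  apply: le_trans eX; rewrite -big_filter (le_trans (ler_normc_sum _ _ _))//.
  have bP z : z \in [seq z <- b | ~~ (e <= normc z)] -> z != 0 /\ normc z <= e.
    by rewrite mem_filter -ltNge => /andP[/ltW ze /B0].
  apply: le_trans (sum_multX_le (ltW e0) (filter_uniq _ (fset_uniq b)) (ltnW l3) bP).
  rewrite big_seq [leRHS]big_seq; apply: ler_sum => z /bP[z0 _].
  by rewrite Normc.normcM normc_real ger0_norm// mult_ge0.
rewrite addrAC (le_lt_trans (le_normcD _ _))//.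
by have := lerD h1 h2; lra.
Qed.

End multiplicity_sums.

Theorem theorem7 (R : realType) (W : R * R -> R) (l : nat) :
  digraphon W -> (3 <= l)%N ->
  summable (spectrum W `\ 0)
    (fun z => algebraic_multiplicity W z * (Normc.normc (z ^+ l))%:E)%E
  /\
  has_sum (spectrum W `\ 0)
    (fun z => (fine (algebraic_multiplicity W z))%:C * z ^+ l)
    (hom_density (@dicycle l) W)%:C.
Proof.
move=> Wd l3; split; first exact: summable_multiplicity (ltnW l3).
exact: has_sum_multiplicity.
Qed.
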